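(* Let $d\geq 1$, $\beta>0$, and let $D$ be the $\beta$-LRP metric on $\mathbb{R}^d$. Then for every $a\geq 0$ and every $\bm x\in \mathbb{S}=\{\bm x\in\mathbb{R}^d: |\bm x|=1\}$, $$\lim_{\varepsilon\to 0^+}\mathbb{P}\left[D(\bm 0,\bm x)\in(a-\varepsilon,a+\varepsilon)\right]=0.$$
   Context: Critical ($\beta$-)long-range percolation on $\mathbb{Z}^d$: each pair $\bm i,\bm j$ with $\|\bm i-\bm j\|_\infty=1$ is joined by an edge with probability $1$, and each pair with $\|\bm i-\bm j\|_\infty>1$ is joined, independently, with probability $1-\exp\{-\beta\int_{V_1(\bm i)}\int_{V_1(\bm j)}|\bm u-\bm v|^{-2d}\,d\bm u\,d\bm v\}$, where $V_1(\bm i)$ is the cube of side length $1$ centered at $\bm i$ and $|\cdot|$ is the Euclidean norm. Let $d(\cdot,\cdot)$ be the graph distance, $\bm 1=(1,\dots,1)$, $a_n$ the median of $d(\bm 0,n\bm 1)$, and $D_n(\bm x,\bm y)=a_n^{-1}d(\lfloor n\bm x\rfloor,\lfloor n\bm y\rfloor)$. It is known that $D_n$ converges in law, with respect to the topology of local uniform convergence on $\mathbb{R}^{2d}$, to a unique random metric $D$ on $\mathbb{R}^d$; this limit is called the $\beta$-LRP metric. *)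

(* Defs.v *)
From HB Require Import structures.
From mathcomp Require Import all_boot all_order all_algebra.
From mathcomp Require Import all_classical all_reals all_analysis.
Set Implicit Arguments. Unset Strict Implicit. Unset Printing Implicit Defensive.
Import Order.TTheory GRing.Theory Num.Theory.
Import numFieldNormedType.Exports.
Local Open Scope classical_set_scope.
Local Open Scope ring_scope.

Definition vtx (d : nat) := 'rV[int]_d.

Definition linf (d : nat) (i j : vtx d) : nat := \max_(k < d) `|i ord0 k - j ord0 k|%N.

Definition enorm {R : realType} (d : nat) (x : 'rV[R]_d) : R :=
  Num.sqrt (\sum_(k < d) x ord0 k ^+ 2).

Fixpoint walk {V : Type} (E : V -> V -> bool) (n : nat) (x y : V) : Prop :=
  match n with
  | 0 => x = y
  | n'.+1 => exists z, E x z /\ walk E n' z y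
  end.

(* graph distance (infimum of walk lengths; the graphs considered are connected) *)
Definition gdist {R : realType} {V : Type} (E : V -> V -> bool) (x y : V) : R :=
  inf [set (n%:R : R) | n in [set n : nat | walk E n x y]].

Fixpoint cube_int {R : realType} (k : nat) (c : nat -> R)
    (f : (nat -> R) -> \bar R) : \bar R :=
  match k with
  | 0 => f (fun _ => 0)
  | k'.+1 => (\int[@lebesgue_measure R]_(t in `[(c k' - 2^-1)%R, (c k' + 2^-1)%R])
               cube_int k' c (fun z => f (fun m => if m == k' then t else z m)))%E
  end.

(* \int_{V_1(i)} \int_{V_1(j)} |u - v|^{-2d} du dv ;
   coordinates 0..d-1 of w are u, coordinates d..2d-1 are v *)
Definition lrp_kernel_int {R : realType} (d : nat) (i j : vtx d) : R :=
  fine (cube_int (d + d)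
          (fun m => if (m < d)%N then ((oapp (fun k : 'I_d => i ord0 k) 0 (insub m))%:~R : R)
                    else (oapp (fun k : 'I_d => j ord0 k) 0 (insub (m - d)%N))%:~R)
          (fun w => ((\sum_(k < d) (w k - w (d + k)%N) ^+ 2) ^- d)%:E)).

Definition lrp_edge_prob {R : realType} (d : nat) (beta : R) (i j : vtx d) : R :=
  1 - expR (- (beta * lrp_kernel_int i j)).

Definition is_LRP {R : realType} {dO : measure_display} {Omega : measurableType dO}
    (P : probability Omega R) (d : nat) (beta : R)
    (E : Omega -> vtx d -> vtx d -> bool) : Prop :=
  [/\ (forall w i j, E w i j = E w j i),
      (forall w i j, linf i j = 1%N -> E w i j),
      (forall i j, measurable [set w | E w i j]),
      (forall i j, (1 < linf i j)%N ->
         P [set w | E w i j] = (lrp_edge_prob beta i j)%:E) &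
      (forall s : seq (vtx d * vtx d), uniq s ->
         (forall p, p \in s -> (1 < linf p.1 p.2)%N /\ (p.2, p.1) \notin s) ->
         P (\big[setI/setT]_(p <- s) [set w | E w p.1 p.2]) =
         (\prod_(p <- s) fine (P [set w | E w p.1 p.2]))%:E)].

Definition floor_scale {R : realType} (d : nat) (n : nat) (x : 'rV[R]_d) : vtx d :=
  \row_k Num.floor (n%:R * x ord0 k).

Definition is_median_seq {R : realType} {dO : measure_display} {Omega : measurableType dO}
    (P : probability Omega R) (d : nat) (E : Omega -> vtx d -> vtx d -> bool)
    (a : nat -> R) : Prop :=
  forall n : nat,
    (2^-1%:E <= P [set w | (gdist (E w) (0%R : vtx d) (const_mx n%:Z : vtx d) <= a n)%R])%E /\
    (2^-1%:E <= P [set w | (a n <= gdist (E w) (0%R : vtx d) (const_mx n%:Z : vtx d))%R])%E.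

Definition Dn {R : realType} {Omega : Type} (d : nat)
    (E : Omega -> vtx d -> vtx d -> bool) (a : nat -> R) (n : nat) (w : Omega)
    (xy : 'rV[R]_d * 'rV[R]_d) : R :=
  (a n)^-1 * gdist (E w) (floor_scale n xy.1) (floor_scale n xy.2).

(* convergence in law w.r.t. the topology of local uniform (= compact) convergence
   on functions R^d x R^d -> R *)
Definition cvg_in_law_lu {R : realType} {dO dO' : measure_display}
    {Omega : measurableType dO} {Omega' : measurableType dO'}
    (P : probability Omega R) (P' : probability Omega' R) (d : nat)
    (X : nat -> Omega -> 'rV[R]_d * 'rV[R]_d -> R)
    (Y : Omega' -> 'rV[R]_d * 'rV[R]_d -> R) : Prop :=
  forall F : {family compact, 'rV[R]_d * 'rV[R]_d -> R} -> R,
    continuous F -> (exists M : R, forall f, `|F f| <= M) ->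
    (fun n => (\int[P]_w (F (X n w))%:E)%E) @ \oo --> (\int[P']_w (F (Y w))%:E)%E.

(* Main.v *)
(* Let m be the mass of a putative atom of D(0, x).  Only edges near the origin are
   resampled, in boxes of radius of order n much smaller than |x|.

   By the continuity of D, on the event that D(0, x) is close to a0, and up to a small
   probability, one sees this event already in the configuration outside a box of
   radius 6 n around 0.  Given that configuration, with a probability that does not
   depend on the scale n, the annulus around 0 is slow: no edge jumps over it, and
   crossing it costs at least c a_n.  (The inequality of Harris reduces this to pairs
   of small balls; D(y, z) cannot vanish almost surely for y <> z, since the lattice
   symmetries would then make d(0, k 1) negligible against the median a_k.)  Then one
   resamples the long edges between the inner and the outer part of the annulus: when
   there are none, D(0, x) exceeds by a definite amount the value that it has when
   every pair of small cubes is joined by an edge, so that at least one of the two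
   choices moves D(0, x) out of a small window around a0.  Hence a fixed proportion of
   the event leaves the smaller window while it stays in the larger one, and the
   masses of shrinking windows cannot converge to m > 0. *)

Require Import Defs.
From HB Require Import structures.
From mathcomp Require Import all_boot all_order all_algebra fingroup perm.
From mathcomp Require Import all_classical all_reals all_analysis.
From mathcomp Require Import measurable_realfun zify ring lra.
Set Implicit Arguments. Unset Strict Implicit. Unset Printing Implicit Defensive.
Import Order.TTheory GRing.Theory Num.Theory.
Import numFieldNormedType.Exports.
Local Open Scope classical_set_scope.
Local Open Scope ring_scope.

(** * Walks and graph distance *)

(** The order of the choices makes the argument close. Edges are resampled at a scale [n], but
    [D(0, x)] is read at a scale [M = N * n]: the box of radius [tau * n] has to be so small
    compared with [M] that distances from 0 in it stay below [del * a M]. The gain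
    [g = b * W * m / 2] is fixed before the windows, from constants that hold at all large scales.
    The radius [r], and with it [del], [N] and the growth constant [C], come later, and [eta] last,
    so small that [eta * a M] is below the effect of the resampling, which is of order [a n].
    Independence is used only on finite Bernoulli products, with one coordinate for each long edge
    of a box of radius [L], chosen after everything else; [trunc_ok] leads back to the infinite
    graph. Convergence in law speaks of continuous functionals only. Tightness, growth of the
    medians, vanishing of [D] on the diagonal and the comparison of windows are all obtained from
    one family of them, suprema of Lipschitz functions of the distance over subsets of compact
    sets. *)

Definition restr {V : Type} (S : pred V) (G : V -> V -> bool) (x y : V) : bool :=
  [&& S x, S y & G x y].

Section Walks.
Variable V : Type.
Implicit Types (G H : V -> V -> bool) (x y z : V) (S : pred V).

Lemma walk_cat G m n x y z :
  walk G m x y -> walk G n y z -> walk G (m + n)%N x z.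
Proof.
elim: m x => [|m IH] x /= => [-> //|[u [xu uy]] yz].
by exists u; split=> //; exact: IH.
Qed.

Lemma walk1 G x y : G x y -> walk G 1 x y.
Proof. by move=> xy; exists y. Qed.

Lemma walk_sub G H m x y : (forall u v, G u v -> H u v) ->
  walk G m x y -> walk H m x y.
Proof.
move=> GH; elim: m x => [//|m IH] x /= [u [xu /IH uy]].
by exists u; split=> //; exact: GH.
Qed.

Lemma restr_sub S G x y : restr S G x y -> G x y.
Proof. by case/and3P. Qed.

(** The piece after the last visit to [S] uses no edge that touches [S]; this is what later
    separates what happens outside a box from what is resampled inside. *)
Lemma walk_last_exit S G m x y : walk G m x y -> ~~ S y ->
  walk (restr (predC S) G) m x y \/
  exists m1 m2 u v, [/\ walk G m1 x u, S u, G u v, ~~ S v &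
    walk (restr (predC S) G) m2 v y /\ m = (m1 + m2).+1].
Proof.
elim: m x => [|m IH] x /=; first by left.
move=> [z [xz zy]] nSy; case: (IH _ zy nSy) => [wz|].
  have nSz : ~~ S z.
    by case: m {IH zy} wz => [-> //|m] /= [t [/and3P[]]].
  case: (boolP (S x)) => Sx; last by left; exists z; split=> //; apply/and3P.
  by right; exists 0%N, m, x, z; split.
move=> [m1 [m2 [u [v [xu Su uv nSv [vy ->]]]]]].
by right; exists m1.+1, m2, u, v; split=> //; exists z.
Qed.

Lemma walk_first_exit S G m x y : walk G m x y -> S x -> ~~ S y ->
  exists m1 m2 u v, [/\ walk (restr S G) m1 x u, S u, G u v, ~~ S v &
    walk G m2 v y /\ m = (m1 + m2).+1].
Proof.
elim: m x => [|m IH] x /=; first by move=> -> ->.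
move=> [z [xz zy]] Sx nSy; case: (boolP (S z)) => Sz; last first.
  by exists 0%N, m, x, z; split.
have [m1 [m2 [u [v [zu Su uv nSv [vy ->]]]]]] := IH _ zy Sz nSy.
by exists m1.+1, m2, u, v; split=> //; exists z; split=> //; apply/and3P.
Qed.

(** The value 0 for pairs that no walk joins is a mere default: the percolation graphs contain all
    nearest-neighbour edges and are connected. *)
Definition nd G x y : nat :=
  if pselect (exists n, `[< walk G n x y >]) is left h then ex_minn h else 0%N.

Definition conn G := forall x y, exists n, walk G n x y.

Lemma nd_walk G x y : conn G -> walk G (nd G x y) x y.
Proof.
move=> Gc; rewrite /nd; case: pselect => [h|[]].
  by case: ex_minnP => n /asboolP.
by have [n xy] := Gc x y; exists n; apply/asboolP.
Qed.

Lemma nd_le G n x y : walk G n x y -> (nd G x y <= n)%N.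
Proof.
move=> xy; rewrite /nd; case: pselect => [h|//].
by case: ex_minnP => k _; apply; apply/asboolP.
Qed.

Lemma nd_triangle G x y z : conn G -> (nd G x z <= nd G x y + nd G y z)%N.
Proof.
by move=> Gc; apply: nd_le; apply: (@walk_cat _ _ _ _ y); exact: nd_walk.
Qed.

Lemma nd_mono G H x y : conn G -> (forall u v, G u v -> H u v) ->
  (nd H x y <= nd G x y)%N.
Proof. by move=> Gc GH; apply: nd_le; apply: (walk_sub GH); exact: nd_walk. Qed.

Lemma nd_xx G x : nd G x x = 0%N.
Proof. by apply/eqP; rewrite -leqn0; apply: nd_le. Qed.

Lemma nd_eq0 G x y : conn G -> nd G x y = 0%N -> x = y.
Proof. by move=> Gc d0; have := nd_walk x y Gc; rewrite d0. Qed.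

Lemma nd_bij G (g : V -> V) (h : V -> V) x y : cancel g h -> cancel h g ->
  conn G -> nd (fun u v => G (g u) (g v)) x y = nd G (g x) (g y).
Proof.
move=> gK hK Gc.
have w1 n u v : walk (fun u v => G (g u) (g v)) n u v -> walk G n (g u) (g v).
  elim: n u => [|n IH] u /= => [-> //|[t [ut /IH tv]]].
  by exists (g t).
have w2 n u v : walk G n u v -> walk (fun u v => G (g u) (g v)) n (h u) (h v).
  elim: n u => [|n IH] u /= => [-> //|[t [ut /IH tv]]].
  by exists (h t); rewrite !hK.
have Gc' : conn (fun u v => G (g u) (g v)).
  by move=> u v; have [n /w2] := Gc (g u) (g v); rewrite !gK; exists n.
apply/eqP; rewrite eqn_leq; apply/andP; split; apply: nd_le.
  by have := w2 _ _ _ (nd_walk (g x) (g y) Gc); rewrite !gK.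
exact/w1/nd_walk.
Qed.

Lemma gdistE (R : realType) G x y : conn G -> gdist G x y = (nd G x y)%:R :> R.
Proof.
move=> Gc; rewrite /gdist; set A := (X in inf X).
have Ad : A (nd G x y)%:R by exists (nd G x y) => //; exact: nd_walk.
have lbA : lbound A (nd G x y)%:R.
  by move=> _ [n /nd_le nn <-]; rewrite ler_nat.
apply/eqP; rewrite eq_le; apply/andP; split.
  by apply: ge_inf => //; exists (nd G x y)%:R.
by apply: lb_le_inf => //; exists (nd G x y)%:R.
Qed.

End Walks.

(** * The sup distance on the lattice *)

Section Linf.
Variable d : nat.
Implicit Types (i j p : vtx d).

Lemma vtxP i j : (forall k, i ord0 k = j ord0 k) -> i = j.
Proof. by move=> h; apply/matrixP => a k; have -> : a = ord0 by exact: ord1. Qed.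

Lemma linf_leP i j r :
  reflect (forall k, (`|i ord0 k - j ord0 k| <= r)%N) (linf i j <= r)%N.
Proof.
apply: (iffP idP) => [h k|h]; last by apply/bigmax_leqP => k _.
by apply: leq_trans h; rewrite /linf (bigD1 k) //= leq_maxl.
Qed.

Lemma linf_ge i j k : (`|i ord0 k - j ord0 k| <= linf i j)%N.
Proof. exact/linf_leP. Qed.

Lemma linf_sym i j : linf i j = linf j i.
Proof. by apply: eq_bigr => k _; rewrite distnC. Qed.

Lemma linf_triangle i j p : (linf i p <= linf i j + linf j p)%N.
Proof.
apply/linf_leP => k; apply: leq_trans (leq_add (linf_ge i j k) (linf_ge j p k)).
by lia.
Qed.

Lemma linf_xx i : linf i i = 0%N.
Proof. by apply/eqP; rewrite -leqn0; apply/linf_leP => k; rewrite subrr. Qed.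

Lemma linf_eq0 i j : linf i j = 0%N -> i = j.
Proof.
by move=> h; apply: vtxP => k;
have := linf_ge i j k; rewrite h; lia.
Qed.

Lemma linf_attained i j : (0 < linf i j)%N ->
  exists k, linf i j = `|i ord0 k - j ord0 k|%N.
Proof.
move=> h; have [e|ne] := pickP (fun k : 'I_d => linf i j <= `|i ord0 k - j ord0 k|)%N.
  by move=> le; exists e; apply/eqP; rewrite eqn_leq le linf_ge.
have : (linf i j <= (linf i j).-1)%N.
  by apply/linf_leP => k; have := ne k; lia.
lia.
Qed.

Definition nn_graph (G : vtx d -> vtx d -> bool) :=
  forall i j, linf i j = 1%N -> G i j.

Lemma nn_walk G i j : nn_graph G -> walk G (linf i j) i j.
Proof.
move=> nG; suff H r : forall i, linf i j = r -> walk G r i j by exact: H.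
elim: r {i} => [|r IH] i lij.
  exact: linf_eq0.
(* All coordinates move by one towards [j] at once, so the sup distance drops by one. *)
pose z : vtx d := \row_k (i ord0 k + sgz (j ord0 k - i ord0 k)).
have [k0 k0E] : exists k, linf i j = `|i ord0 k - j ord0 k|%N.
  by apply: linf_attained; rewrite lij.
have zk k : z ord0 k = i ord0 k + sgz (j ord0 k - i ord0 k) by rewrite mxE.
exists z; split.
  apply: nG; apply/eqP; rewrite eqn_leq; apply/andP; split.
    by apply/linf_leP => k; rewrite zk; case: (sgzP (j ord0 k - i ord0 k)); lia.
  apply: leq_trans (linf_ge _ _ k0).
  by rewrite zk; case: (sgzP (j ord0 k0 - i ord0 k0)); lia.
apply: IH; apply/eqP; rewrite eqn_leq; apply/andP; split.
  apply/linf_leP => k; rewrite zk; have := linf_ge i j k; rewrite lij.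
  by case: (sgzP (j ord0 k - i ord0 k)); lia.
apply: leq_trans (linf_ge _ _ k0).
by rewrite zk; case: (sgzP (j ord0 k0 - i ord0 k0)); lia.
Qed.

Lemma nn_conn G : nn_graph G -> conn G.
Proof. by move=> nG i j; exists (linf i j); exact: nn_walk. Qed.

End Linf.

(** * Finite Bernoulli product measures *)

(** Expectation over independent Bernoulli coordinates with parameters [ps], by conditioning on the
    first coordinate. *)
Fixpoint Eb {R : realType} (ps : seq R) (F : seq bool -> R) : R :=
  match ps with
  | [::] => F [::]
  | p :: ps' => p * Eb ps' (fun s => F (true :: s)) +
                (1 - p) * Eb ps' (fun s => F (false :: s))
  end.

Definition Pb {R : realType} (ps : seq R) (A : seq bool -> Prop) : R :=
  Eb ps (fun s => (`[< A s >])%:R).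

Definition leb (s t : seq bool) : bool := all2 implb s t.

Definition bup (n : nat) (A : seq bool -> Prop) : Prop :=
  forall s t, size s = n -> size t = n -> leb s t -> A s -> A t.

Definition bdown (n : nat) (A : seq bool -> Prop) : Prop :=
  forall s t, size s = n -> size t = n -> leb s t -> A t -> A s.

Definition dep {T : Type} (m : seq bool) (F : seq bool -> T) : Prop :=
  forall s t, size s = size m -> size t = size m -> mask m s = mask m t -> F s = F t.

Definition off (m s : seq bool) : bool := ~~ has id (mask m s).

Definition erase (m s : seq bool) : seq bool :=
  [seq ~~ x.1 && x.2 | x <- zip m s].

Definition cmask (m : seq bool) : seq bool := map negb m.

Section Bernoulli.
Variable R : realType.
Implicit Types (ps : seq R) (F G : seq bool -> R) (A B : seq bool -> Prop).
Implicit Types (s t m : seq bool).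

Definition probs ps := all (fun p => 0 <= p <= 1) ps.

Lemma eq_Eb ps F G : (forall s, size s = size ps -> F s = G s) -> Eb ps F = Eb ps G.
Proof.
elim: ps F G => [|p ps IH] F G h /=; first exact: h.
by congr (_ * _ + _ * _); apply: IH => s ss; apply: h => /=; rewrite ss.
Qed.

Lemma le_Eb ps F G : probs ps -> (forall s, size s = size ps -> F s <= G s) ->
  Eb ps F <= Eb ps G.
Proof.
elim: ps F G => [|p ps IH] F G /=; first by move=> _; apply.
move=> /andP[/andP[p0 p1] pps] h.
by apply: lerD; apply: ler_wpM2l; rewrite ?subr_ge0 //;
  apply: IH => // s ss; apply: h => /=; rewrite ss.
Qed.

Lemma EbD ps F G : Eb ps (fun s => F s + G s) = Eb ps F + Eb ps G.
Proof. by elim: ps F G => [//|p ps IH] F G /=; rewrite !IH; ring. Qed.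

Lemma Eb_cst ps c : Eb ps (fun=> c) = c.
Proof. by elim: ps => [//|p ps IH] /=; rewrite IH; ring. Qed.

(** Induction on the coordinates. Once the induction hypothesis is applied under both values of the
    first coordinate, the remaining difference is [p * (1 - p) * (f1 - f0) * (g1 - g0)], and both
    conditional expectations increase with that coordinate. *)
Lemma harris_E ps F G : probs ps ->
  (forall s t, size s = size ps -> size t = size ps -> leb s t -> F s <= F t) ->
  (forall s t, size s = size ps -> size t = size ps -> leb s t -> G s <= G t) ->
  Eb ps F * Eb ps G <= Eb ps (fun s => F s * G s).
Proof.
elim: ps F G => [//|p ps IH] F G /= /andP[/andP[p0 p1] pps] hF hG.
have sub H b : (forall s t, size s = (size ps).+1 -> size t = (size ps).+1 ->
    leb s t -> H s <= H t) ->
  forall s t, size s = size ps -> size t = size ps -> leb s t ->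
    (H (b :: s) : R) <= H (b :: t).
  by move=> hH s t ss st st'; apply: hH; rewrite /= ?ss ?st //; case: b.
have dif H : (forall s t, size s = (size ps).+1 -> size t = (size ps).+1 ->
    leb s t -> H s <= H t) ->
  Eb ps (fun s => (H (false :: s) : R)) <= Eb ps (fun s => H (true :: s)).
  move=> hH; apply: le_Eb => // s ss; apply: hH; rewrite /= ?ss //.
  by elim: s {ss} => //= -[] s.
have h1 := IH _ _ pps (sub F true hF) (sub G true hG).
have h0 := IH _ _ pps (sub F false hF) (sub G false hG).
have f10 := dif F hF; have g10 := dif G hG.
apply: le_trans (lerD (ler_wpM2l p0 h1) (ler_wpM2l _ h0)); last by rewrite subr_ge0.
move: f10 g10; set f1 := Eb ps (fun s => F (true :: s)).
set f0 := Eb ps (fun s => F (false :: s)); set g1 := Eb ps (fun s => G (true :: s)).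
set g0 := Eb ps (fun s => G (false :: s)) => f10 g10.
rewrite -subr_ge0 (_ : _ - _ = p * (1 - p) * ((f1 - f0) * (g1 - g0))); last by ring.
by rewrite !mulr_ge0 ?subr_ge0.
Qed.

(** At each coordinate one of the two functions ignores it, so the two conditional expectations of
    that function agree and factor out. *)
Lemma Eb_indep ps m F G : size m = size ps -> dep m F -> dep (cmask m) G ->
  Eb ps (fun s => F s * G s) = Eb ps F * Eb ps G.
Proof.
elim: ps m F G => [//|p ps IH] [//|b m] F G /= [sm] dF dG.
have cons b' c T (H : seq bool -> T) (m' : seq bool) :
    dep (b' :: m') H -> dep m' (fun s => H (c :: s)).
  move=> dH s t ss st e; apply: dH => /=; rewrite ?ss ?st //.
  by case: b' => //=; rewrite e.
rewrite !(IH m) //; try exact: cons dF; try exact: cons dG.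
case: b dF dG => /= dF dG.
  have -> : Eb ps (fun s => G (true :: s)) = Eb ps (fun s => G (false :: s)).
    by apply: eq_Eb => s ss; apply: dG => //=; rewrite size_map sm ss.
  by ring.
have -> : Eb ps (fun s => F (true :: s)) = Eb ps (fun s => F (false :: s)).
  by apply: eq_Eb => s ss; apply: dF => //=; rewrite sm ss.
by ring.
Qed.

Lemma Pb_sub ps A B : probs ps -> (forall s, size s = size ps -> A s -> B s) ->
  Pb ps A <= Pb ps B.
Proof.
move=> pps AB; apply: le_Eb => // s ss.
case: asboolP => [/(AB _ ss) Bs|_]; last exact: ler0n.
by rewrite (asboolT Bs).
Qed.

Lemma eq_Pb ps A B : (forall s, size s = size ps -> A s <-> B s) -> Pb ps A = Pb ps B.
Proof.
move=> AB; apply: eq_Eb => s /AB h; congr (_%:R); congr nat_of_bool.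
exact/asbool_equiv_eq.
Qed.

Lemma Pb_ge0 ps A : probs ps -> 0 <= Pb ps A.
Proof.
by move=> pps; rewrite -(Eb_cst ps 0); apply: le_Eb => // s _; exact: ler0n.
Qed.

Lemma PbC ps A : Pb ps (fun s => ~ A s) = 1 - Pb ps A.
Proof.
suff <- : Pb ps (fun s => ~ A s) + Pb ps A = 1 by rewrite addrK.
rewrite /Pb -EbD -[RHS](Eb_cst ps 1).
by apply: eq_Eb => s _; rewrite asbool_neg; case: asboolP => _; rewrite /=; ring.
Qed.

Lemma PbDI ps A B : Pb ps A = Pb ps (fun s => A s /\ B s) + Pb ps (fun s => A s /\ ~ B s).
Proof.
rewrite /Pb -EbD; apply: eq_Eb => s _; rewrite !asbool_and asbool_neg.
by do 2 case: asboolP => _; rewrite /=; ring.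
Qed.

Lemma Pb_indep ps m A B : size m = size ps -> dep m A -> dep (cmask m) B ->
  Pb ps (fun s => A s /\ B s) = Pb ps A * Pb ps B.
Proof.
move=> sm dA dB; rewrite /Pb -(Eb_indep (m := m)) //.
- by apply: eq_Eb => s _; rewrite asbool_and; do 2 case: asboolP => _; rewrite /=; ring.
- by move=> s t ss st e; rewrite (dA s t).
- by move=> s t ss st e; rewrite (dB s t).
Qed.

Lemma harris_up ps A B : probs ps -> bup (size ps) A -> bup (size ps) B ->
  Pb ps A * Pb ps B <= Pb ps (fun s => A s /\ B s).
Proof.
move=> pps uA uB.
have mono C : bup (size ps) C -> forall s t, size s = size ps -> size t = size ps ->
    leb s t -> (`[< C s >])%:R <= (`[< C t >])%:R :> R.
  move=> uC s t ss st le; rewrite ler_nat; case: asboolP => // Cs.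
  by rewrite asboolT //; exact: uC Cs.
apply: le_trans (harris_E pps (mono _ uA) (mono _ uB)) _.
by apply: le_Eb => // s _; rewrite asbool_and; do 2 case: asboolP => _; rewrite /=; lra.
Qed.

(** Complements of decreasing events are increasing, and passing to both complements does not change
    the covariance. *)
Lemma harris_down ps A B : probs ps -> bdown (size ps) A -> bdown (size ps) B ->
  Pb ps A * Pb ps B <= Pb ps (fun s => A s /\ B s).
Proof.
move=> pps dA dB.
have up C : bdown (size ps) C -> bup (size ps) (fun s => ~ C s).
  by move=> dC s t ss st le nC Ct; apply: nC; exact: dC Ct.
have := harris_up pps (up _ dA) (up _ dB).
have e1 := PbDI ps A B.
have e2 := PbDI ps (fun s => ~ B s) A.
have e3 := PbC ps A; have e4 := PbC ps B.
rewrite (@eq_Pb ps (fun s => ~ B s /\ A s) (fun s => A s /\ ~ B s)) in e2; last first.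
  by move=> s _; split=> -[].
rewrite (@eq_Pb ps (fun s => ~ B s /\ ~ A s) (fun s => ~ A s /\ ~ B s)) in e2; last first.
  by move=> s _; split=> -[].
nra.
Qed.

Lemma harris_up_seq (T : Type) ps (r : seq T) (A : T -> seq bool -> Prop) c :
  probs ps -> 0 <= c ->
  (forall x, bup (size ps) (A x)) -> (forall x, List.In x r -> c <= Pb ps (A x)) ->
  c ^+ size r <= Pb ps (fun s => forall x, List.In x r -> A x s).
Proof.
move=> pps c0 uA; elim: r => [|x r IH] h.
  rewrite expr0 -(Eb_cst ps 1); apply: le_Eb => // s _.
  by rewrite asboolT // => x [].
rewrite exprS.
apply: (@le_trans _ _ (Pb ps (A x) * Pb ps (fun s => forall y, List.In y r -> A y s))).
  apply: ler_pM => //; [exact: exprn_ge0| by apply: h; left |].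
  by apply: IH => y yr; apply: h; right.
apply: le_trans (harris_up pps (uA x) _) _.
  by move=> s t ss st le h' y yr; apply: (uA y s t) => //; exact: h'.
by apply: Pb_sub => // s _ [Ax Ar] y [<-//|]; exact: Ar.
Qed.

Lemma harris_down_seq (T : Type) ps (r : seq T) (A : T -> seq bool -> Prop) (c : T -> R) :
  probs ps -> (forall x, 0 <= c x) ->
  (forall x, bdown (size ps) (A x)) -> (forall x, List.In x r -> c x <= Pb ps (A x)) ->
  \prod_(x <- r) c x <= Pb ps (fun s => forall x, List.In x r -> A x s).
Proof.
move=> pps c0 uA; elim: r => [|x r IH] h.
  rewrite big_nil -(Eb_cst ps 1); apply: le_Eb => // s _.
  by rewrite asboolT // => x [].
rewrite big_cons.
apply: (@le_trans _ _ (Pb ps (A x) * Pb ps (fun s => forall y, List.In y r -> A y s))).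
  apply: ler_pM => //; [exact: prodr_ge0| by apply: h; left |].
  by apply: IH => y yr; apply: h; right.
apply: le_trans (harris_down pps (uA x) _) _.
  by move=> s t ss st le h' y yr; apply: (uA y s t) => //; exact: h'.
by apply: Pb_sub => // s _ [Ax Ar] y [<-//|]; exact: Ar.
Qed.

Lemma Pb_off ps m : size m = size ps ->
  Pb ps (fun s => off m s) = \prod_(p <- mask m ps) (1 - p).
Proof.
rewrite /Pb; elim: ps m => [|p ps IH] [|b m] //= => [_|[sm]].
  by rewrite big_nil (asboolT (P := true)).
case: b => /=.
  rewrite big_cons -IH //.
  rewrite (@eq_Eb ps _ (fun=> 0)); last by move=> s _; rewrite asboolF.
  by rewrite Eb_cst mulr0 add0r.
by rewrite -IH // -mulrDl addrC subrK mul1r.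
Qed.

(** An edge of weight [x] is closed with probability [expR (- x)], so only the total weight of the
    selected edges matters. *)
Lemma Pb_off_exp ps (xs : seq R) m : size m = size ps ->
  ps = [seq 1 - expR (- x) | x <- xs] ->
  Pb ps (fun s => off m s) = expR (- \sum_(x <- mask m xs) x).
Proof.
move=> sm pE; rewrite Pb_off // pE -map_mask big_map.
rewrite -sumrN expR_sum; apply: eq_bigr => x _; ring.
Qed.

Lemma off_dep m : dep m (off m).
Proof. by move=> s t _ _; rewrite /off => ->. Qed.

Lemma size_erase m s : size s = size m -> size (erase m s) = size m.
Proof. by move=> e; rewrite size_map size_zip e minnn. Qed.

Lemma erase_leb m s : size s = size m -> leb (erase m s) s.
Proof.
elim: m s => [|b m IH] [|a s] //= [e]; have := IH s e; rewrite /leb /= => ->.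
by case: a; case: b.
Qed.

Lemma mask_erase m s : size s = size m -> mask (cmask m) (erase m s) = mask (cmask m) s.
Proof. by elim: m s => [|b m IH] [|a s] //= [e]; case: b => /=; rewrite IH. Qed.

Lemma erase_eq m s t : size s = size m -> size t = size m ->
  mask (cmask m) s = mask (cmask m) t -> erase m s = erase m t.
Proof.
elim: m s t => [|b m IH] [|a s] [|c t] //= [e1] [e2].
by case: b => /= [h|[-> h]]; congr (_ :: _); exact: IH.
Qed.

Lemma erase_off m s : size s = size m -> off m s -> erase m s = s.
Proof.
elim: m s => [|b m IH] [|a s] //= [e].
case: b => /=; last by move=> ho; congr (_ :: _); exact: IH.
by rewrite /off /= negb_or => /andP[/negbTE -> ho]; congr (_ :: _); exact: IH.
Qed.

Lemma dep_erase (T : Type) m (F : seq bool -> T) : dep (cmask m) (fun s => F (erase m s)).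
Proof. by move=> s t; rewrite size_map => ss st e; rewrite (@erase_eq m s t). Qed.

(** The event [A (erase m s)] ignores the coordinates of [m], hence is independent of [off m], and
    under [off m] erasing changes nothing. A rare event thus stays rare after erasing, up to the
    factor [1 / Pb ps (off m)]. *)
Lemma Pb_erase_le ps m A : probs ps -> size m = size ps ->
  Pb ps (fun s => A (erase m s)) * Pb ps (fun s => off m s) <= Pb ps A.
Proof.
move=> pps sm; rewrite mulrC -(@Pb_indep _ m) //; last exact: dep_erase.
- by apply: Pb_sub => // s ss [ho]; rewrite erase_off // ss.
- by move=> s t ss st e; rewrite (@off_dep m s t).
Qed.

(* Resampling the coordinates of [m]: whatever the other coordinates are, either
   switching all of [m] off or putting [m] in a configuration of [C] leads to [T]. *)
Lemma Pb_flip ps m (Y C T : seq bool -> Prop) b : probs ps -> size m = size ps ->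
  dep (cmask m) Y -> dep m C ->
  (forall s, size s = size ps -> Y s -> T (erase m s) \/
     forall t, size t = size ps -> mask (cmask m) t = mask (cmask m) s -> C t -> T t) ->
  b <= Pb ps (fun s => off m s) -> b <= Pb ps C ->
  b * Pb ps Y <= Pb ps T.
Proof.
move=> pps sm dY dC h b0 b1.
pose Y0 s := Y s /\ T (erase m s); pose Y1 s := Y s /\ ~ T (erase m s).
rewrite (PbDI ps Y (fun s => T (erase m s))) mulrDr -/Y0 -/Y1.
rewrite (PbDI ps T (fun s => T (erase m s))).
have dT := @dep_erase _ m T.
have dY0 : dep (cmask m) Y0 by move=> s t ss st e; rewrite /Y0 (dY s t) // (dT s t).
have dY1 : dep (cmask m) Y1 by move=> s t ss st e; rewrite /Y1 (dY s t) // (dT s t).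
apply: lerD.
  apply: (@le_trans _ _ (Pb ps (fun s => off m s) * Pb ps Y0)).
    by apply: ler_wpM2r => //; exact: Pb_ge0.
  rewrite -(@Pb_indep _ m) //; last by move=> s t ss st e; rewrite (@off_dep m s t).
  apply: Pb_sub => // s ss [ho [_ Ts]]; split=> //.
  by move: Ts; rewrite erase_off // ss.
apply: (@le_trans _ _ (Pb ps C * Pb ps Y1)).
  by apply: ler_wpM2r => //; exact: Pb_ge0.
rewrite -(@Pb_indep _ m) //; apply: Pb_sub => // s ss [Cs [Ys nT]]; split=> //.
by case: (h _ ss Ys) => // H; apply: H.
Qed.

End Bernoulli.

(** * Lower and upper integrals by cells *)

(* No measurability is assumed: the integral of a nonnegative function is the
   supremum of the integrals of the simple functions below it. *)
Lemma ge0_le_integral_nomeas (dd : measure_display) (T : measurableType dd)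
    (R : realType) (mu : {measure set T -> \bar R}) (D : set T) (f g : T -> \bar R) :
  (forall x, D x -> (0 <= f x)%E) -> (forall x, D x -> (f x <= g x)%E) ->
  (\int[mu]_(x in D) f x <= \int[mu]_(x in D) g x)%E.
Proof.
move=> f0 fg.
have g0 x : D x -> (0 <= g x)%E by move=> Dx; apply: le_trans (f0 _ Dx) (fg _ Dx).
rewrite !ge0_integralE //; apply: le_ereal_sup => _ [h hf <-].
exists h => // x; apply: le_trans (hf x) _; rewrite /patch.
by case: ifPn => // /set_mem; exact: fg.
Qed.

Section Cells.
Variable R : realType.
Implicit Types (t : R) (g : R -> \bar R) (l u : nat -> R).

Lemma int_step (I : nat -> interval R) (D : set R) (N : nat) (u : nat -> R) h :
  measurable D -> (forall a, (a < N)%N -> 0 <= u a) ->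
  (forall a, (a < N)%N -> [set` I a] `<=` D /\
     @lebesgue_measure R [set` I a] = h%:E) ->
  (\int[@lebesgue_measure R]_(t in D)
     (\sum_(a < N) (u a)%:E * (\1_([set` I a]) t)%:E) =
   (\sum_(a < N) h * u a)%:E)%E.
Proof.
move=> mD u0 hI.
rewrite (@ge0_integral_sum _ _ R (@lebesgue_measure R) D mD 'I_N
  (fun a t => ((u a)%:E * (\1_([set` I a]) t)%:E)%E)); first last.
- by move=> a t _; rewrite mule_ge0 // lee_fin ?u0 // indicE ler0n.
- move=> a; apply: measurable_funeM; apply/measurable_EFinP.
  exact: measurable_indic.
rewrite -sumEFin; apply: eq_bigr => a _.
rewrite ge0_integralZl_EFin ?u0 //; last first.
  by apply/measurable_EFinP; exact: measurable_indic.
have [IaD mI] := hI a (ltn_ord a).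
by rewrite integral_indic // setIidl // mulrC EFinM; congr (_ * _)%E; exact: mI.
Qed.

(** The lower step function uses half-open cells: they are disjoint, so it stays below [g]. The
    upper one uses closed cells: they cover the whole segment, and where they overlap the step
    function only grows. *)
Lemma int_cells (x0 : R) (N : nat) g l u : (0 < N)%N ->
  (forall a, (a < N)%N -> 0 <= l a) ->
  (forall a t, (a < N)%N -> x0 + a%:R / N%:R <= t <= x0 + a.+1%:R / N%:R ->
     ((l a)%:E <= g t <= (u a)%:E)%E) ->
  ((N%:R^-1 * \sum_(a < N) l a)%:E <=
     \int[@lebesgue_measure R]_(t in `[x0, (x0 + 1)%R]) g t <=
     (N%:R^-1 * \sum_(a < N) u a)%:E)%E.
Proof.
move=> N0 l0 h; rewrite !mulr_sumr.
have N0' : 0 < N%:R :> R by rewrite ltr0n.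
have cellE a t : (x0 + a%:R / N%:R <= t) = (a%:R <= N%:R * (t - x0)).
  by rewrite -lerBrDl ler_pdivrMr // mulrC.
have cellE' a t : (t <= x0 + a%:R / N%:R) = (N%:R * (t - x0) <= a%:R).
  by rewrite -lerBlDl ler_pdivlMr // mulrC.
have ex t : x0 <= t <= x0 + 1 -> exists2 a, (a < N)%N &
    x0 + a%:R / N%:R <= t <= x0 + a.+1%:R / N%:R.
  move=> /andP[t0 t1]; have s0 : 0 <= N%:R * (t - x0).
    by rewrite mulr_ge0 ?ler0n // subr_ge0.
  have sN : N%:R * (t - x0) <= N%:R.
    by rewrite ler_piMr ?ler0n // lerBlDl.
  move: s0 sN; set s := N%:R * (t - x0) => s0 sN.
  have := truncn_le s; rewrite s0 => tr1.
  have tr2 := truncnS_gt s.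
  have [lt|ge] := ltnP (Num.truncn s) N.
    by exists (Num.truncn s) => //; rewrite cellE cellE' tr1 ltW.
  (* The right end [x0 + 1] belongs to the last cell. *)
  exists N.-1; first by rewrite prednK.
  rewrite cellE cellE' prednK // sN andbT.
  by apply: le_trans tr1; rewrite ler_nat; lia.
have g0 t : `[x0, x0 + 1]%classic t -> (0 <= g t)%E.
  rewrite /= in_itv /= => /ex[a aN /(h a t aN) /andP[lg _]].
  by apply: le_trans lg; rewrite lee_fin l0.
have u0 a : (a < N)%N -> 0 <= u a.
  move=> aN; have /andP[lg gu] : ((l a)%:E <= g (x0 + a%:R / N%:R)%R <= (u a)%:E)%E.
    by apply: h => //; rewrite lexx lerD2l ler_pM2r ?invr_gt0 // ler_nat leqnSn.
  by rewrite -lee_fin; apply: le_trans (le_trans lg gu); rewrite lee_fin l0.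
have nest a : (a < N)%N -> x0 <= x0 + a%:R / N%:R /\ x0 + a.+1%:R / N%:R <= x0 + 1.
  move=> aN; split; first by rewrite lerDl mulr_ge0 ?invr_ge0 ?ler0n.
  by rewrite lerD2l ler_pdivrMr // mul1r ler_nat.
have len a : x0 + a.+1%:R / N%:R - (x0 + a%:R / N%:R) = N%:R^-1.
  by rewrite opprD addrACA subrr add0r -mulrBl -natr1 addrAC subrr add0r mul1r.
have ltc a : x0 + a%:R / N%:R < x0 + a.+1%:R / N%:R.
  by rewrite ltrD2l ltr_pM2r ?invr_gt0 // ltr_nat.
apply/andP; split.
  have <- := @int_step (fun a => `[x0 + a%:R / N%:R, x0 + a.+1%:R / N%:R[%O)
    `[x0, x0 + 1]%classic N l N%:R^-1 _ l0 _; first last.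
  - move=> a aN; have [n1 n2] := nest a aN; split.
      move=> t /=; rewrite !in_itv /= => /andP[t1 t2].
      by rewrite (le_trans n1 t1) (le_trans (ltW t2) n2).
    by rewrite lebesgue_measure_itv /= lte_fin ltc -EFinB len.
  - exact: measurable_itv.
  - apply: ge0_le_integral_nomeas.
      move=> t _; apply: sume_ge0 => a _.
      by rewrite mule_ge0 // lee_fin ?l0 // indicE ler0n.
    move=> t Dt.
    have [[b bN bt]|nb] := pselect (exists2 b, (b < N)%N &
        x0 + b%:R / N%:R <= t < x0 + b.+1%:R / N%:R).
      rewrite (bigD1 (Ordinal bN)) //= big1 ?adde0; last first.
        move=> a ab; rewrite indicE memNset ?mule0 //= in_itv /= => /andP[t1 t2].
        have /andP[t3 t4] := bt; move/eqP: ab; apply; apply: val_inj => /=.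
        have : x0 + a%:R / N%:R < x0 + b.+1%:R / N%:R by exact: le_lt_trans t1 t4.
        have : x0 + b%:R / N%:R < x0 + a.+1%:R / N%:R by exact: le_lt_trans t3 t2.
        by rewrite !ltrD2l !ltr_pM2r ?invr_gt0 // !ltr_nat; lia.
      rewrite indicE mem_set /=; last by rewrite in_itv.
      rewrite mule1; have /andP[t3 t4] := bt.
      have /andP[] // : ((l b)%:E <= g t <= (u b)%:E)%E.
      by apply: h => //; rewrite t3 ltW.
    rewrite big1; first exact: g0.
    move=> a _; rewrite indicE memNset ?mule0 //= in_itv /= => at'; apply: nb.
    by exists a.
have <- := @int_step (fun a => `[x0 + a%:R / N%:R, x0 + a.+1%:R / N%:R]%O)
  `[x0, x0 + 1]%classic N u N%:R^-1 _ u0 _; first last.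
- move=> a aN; have [n1 n2] := nest a aN; split.
    move=> t /=; rewrite !in_itv /= => /andP[t1 t2].
    by rewrite (le_trans n1 t1) (le_trans t2 n2).
  by rewrite lebesgue_measure_itv /= lte_fin ltc -EFinB len.
- exact: measurable_itv.
apply: ge0_le_integral_nomeas => // t Dt.
have [b bN bt] : exists2 a, (a < N)%N &
    x0 + a%:R / N%:R <= t <= x0 + a.+1%:R / N%:R.
  by apply: ex; move: Dt; rewrite /= in_itv.
have /andP[_ gu] := h b t bN bt; apply: le_trans gu _.
rewrite (bigD1 (Ordinal bN)) //= indicE mem_set /= ?in_itv // mule1.
apply: leeDl; apply: sume_ge0 => a _.
by rewrite mule_ge0 // lee_fin ?u0 // indicE ler0n.
Qed.

End Cells.

(** * The percolation kernel *)

Section CubeInt.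
Variable R : realType.
Implicit Types (c w z : nat -> R) (f g : (nat -> R) -> R) (k N : nat).

Definition upd k (t : R) z : nat -> R := fun m => if m == k then t else z m.

Definition incube k c w := forall l, (l < k)%N -> `|w l - c l| <= 2^-1.

Definition midpt (c : R) N a : R := c - 2^-1 + (a%:R + 2^-1) / N%:R.

(* Midpoints are used because they are preserved by the reflections of the cube. *)
Fixpoint rsum k c N f : R :=
  match k with
  | 0 => f (fun _ => 0)
  | k'.+1 => N%:R^-1 * \sum_(a < N) rsum k' c N (fun z => f (upd k' (midpt (c k') N a) z))
  end.

Lemma incube_upd k c w t : incube k c w -> `|t - c k| <= 2^-1 -> incube k.+1 c (upd k t w).
Proof.
move=> iw it l; rewrite ltnS leq_eqVlt /upd; case: eqVneq => [-> //|_ /= lk].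
exact: iw.
Qed.

Lemma midpt_cell (c : R) N a (t : R) : (a < N)%N ->
  c - 2^-1 + a%:R / N%:R <= t <= c - 2^-1 + a.+1%:R / N%:R ->
  [/\ `|t - midpt c N a| <= N%:R^-1, `|t - c| <= 2^-1 & `|midpt c N a - c| <= 2^-1].
Proof.
move=> aN; have N0 : 0 < N%:R :> R by rewrite ltr0n; lia.
rewrite -(natr1 a) /midpt !mulrDl mul1r.
have h1 : (a%:R + 1) / N%:R <= 1 :> R.
  by rewrite ler_pdivrMr // mul1r natr1 ler_nat.
have h2 : 0 <= a%:R / N%:R :> R by rewrite mulr_ge0 ?invr_ge0 ?ler0n.
have h3 : 0 < N%:R^-1 :> R by rewrite invr_gt0.
move: h1; rewrite mulrDl mul1r; set x := a%:R / N%:R; set y := N%:R^-1.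
rewrite -/x in h2; rewrite -/y in h3.
by move=> h1 /andP[t1 t2]; split; rewrite ler_norml; apply/andP; split; lra.
Qed.

Lemma rsum_le k c N f g e : (0 < N)%N ->
  (forall w, incube k c w -> f w <= g w + e) ->
  rsum k c N f <= rsum k c N g + e.
Proof.
move=> N0; elim: k f g => [|k IH] f g h /=; first exact: h.
have N0' : 0 < N%:R :> R by rewrite ltr0n.
have -> : e = N%:R^-1 * \sum_(a < N) e.
  by rewrite sumr_const card_ord -(mulr_natl e) mulKf ?lt0r_neq0.
rewrite -mulrDr ler_pM2l ?invr_gt0 // -big_split /=; apply: ler_sum => a _.
apply: IH => w iw; apply: h; apply: incube_upd => //.
have [] // := @midpt_cell (c k) N a (c k - 2^-1 + a%:R / N%:R) (ltn_ord a).
by rewrite lexx lerD2l ler_pM2r ?invr_gt0 // ler_nat leqnSn.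
Qed.

Lemma cube_int_cells k c f (l u : nat -> R) N : (0 < N)%N ->
  (forall a, (a < N)%N -> 0 <= l a) ->
  (forall a t, (a < N)%N ->
     c k - 2^-1 + a%:R / N%:R <= t <= c k - 2^-1 + a.+1%:R / N%:R ->
     ((l a)%:E <= cube_int k c (fun z => (f (upd k t z))%:E) <= (u a)%:E)%E) ->
  ((N%:R^-1 * \sum_(a < N) l a)%:E <= cube_int k.+1 c (fun z => (f z)%:E) <=
     (N%:R^-1 * \sum_(a < N) u a)%:E)%E.
Proof.
move=> N0 l0 h; rewrite /=.
have -> : c k + 2^-1 = c k - 2^-1 + 1 by lra.
exact: int_cells.
Qed.

Lemma cube_int_bound k c f (l u : R) : 0 <= l ->
  (forall w, incube k c w -> l <= f w <= u) ->
  (l%:E <= cube_int k c (fun z => (f z)%:E) <= u%:E)%E.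
Proof.
move=> l0; elim: k f => [|k IH] f h; first by rewrite /= !lee_fin h.
have := @cube_int_cells k c f (fun=> l) (fun=> u) 1 isT (fun _ _ => l0).
rewrite !big_ord1 invr1 !mul1r; apply => a t aN ht.
apply: IH => w iw; apply: h; apply: incube_upd => //.
by have [] := @midpt_cell (c k) 1 a t aN; rewrite ?invr1.
Qed.

Lemma cube_int_ge0 k c f : (forall w, incube k c w -> 0 <= f w) ->
  (0 <= cube_int k c (fun z => (f z)%:E))%E.
Proof.
elim: k f => [|k IH] f h; first by rewrite /= lee_fin h.
apply: integral_ge0 => t; rewrite /= in_itv /= => /andP[t1 t2].
apply: (IH (fun z => f (upd k t z))) => w iw; apply: h; apply: incube_upd => //.
by rewrite ler_norml; apply/andP; split; lra.
Qed.

(** Each of the [k] nested integrals costs one oscillation [e], when the integrand on a cell is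
    replaced by its value at the midpoint. *)
Lemma cube_int_rsum k c N f e : (0 < N)%N -> 0 <= e ->
  (forall w, incube k c w -> 0 <= f w) ->
  (forall w w', incube k c w -> incube k c w' ->
     (forall l, `|w l - w' l| <= N%:R^-1) -> f w <= f w' + e) ->
  ((rsum k c N f - k%:R * e)%:E <= cube_int k c (fun z => (f z)%:E) <=
   (rsum k c N f + k%:R * e)%:E)%E.
Proof.
move=> N0 e0; elim: k f => [|k IH] f f0 h.
  by rewrite /= mul0r subr0 addr0 lexx.
have N0' : 0 < N%:R :> R by rewrite ltr0n.
have Nv : 0 <= N%:R^-1 :> R by rewrite invr_ge0 ler0n.
pose r a := rsum k c N (fun z => f (upd k (midpt (c k) N a) z)).
(* The lower bounds are cut off at 0 because [cube_int_cells] asks for nonnegative ones. *)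
have := @cube_int_cells k c f (fun a => Num.max 0 (r a - k.+1%:R * e))
  (fun a => r a + k.+1%:R * e) N N0.
case/(_ _ _)/andP => [a aN|a t aN ht|lo up].
- by rewrite le_max lexx.
- have [tm tc mc] := midpt_cell aN ht.
  have close w : incube k c w ->
      f (upd k t w) <= f (upd k (midpt (c k) N a) w) + e /\
      f (upd k (midpt (c k) N a) w) <= f (upd k t w) + e.
    move=> iw; split; apply: h; try exact: incube_upd; move=> l; rewrite /upd.
      by case: eqP => // _; rewrite subrr normr0.
    by case: eqP => [_|_]; rewrite ?subrr ?normr0 // distrC.
  have /andP[lo up] : ((rsum k c N (fun z => f (upd k t z)) - k%:R * e)%:E <=
      cube_int k c (fun z => (f (upd k t z))%:E) <=
      (rsum k c N (fun z => f (upd k t z)) + k%:R * e)%:E)%E.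
    apply: IH => [w iw|w w' iw iw' ww']; first by apply: f0; exact: incube_upd.
    apply: h; try exact: incube_upd; move=> l; rewrite /upd.
    by case: eqP => // _; rewrite subrr normr0.
  have r1 := rsum_le N0 (fun w iw => (close w iw).1).
  have r2 := rsum_le N0 (fun w iw => (close w iw).2).
  rewrite -/(r a) in r1 r2; apply/andP; split.
    rewrite EFin_max ge_max; apply/andP; split.
      by apply: cube_int_ge0 => w iw; apply: f0; exact: incube_upd.
    apply: le_trans lo; rewrite lee_fin -(natr1 k) mulrDl mul1r; lra.
  apply: le_trans up _; rewrite lee_fin -(natr1 k) mulrDl mul1r; lra.
- have ke : k.+1%:R * e = N%:R^-1 * \sum_(a < N) (k.+1%:R * e).
    by rewrite sumr_const card_ord -(mulr_natl (_ * e)) mulKf ?lt0r_neq0.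
  apply/andP; split.
    apply: le_trans lo; rewrite lee_fin /= [X in _ - X <= _]ke.
    rewrite -mulrBr ler_wpM2l // -sumrB; apply: ler_sum => a _.
    by rewrite le_max; apply/orP; right; exact: lexx.
  apply: le_trans up _; rewrite lee_fin /= [X in _ <= _ + X]ke.
  by rewrite -mulrDr ler_wpM2l // -big_split.
Qed.

End CubeInt.

(** * Size of the kernel and its approximation by midpoint sums *)

Section KernelBounds.
Variables (R : realType) (d : nat).
Implicit Types (i j : vtx d) (w : nat -> R) (N : nat).

Definition kc i j : nat -> R := fun m =>
  if (m < d)%N then (oapp (fun k : 'I_d => i ord0 k) 0 (insub m))%:~R
  else (oapp (fun k : 'I_d => j ord0 k) 0 (insub (m - d)%N))%:~R.

Definition ksum w : R := \sum_(k < d) (w k - w (d + k)%N) ^+ 2.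

Lemma kernelE i j :
  lrp_kernel_int i j = fine (cube_int (d + d) (kc i j) (fun w => (ksum w ^- d)%:E)) :> R.
Proof. by []. Qed.

Lemma kcl i j (k : 'I_d) : kc i j k = (i ord0 k)%:~R.
Proof. by rewrite /kc ltn_ord valK. Qed.

Lemma kcr i j (k : 'I_d) : kc i j (d + k)%N = (j ord0 k)%:~R.
Proof. by rewrite /kc ltnNge leq_addr /= addnC addnK valK. Qed.

Lemma incube_diff i j w (k : 'I_d) : incube (d + d) (kc i j) w ->
  `|w k - w (d + k)%N - ((i ord0 k)%:~R - (j ord0 k)%:~R)| <= 1.
Proof.
move=> iw.
have h1 : (k < d + d)%N by rewrite ltn_addr // ltn_ord.
have h2 : (d + k < d + d)%N by rewrite ltn_add2l ltn_ord.
have := iw _ h2; have := iw _ h1; rewrite kcl kcr !ler_norml.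
by move=> /andP[a1 a2] /andP[a3 a4]; apply/andP; split; lra.
Qed.

Lemma normr_coord (a b : int) : `|a%:~R - b%:~R| = `|a - b|%N%:R :> R.
Proof. by rewrite -intrB -intr_norm -abszE. Qed.

Lemma incube_diff_le i j w (k : 'I_d) : incube (d + d) (kc i j) w ->
  `|w k - w (d + k)%N| <= (linf i j)%:R + 1.
Proof.
move=> iw; have h := incube_diff k iw.
have h2 : `|(i ord0 k)%:~R - (j ord0 k)%:~R| <= (linf i j)%:R :> R.
  by rewrite normr_coord ler_nat linf_ge.
rewrite -[X in `|X|](subrK ((i ord0 k)%:~R - (j ord0 k)%:~R)).
by apply: le_trans (ler_normD _ _) _; rewrite addrC lerD.
Qed.

(** Moving the two points inside their unit cubes changes each coordinate difference by at most 1.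
    The lower bound keeps one coordinate that realizes [linf i j], the upper bound counts all
    [d]. *)
Lemma ksum_bounds i j w : (1 < linf i j)%N -> incube (d + d) (kc i j) w ->
  ((linf i j)%:R - 1) ^+ 2 <= ksum w <= d%:R * ((linf i j)%:R + 1) ^+ 2.
Proof.
move=> M2 iw; apply/andP; split.
  have [|k kE] := @linf_attained d i j; first by lia.
  have h := incube_diff k iw.
  have h1 : 0 <= (linf i j)%:R - 1 :> R by rewrite subr_ge0 ler1n; lia.
  have h2 : (linf i j)%:R - 1 <= `|w k - w (d + k)%N|.
    rewrite kE -normr_coord; rewrite distrC in h.
    by move: (lerB_dist ((i ord0 k)%:~R - (j ord0 k)%:~R) (w k - w (d + k)%N)) h; lra.
  rewrite /ksum (bigD1 k) //= -[X in X <= _]addr0; apply: lerD.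
    by rewrite -[X in _ <= X]real_normK ?num_real // ler_sqr ?nnegrE.
  by apply: sumr_ge0 => l _; exact: sqr_ge0.
rewrite mulr_natl -[X in _ *+ X]card_ord -sumr_const; apply: ler_sum => k _.
rewrite -[X in X <= _]real_normK ?num_real // ler_sqr ?nnegrE ?addr_ge0 ?ler0n //.
exact: incube_diff_le.
Qed.

(** On the half-line above 1 the function [S ^- n] has slope at most [n] in absolute value. *)
Lemma exprN_lip (n : nat) (S T : R) : 1 <= S -> 1 <= T ->
  S ^- n <= T ^- n + n%:R * `|S - T|.
Proof.
move=> S1 T1; elim: n => [|n IH]; first by rewrite !expr0 mul0r addr0.
have S0 : 0 < S by exact: lt_le_trans S1.
have T0 : 0 < T by exact: lt_le_trans T1.
have Sn : S ^- n <= 1 by rewrite invf_le1 ?exprn_gt0 // exprn_ege1.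
have Sn0 : 0 <= S ^- n by rewrite invr_ge0 exprn_ge0 // ltW.
have Ti : T^-1 <= 1 by rewrite invf_le1.
have Ti0 : 0 <= T^-1 by rewrite invr_ge0 ltW.
have Si : S^-1 <= 1 by rewrite invf_le1.
have Si0 : 0 <= S^-1 by rewrite invr_ge0 ltW.
have e1 : S^-1 - T^-1 = (T - S) * (S^-1 * T^-1).
  by field; rewrite !gt_eqF.
have h1 : S^-1 - T^-1 <= `|S - T|.
  rewrite e1; apply: le_trans (ler_norm _) _; rewrite normrM distrC.
  by rewrite ler_piMr ?normr_ge0 // ger0_norm ?mulr_ge0 // mulr_ile1.
rewrite !exprS !invfM.
have -> : S^-1 * S ^- n = S ^- n * (S^-1 - T^-1) + T^-1 * S ^- n by ring.
rewrite -natr1 mulrDl mul1r.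
have h2 : S ^- n * (S^-1 - T^-1) <= `|S - T|.
  apply: (@le_trans _ _ (S ^- n * `|S - T|)); first exact: ler_wpM2l.
  by rewrite ler_piMl.
have h3 : T^-1 * S ^- n <= T^-1 * T ^- n + n%:R * `|S - T|.
  apply: le_trans (ler_wpM2l Ti0 IH) _; rewrite mulrDr lerD2l.
  by rewrite ler_piMl // mulr_ge0 ?ler0n ?normr_ge0.
by move: h2 h3; lra.
Qed.

Lemma kernel_cube_bounds i j : (1 < linf i j)%N ->
  (((d%:R * ((linf i j)%:R + 1) ^+ 2) ^- d)%:E <=
   cube_int (d + d) (kc i j) (fun w => (ksum w ^- d)%:E) <=
   ((((linf i j)%:R - 1) ^+ 2) ^- d)%:E)%E.
Proof.
move=> M2; have M1 : 1 < (linf i j)%:R :> R by rewrite ltr1n.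
apply: cube_int_bound.
  by rewrite invr_ge0 exprn_ge0 // mulr_ge0 ?ler0n // exprn_even_ge0.
move=> w iw; have /andP[lo up] := ksum_bounds M2 iw.
have p0 : 0 < ((linf i j)%:R - 1) ^+ 2 :> R by rewrite exprn_gt0 // subr_gt0.
have s0 : 0 < ksum w by exact: lt_le_trans lo.
have q0 : 0 < d%:R * ((linf i j)%:R + 1) ^+ 2 :> R by exact: lt_le_trans up.
have inv x y : 0 < x -> x <= y -> y ^- d <= x ^- d :> R.
  move=> x0 xy; have y0 : 0 < y by exact: lt_le_trans xy.
  rewrite lef_pV2 ?posrE; [|exact: exprn_gt0|exact: exprn_gt0].
  by apply: lerXn2r; rewrite // nnegrE ltW.
by apply/andP; split; apply: inv.
Qed.

Lemma kernel_bounds i j : (1 < linf i j)%N ->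
  (d%:R * ((linf i j)%:R + 1 : R) ^+ 2) ^- d <= lrp_kernel_int i j <=
  (((linf i j)%:R - 1 : R) ^+ 2) ^- d.
Proof.
move=> M2; have /andP[lo up] := kernel_cube_bounds M2; rewrite kernelE.
have fin : cube_int (d + d) (kc i j) (fun w => (ksum w ^- d)%:E) \is a fin_num.
  by rewrite fin_numElt (lt_le_trans (ltNyr _) lo) (le_lt_trans up (ltry _)).
by rewrite -!lee_fin !fineK // lo.
Qed.

(** The kernel becomes a limit of finite sums, on which the symmetries of the lattice act by
    reindexing; no exchange of the nested integrals has to be justified. *)
Lemma kernel_rsum i j : (1 < linf i j)%N -> exists C : R, forall N, (0 < N)%N ->
  `|lrp_kernel_int i j - rsum (d + d) (kc i j) N (fun w => ksum w ^- d)| <= C / N%:R.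
Proof.
move=> M2; pose M : R := (linf i j)%:R.
(* In order: the number of integrals, the slope of [S ^- d], the number of coordinates, and the
   factors from [|a ^+ 2 - b ^+ 2| = |a - b| * |a + b|] with [|a - b| <= 2 / N] and
   [|a + b| <= 2 * (M + 1)]. *)
exists ((d + d)%:R * (d%:R * (d%:R * (2 * (2 * (M + 1)))))) => N N0.
pose e := (d%:R * (d%:R * (2 * (2 * (M + 1))))) / N%:R.
have N0' : 0 < N%:R :> R by rewrite ltr0n.
have M1 : 1 < M by rewrite ltr1n.
have e0 : 0 <= e.
  by rewrite /e !mulr_ge0 ?ler0n ?invr_ge0 ?ler0n // addr_ge0 // ltW // (lt_trans _ M1).
have s1 w : incube (d + d) (kc i j) w -> 1 <= ksum w.
  move=> iw; have /andP[lo _] := ksum_bounds M2 iw; apply: le_trans lo.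
  by rewrite exprn_ege1 // lerBrDr -[1 + 1]/(2%:R) ler_nat.
have /andP[lo up] : ((rsum (d + d) (kc i j) N (fun w => ksum w ^- d) - (d + d)%:R * e)%:E <=
   cube_int (d + d) (kc i j) (fun w => (ksum w ^- d)%:E) <=
   (rsum (d + d) (kc i j) N (fun w => ksum w ^- d) + (d + d)%:R * e)%:E)%E.
  apply: cube_int_rsum => //.
    by move=> w iw; rewrite invr_ge0 exprn_ge0 // (le_trans ler01) // s1.
  move=> w w' iw iw' ww'.
  apply: le_trans (exprN_lip d (s1 _ iw) (s1 _ iw')) _; rewrite lerD2l.
  rewrite /e -mulrA ler_wpM2l ?ler0n // /ksum -sumrB.
  apply: le_trans (ler_norm_sum _ _ _) _.
  rewrite -mulrA mulr_natl -[X in _ *+ X]card_ord -sumr_const; apply: ler_sum => k _.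
  rewrite subr_sqr normrM mulrAC; apply: ler_pM; rewrite ?normr_ge0 //.
    have := ww' k; have := ww' (d + k)%N; rewrite !ler_norml.
    by move=> /andP[a1 a2] /andP[a3 a4]; apply/andP; split; lra.
  apply: le_trans (ler_normD _ _) _.
  by have := incube_diff_le k iw; have := incube_diff_le k iw'; rewrite -/M; lra.
have fin : cube_int (d + d) (kc i j) (fun w => (ksum w ^- d)%:E) \is a fin_num.
  by rewrite fin_numElt (lt_le_trans (ltNyr _) lo) (le_lt_trans up (ltry _)).
move: lo up; rewrite -(fineK fin) !lee_fin -kernelE -mulrA -/e => lo up.
by rewrite ler_norml; apply/andP; split; lra.
Qed.

End KernelBounds.

(** * Invariance of the kernel under the symmetries of the lattice *)

Section RsumGrid.
Variable R : realType.
Implicit Types (k N : nat).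

Definition grid k (c : nat -> R) N (m : {ffun 'I_k -> 'I_N}) : nat -> R := fun l =>
  if insub l is Some l' then midpt (c l) N (m l') else 0.

Lemma rsumE k c N f :
  rsum k c N f = N%:R^-1 ^+ k * \sum_(m : {ffun 'I_k -> 'I_N}) f (grid c m).
Proof.
elim: k f => [|k IH] f /=.
  rewrite expr0 mul1r (eq_bigr (fun=> f (fun=> 0))); last first.
    by move=> m _; congr f; apply/funext => l; rewrite /grid; case: insubP.
  by rewrite sumr_const card_ffun !card_ord expn0.
rewrite exprS -mulrA; congr (_ * _).
under eq_bigr do rewrite IH.
rewrite -mulr_sumr pair_big /=; congr (_ * _).
pose ext (p : 'I_N * {ffun 'I_k -> 'I_N}) : {ffun 'I_k.+1 -> 'I_N} :=
  [ffun l : 'I_k.+1 => if insub (val l) is Some l' then p.2 l' else p.1].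
pose tni (m : {ffun 'I_k.+1 -> 'I_N}) : 'I_N * {ffun 'I_k -> 'I_N} :=
  (m ord_max, [ffun l => m (widen_ord (leqnSn k) l)]).
rewrite [RHS](reindex ext) /=; last first.
  exists tni => [[a m] _|m _]; rewrite /tni /ext /=.
    congr pair; first by rewrite ffunE /=; case: insubP => //= l; rewrite ltnn.
    apply/ffunP => l; rewrite !ffunE /=; case: insubP => /= [l' _ ll'|].
      by congr (m _); exact: val_inj.
    by rewrite ltn_ord.
  apply/ffunP => l; rewrite ffunE; case: insubP => /= [l' _ ll'|].
    by rewrite ffunE; congr (m _); exact: val_inj.
  by rewrite -leqNgt => kl; congr (m _); apply: val_inj => /=; have := ltn_ord l; lia.
apply: eq_bigr => -[a m] _ /=; congr f; apply/funext => l; rewrite /upd /grid.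
case: eqVneq => [->|lk].
  case: insubP => /= [l' _ ll'|]; last by rewrite ltnSn.
  by rewrite /ext ffunE /= ll' insubF // ltnn.
case: insubP => /= [l' h ll'|h]; case: insubP => /= [l'' h' ll''|h'] //.
- rewrite /ext ffunE /= ll''; case: insubP => /= [l3 _ ll3|]; last by rewrite h.
  by congr (midpt _ _ (m _)); apply: val_inj; rewrite /= ll' ll3.
- by move: h'; rewrite ltnS ltnW.
- by move: h h' lk; rewrite ltnS; lia.
Qed.

End RsumGrid.

Section Invariance.
Variables (R : realType) (d : nat) (s : 'I_d -> bool) (pi : {perm 'I_d}) (p : vtx d).
Implicit Types (i j : vtx d) (N : nat).

(** The affine symmetries of the cubic lattice: a signed permutation of the coordinates, then a
    translation by [p]. *)
Definition sperm i : vtx d := \row_k ((-1) ^+ (s k) * i ord0 (pi k) + p ord0 k).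

Lemma spermE i k : sperm i ord0 k = (-1) ^+ (s k) * i ord0 (pi k) + p ord0 k.
Proof. by rewrite mxE. Qed.

Lemma sperm_diff i j k :
  sperm i ord0 k - sperm j ord0 k = (-1) ^+ (s k) * (i ord0 (pi k) - j ord0 (pi k)).
Proof. by rewrite !spermE; ring. Qed.

Lemma sperm_linf i j : linf (sperm i) (sperm j) = linf i j.
Proof.
rewrite /linf [RHS](reindex_perm pi) /=; apply: eq_bigr => k _.
rewrite sperm_diff; case: (s k); rewrite ?expr0 ?expr1; lia.
Qed.

Definition sperm_inv i : vtx d :=
  \row_k ((-1) ^+ (s ((pi^-1)%g k)) * (i ord0 ((pi^-1)%g k) - p ord0 ((pi^-1)%g k))).

Lemma spermK : cancel sperm sperm_inv.
Proof.
move=> i; apply/rowP => k; rewrite mxE spermE permKV addrK mulrA -exprD addnn.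
by rewrite -muln2 exprM sqrr_sign mul1r.
Qed.

Lemma sperm_invK : cancel sperm_inv sperm.
Proof.
move=> i; apply/rowP => k; rewrite mxE mxE permK mulrA -exprD addnn.
by rewrite -muln2 exprM sqrr_sign mul1r subrK.
Qed.

Let offs N (a : 'I_N) : R := - 2^-1 + (a%:R + 2^-1) / N%:R.

Let offs_rev N (a : 'I_N) : offs (rev_ord a) = - offs a.
Proof.
rewrite /offs /= natrB ?ltn_ord // -natr1.
have N0 : N%:R != 0 :> R by rewrite pnatr_eq0; case: N a => // -[].
by field.
Qed.

Let ksum_grid N i j (m : {ffun 'I_(d + d) -> 'I_N}) :
  ksum d (grid (kc R i j) m) = \sum_(k < d)
   ((i ord0 k - j ord0 k)%:~R + (offs (m (lshift d k)) - offs (m (rshift d k)))) ^+ 2.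
Proof.
apply: eq_bigr => k _; congr (_ ^+ 2); rewrite /grid.
have -> : insub (val k) = Some (lshift d k) :> option 'I_(d + d).
  by case: insubP => [l _ ll|/=]; [congr Some; exact: val_inj|rewrite ltn_addr].
have -> : insub (d + k)%N = Some (rshift d k) :> option 'I_(d + d).
  by case: insubP => [l _ ll|/=]; [congr Some; exact: val_inj|rewrite ltn_add2l ltn_ord].
by rewrite kcl kcr /midpt /offs intrB; ring.
Qed.

(** A symmetry permutes the grid points: permuting the coordinates permutes the indices, and a
    change of sign reverses the order of the cells ([rev_ord]), since the offsets of the midpoints
    are symmetric about 0. *)
Lemma rsum_sperm N i j :
  rsum (d + d) (kc R (sperm i) (sperm j)) N (fun w => ksum d w ^- d) =
  rsum (d + d) (kc R i j) N (fun w => ksum d w ^- d).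
Proof.
rewrite !rsumE; congr (_ * _).
pose psi (l : 'I_(d + d)) : 'I_(d + d) :=
  match fintype.split l with inl k => lshift d (pi k) | inr k => rshift d (pi k) end.
pose sg (l : 'I_(d + d)) := match fintype.split l with inl k => s k | inr k => s k end.
pose Phi (m : {ffun 'I_(d + d) -> 'I_N}) : {ffun 'I_(d + d) -> 'I_N} :=
  [ffun l => if sg l then rev_ord (m (psi l)) else m (psi l)].
have psiL k : psi (lshift d k) = lshift d (pi k).
  by rewrite /psi -[lshift d k]/(unsplit (inl k)) unsplitK.
have psiR k : psi (rshift d k) = rshift d (pi k).
  by rewrite /psi -[rshift d k]/(unsplit (inr k)) unsplitK.
have sgL k : sg (lshift d k) = s k.
  by rewrite /sg -[lshift d k]/(unsplit (inl k)) unsplitK.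
have sgR k : sg (rshift d k) = s k.
  by rewrite /sg -[rshift d k]/(unsplit (inr k)) unsplitK.
have Phi_inj : injective Phi.
  move=> m m' /ffunP e; apply/ffunP => l.
  have [l' <-] : exists l', psi l' = l.
    case: (fintype.split_ordP l) => k ->.
      by exists (lshift d ((pi^-1)%g k)); rewrite psiL permKV.
    by exists (rshift d ((pi^-1)%g k)); rewrite psiR permKV.
  by have := e l'; rewrite !ffunE; case: (sg l') => // /rev_ord_inj.
rewrite (reindex_inj Phi_inj) /=; apply: eq_bigr => m _; congr (_ ^- d).
rewrite !ksum_grid [RHS](reindex_perm pi) /=; apply: eq_bigr => k _.
rewrite !ffunE sgL sgR psiL psiR sperm_diff.
case: (s k); rewrite ?expr0 ?expr1 ?mul1r // !offs_rev mulN1r intrN.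
by rewrite -sqrrN; congr (_ ^+ 2); ring.
Qed.

Lemma kernel_sperm i j : (1 < linf i j)%N ->
  lrp_kernel_int (sperm i) (sperm j) = lrp_kernel_int i j :> R.
Proof.
move=> M2; have M2' : (1 < linf (sperm i) (sperm j))%N by rewrite sperm_linf.
have [C hC] := @kernel_rsum R d _ _ M2; have [C' hC'] := @kernel_rsum R d _ _ M2'.
apply/eqP; rewrite -subr_eq0 -normr_le0; apply/ler_addgt0Pl => e e0; rewrite addr0.
have [N N0 hN] : exists2 N, (0 < N)%N & (`|C| + `|C'|) / N%:R <= e.
  exists (Num.truncn ((`|C| + `|C'|) / e)).+1 => //.
  rewrite ler_pdivrMr ?ltr0n // mulrC -ler_pdivrMr //.
  exact/ltW/truncnS_gt.
have := hC N N0; have := hC' N N0; rewrite rsum_sperm.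
set r := rsum _ _ _ _; set K := lrp_kernel_int i j; set K' := lrp_kernel_int _ _.
have NV : 0 <= N%:R^-1 :> R by rewrite invr_ge0 ler0n.
have a1 : C / N%:R <= `|C| / N%:R by rewrite ler_wpM2r // ler_norm.
have a2 : C' / N%:R <= `|C'| / N%:R by rewrite ler_wpM2r // ler_norm.
rewrite mulrDl in hN; move=> h1 h2.
have -> : K' - K = (K' - r) - (K - r) by ring.
by apply: le_trans (ler_normB _ _) _; lra.
Qed.

End Invariance.

(** * Percolation configurations on finite edge lists *)

(** Graph of a finite configuration: [t] tells which pairs of [s] are open. A pair is listed in one
    orientation only, hence the two membership tests. *)
Definition Gof {d : nat} (s : seq (vtx d * vtx d)) (t : seq bool) (i j : vtx d) : bool :=
  [|| linf i j == 1%N, (i, j) \in mask t s | (j, i) \in mask t s].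

Definition cfg {Omega : Type} {d : nat} (E : Omega -> vtx d -> vtx d -> bool) (w : Omega)
  (s : seq (vtx d * vtx d)) : seq bool := [seq E w e.1 e.2 | e <- s].

Definition valid {d : nat} (s : seq (vtx d * vtx d)) : Prop :=
  uniq s /\ (forall p, p \in s -> (1 < linf p.1 p.2)%N /\ (p.2, p.1) \notin s).

Definition rad {d : nat} (i : vtx d) : nat := linf i 0%R.

Definition box (d r : nat) : seq (vtx d) :=
  [seq \row_k ((m k : nat)%:Z - r%:Z) | m : {ffun 'I_d -> 'I_(r.*2.+1)}].

(** Comparing the [pickle] codes selects one orientation of each pair, as the independence clause of
    [is_LRP] requires. *)
Definition edges (d L : nat) : seq (vtx d * vtx d) :=
  [seq p <- [seq (i, j) | i <- box d L, j <- box d L] |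
    (1 < linf p.1 p.2)%N && (pickle p.1 < pickle p.2)%N].

Section Config.
Variable d : nat.
Implicit Types (s : seq (vtx d * vtx d)) (t u : seq bool) (i j : vtx d).

Lemma Gof_nn s t : nn_graph (Gof s t).
Proof. by move=> i j /eqP h; rewrite /Gof h. Qed.

Lemma mem_mask_leb (T : eqType) (r : seq T) t u e : size t = size r -> size u = size r ->
  leb t u -> e \in mask t r -> e \in mask u r.
Proof.
rewrite /leb; elim: r t u => [|x r IH] [|a t] [|b u] //= [st] [su] /andP[ab tu].
case: a b ab => -[] //= _; rewrite ?inE; last exact: IH.
  by case/orP => [->//|/IH h]; rewrite h ?orbT.
by move=> /IH h; rewrite h ?orbT.
Qed.

Lemma Gof_mono s t u i j : size t = size s -> size u = size s -> leb t u ->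
  Gof s t i j -> Gof s u i j.
Proof.
move=> st su tu /or3P[h|h|h]; apply/or3P; [exact: Or31|apply: Or32|apply: Or33];
  exact: mem_mask_leb h.
Qed.

Lemma mem_mask_dep (T : eqType) (r : seq T) (q : pred T) t u e :
  size t = size r -> size u = size r -> mask (map q r) t = mask (map q r) u ->
  q e -> (e \in mask t r) = (e \in mask u r).
Proof.
move=> + + + qe; elim: r t u => [|x r IH] [|a t] [|b u] //= [st] [su].
case: ifPn => qx; first by move=> [-> /(IH _ _ st su) h]; case: b; rewrite ?inE h.
move=> /(IH _ _ st su) h.
by case: a; case: b; rewrite ?inE h //; case: eqP qe => // ->; rewrite (negbTE qx).
Qed.

Lemma Gof_dep s (q : pred (vtx d * vtx d)) (S : pred (vtx d)) :
  (forall i j, S i -> S j -> q (i, j)) ->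
  dep (map q s) (fun t => restr S (Gof s t)).
Proof.
move=> Sq t u; rewrite size_map => st su h; apply/funext => i; apply/funext => j.
rewrite /restr; case: (boolP (S i)) => //= Si; case: (boolP (S j)) => //= Sj.
by rewrite /Gof !(mem_mask_dep st su h) ?Sq.
Qed.

Lemma off_mem (T : eqType) (r : seq T) (q : pred T) t :
  size t = size r -> off (map q r) t = ~~ has q (mask t r).
Proof.
rewrite /off; elim: r t => [|x r IH] [|a t] //= [st]; have := IH t st.
by case qx: (q x); case: a => /=; rewrite ?qx.
Qed.

Lemma off_Gof s (q : pred (vtx d * vtx d)) t i j : size t = size s ->
  off (map q s) t -> (1 < linf i j)%N -> q (i, j) -> q (j, i) -> ~~ Gof s t i j.
Proof.
move=> st; rewrite off_mem // => /hasPn h l q1 q2; rewrite /Gof !negb_or.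
apply/and3P; split; first by rewrite gtn_eqF.
  by apply/negP => /h; rewrite q1.
by apply/negP => /h; rewrite q2.
Qed.

Lemma mem_box r i : (i \in box d r) = (rad i <= r)%N.
Proof.
apply/mapP/linf_leP => [[m _ ->] k|h].
  by rewrite !mxE subr0; case: (m k) => a la /=; lia.
have b k : (`|(i ord0 k + r%:Z)%R| < r.*2.+1)%N by have := h k; rewrite mxE; lia.
exists [ffun k => Ordinal (b k)]; first by rewrite mem_enum.
by apply: vtxP => k; rewrite !mxE ffunE /=; have := h k; rewrite mxE; lia.
Qed.

Lemma box_uniq r : uniq (box d r).
Proof.
rewrite map_inj_uniq ?enum_uniq // => m m' /rowP h; apply/ffunP => k.
by apply: val_inj; have := h k; rewrite !mxE /=; lia.
Qed.

Lemma size_box r : size (box d r) = (r.*2.+1 ^ d)%N.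
Proof. by rewrite size_map -cardT card_ffun !card_ord. Qed.

Lemma edges_valid L : valid (edges d L).
Proof.
split.
  apply: filter_uniq; apply: allpairs_uniq; rewrite ?box_uniq //.
  by move=> [a b] [a' b'] _ _ [-> ->].
move=> p; rewrite mem_filter => /andP[/andP[-> h] _]; split=> //.
by rewrite mem_filter /=; apply/negP => /andP[/andP[_ h'] _]; have := ltn_trans h h'; rewrite ltnn.
Qed.

Lemma mem_edges L i j : (1 < linf i j)%N -> (rad i <= L)%N -> (rad j <= L)%N ->
  ((i, j) \in edges d L) || ((j, i) \in edges d L).
Proof.
move=> l iL jL; rewrite !mem_filter /= l linf_sym l /=.
have m a b : (rad a <= L)%N -> (rad b <= L)%N ->
    (a, b) \in [seq (i, j) | i <- box d L, j <- box d L].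
  by move=> aL bL; apply: allpairs_f; rewrite mem_box.
rewrite !m // !andbT; case: (ltngtP (pickle i) (pickle j)) => // e.
have ij : i = j by apply: (pcan_inj pickleK).
by move: l; rewrite ij linf_xx.
Qed.

Lemma Gof_cfg (Omega : Type) (E : Omega -> vtx d -> vtx d -> bool) w s i j :
  Gof s (cfg E w s) i j = [|| linf i j == 1%N, ((i, j) \in s) && E w i j |
                              ((j, i) \in s) && E w j i].
Proof. by rewrite /Gof /cfg -!filter_mask !mem_filter /= ![E _ _ _ && _]andbC. Qed.

End Config.

(** * Lattice sums *)

Section LatticeSums.
Variables (R : realType) (d : nat).
Hypothesis d0 : (0 < d)%N.
Implicit Types (i j : vtx d) (J : seq (vtx d)).

Lemma ball_count i r J : uniq J -> (forall j, j \in J -> (linf i j <= r)%N) ->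
  (size J <= r.*2.+1 ^ d)%N.
Proof.
move=> uJ h; rewrite -(size_box d r) -(size_map (fun v => i + v) (box d r)).
apply: uniq_leq_size => // j /h; rewrite linf_sym => /linf_leP l.
apply/mapP; exists (j - i); last by rewrite addrC subrK.
by rewrite mem_box; apply/linf_leP => k; have := l k; rewrite !mxE subr0.
Qed.

(** Dyadic induction. The points at distance between [r] and [2 r] number at most
    [(4 r + 1) ^ d <= (5 r) ^ d] and contribute at most [r ^- (2 d)] each, in total [(5 / r) ^ d].
    The others contribute at most [2 * (5 / (2 r)) ^ d], which is again at most [(5 / r) ^ d]
    because [d >= 1]. *)
Lemma shell_sum i r J K : (0 < r)%N -> uniq J ->
  (forall j, j \in J -> (r < linf i j <= r * 2 ^ K)%N) ->
  \sum_(j <- J) (linf i j)%:R ^- (2 * d) <= 2 * (5 / r%:R) ^+ d :> R.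
Proof.
elim: K r J => [|K IH] r J r0 uJ h.
  case: J uJ h => [|j J] _ h; first by rewrite big_nil mulr_ge0 ?exprn_ge0 ?divr_ge0 ?ler0n.
  by have := h j (mem_head _ _); rewrite expn0 muln1; lia.
have r0' : 0 < r%:R :> R by rewrite ltr0n.
rewrite (bigID (fun j => linf i j <= 2 * r)%N) /=.
have hnear : \sum_(j <- J | (linf i j <= 2 * r)%N) (linf i j)%:R ^- (2 * d) <=
    (5 / r%:R) ^+ d :> R.
  rewrite -big_filter; set J1 := seq.filter _ J.
  have uJ1 : uniq J1 by exact: filter_uniq.
  have sJ1 : (size J1 <= (5 * r) ^ d)%N.
    apply: (@leq_trans ((2 * r).*2.+1 ^ d)%N); last by rewrite leq_exp2r //; lia.
    by apply: (@ball_count i) => // j; rewrite mem_filter => /andP[].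
  apply: (@le_trans _ _ (\sum_(j <- J1) (r%:R : R) ^- (2 * d))).
    rewrite !big_seq; apply: ler_sum => j; rewrite mem_filter => /andP[_ /h /andP[rj _]].
    rewrite lef_pV2 ?posrE ?exprn_gt0 ?ltr0n //; last by lia.
    by apply: lerXn2r; rewrite ?nnegrE ?ler0n // ler_nat ltnW.
  rewrite big_const_seq count_predT iter_addr_0 -[X in X <= _]mulr_natl.
  apply: (@le_trans _ _ (((5 * r) ^ d)%N%:R * r%:R ^- (2 * d))).
    by rewrite ler_wpM2r ?invr_ge0 ?exprn_ge0 ?ler0n // ler_nat.
  rewrite natrX natrM mul2n -addnn exprD invfM mulrA -exprVn -exprMn mulfK ?gt_eqF //.
  by rewrite -exprMn.
have hfar : \sum_(j <- J | ~~ (linf i j <= 2 * r)%N) (linf i j)%:R ^- (2 * d) <=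
    (5 / r%:R) ^+ d :> R.
  rewrite -big_filter; apply: le_trans (IH (2 * r)%N _ _ _ _) _.
  - by rewrite muln_gt0.
  - exact: filter_uniq.
  - move=> j; rewrite mem_filter -ltnNge => /andP[-> /h /andP[_]].
    by rewrite expnS mulnCA mulnA.
  rewrite natrM invfM mulrCA exprMn.
  rewrite mulrA ler_piMl ?exprn_ge0 ?divr_ge0 ?ler0n //.
  case: d d0 => // n _; rewrite exprS mulrA divff ?pnatr_eq0 // mul1r.
  by rewrite exprn_ile1 // invf_le1 // ler1n.
by rewrite mulrDl mul1r lerD.
Qed.

Lemma tail_sum i r J : (0 < r)%N -> uniq J -> (forall j, j \in J -> (r < linf i j)%N) ->
  \sum_(j <- J) (linf i j)%:R ^- (2 * d) <= 2 * (5 / r%:R) ^+ d :> R.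
Proof.
move=> r0 uJ h; apply: (@shell_sum i r J (\max_(j <- J) linf i j)) => // j jJ.
rewrite h //= -{1}[linf i j]mul1n leq_mul //.
apply: leq_trans (ltnW (ltn_expl _ (isT : 1 < 2)%N)).
exact: leq_bigmax_seq.
Qed.

End LatticeSums.

(** * The law of a configuration *)

Definition Pr {R : realType} {dd : measure_display} {T : measurableType dd}
  (P : probability T R) (A : set T) : R := fine (P A).

Section RealProb.
Variables (R : realType) (dd : measure_display) (T : measurableType dd).
Variable P : probability T R.
Implicit Types A B : set T.

Lemma PrE A : measurable A -> P A = (Pr P A)%:E.
Proof. by move=> mA; rewrite fineK // fin_num_measure. Qed.

Lemma Pr_ge0 A : 0 <= Pr P A.
Proof. by apply: fine_ge0; exact: measure_ge0. Qed.

Lemma le_Pr A B : measurable A -> measurable B -> A `<=` B -> Pr P A <= Pr P B.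
Proof.
move=> mA mB AB; rewrite -lee_fin -(PrE mA) -(PrE mB).
by apply: le_measure AB; rewrite inE.
Qed.

Lemma PrT : Pr P setT = 1.
Proof. by rewrite /Pr probability_setT. Qed.

Lemma Pr0 : Pr P set0 = 0.
Proof. by rewrite /Pr measure0. Qed.

Lemma PrDI A B : measurable A -> measurable B ->
  Pr P A = Pr P (A `&` B) + Pr P (A `\` B).
Proof.
move=> mA mB; have mI := measurableI _ _ mA mB; have mD := measurableD mA mB.
have e : P A = (P (A `\` B) + P (A `&` B))%E by exact: measureDI.
by move: e; rewrite (PrE mA) (PrE mI) (PrE mD) -EFinD => -[->]; rewrite addrC.
Qed.

Lemma PrC A : measurable A -> Pr P (~` A) = 1 - Pr P A.
Proof.
move=> mA; have := PrDI measurableT mA.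
by rewrite PrT setTI setTD => ->; rewrite addrAC subrr add0r.
Qed.

Lemma PrU A B : measurable A -> measurable B -> Pr P (A `|` B) <= Pr P A + Pr P B.
Proof.
move=> mA mB; have mU := measurableU _ _ mA mB.
rewrite (PrDI mU mA) (_ : (A `|` B) `&` A = A); last first.
  by apply/seteqP; split=> x; [case | split=> //; left].
rewrite lerD2l; apply: le_Pr => //.
- exact: measurableD.
- by move=> x [[]].
Qed.

Lemma le_PrU A B N : measurable A -> measurable B -> measurable N ->
  A `<=` B `|` N -> Pr P A <= Pr P B + Pr P N.
Proof.
move=> mA mB mN AB; apply: le_trans (PrU mB mN); apply: le_Pr => //.
exact: measurableU.
Qed.

Lemma eq_set_Pr A B : A = B -> Pr P A = Pr P B.
Proof. by move=> ->. Qed.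

Lemma Pr_exhaust (F : nat -> set T) (e : R) : (forall n, measurable (F n)) ->
  (forall n m, (n <= m)%N -> F n `<=` F m) -> \bigcup_n F n = setT -> 0 < e ->
  exists N, forall n, (N <= n)%N -> 1 - e <= Pr P (F n).
Proof.
move=> mF ndF UF e0.
have mU : measurable (\bigcup_n F n) by exact: bigcup_measurable.
have ndF' : {homo F : n m / (n <= m)%O >-> (n <= m)%O}.
  by move=> n m nm; apply/subsetPset; exact: ndF.
have /= cv := nondecreasing_cvg_mu mF mU ndF' (mu := P).
rewrite UF probability_setT in cv.
have /fine_cvgP[_] := cv.
move/cvgrPdist_le => /(_ e e0)[N _ hN]; exists N => n Nn.
have := hN n Nn; rewrite /= ler_distl => /andP[_ +].
by rewrite -lerBlDr.
Qed.

Lemma Pr_vanish (F : nat -> set T) (e : R) : (forall n, measurable (F n)) ->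
  (forall n m, (n <= m)%N -> F m `<=` F n) -> \bigcap_n F n = set0 -> 0 < e ->
  exists N, forall n, (N <= n)%N -> Pr P (F n) <= e.
Proof.
move=> mF niF IF e0.
have [] := @Pr_exhaust (fun n => ~` F n) e (fun n => measurableC (mF n)) _ _ e0.
- by move=> n m nm; apply: subsetC; exact: niF.
- by rewrite -setC_bigcap IF setC0.
- by move=> N hN; exists N => n /hN; rewrite PrC // lerD2l lerN2.
Qed.

End RealProb.

Section Law.
Variables (R : realType) (d : nat) (beta : R) (dO : measure_display).
Variables (Omega : measurableType dO) (P : probability Omega R).

Definition wt (e : vtx d * vtx d) : R := beta * lrp_kernel_int e.1 e.2.

Definition pe (e : vtx d * vtx d) : R := lrp_edge_prob beta e.1 e.2.

Lemma peE s : map pe s = [seq 1 - expR (- x) | x <- map wt s].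
Proof. by rewrite -map_comp. Qed.

Hypothesis beta0 : 0 < beta.

Lemma wt_ge0 e : (1 < linf e.1 e.2)%N -> 0 <= wt e.
Proof.
move=> l; have /andP[lo _] := @kernel_bounds R d _ _ l.
by rewrite /wt mulr_ge0 ?(ltW beta0) // (le_trans _ lo) // invr_ge0 exprn_ge0 //.
Qed.

Lemma probs_pe s : valid s -> probs (map pe s).
Proof.
move=> [_ v]; apply/allP => _ /mapP[e /v[l _] ->].
rewrite /pe /lrp_edge_prob gerBl expR_ge0 andbT subr_ge0 -expR0 ler_expR oppr_le0.
exact: wt_ge0.
Qed.

Lemma valid_sub (s s' : seq (vtx d * vtx d)) : valid s -> {subset s' <= s} -> uniq s' -> valid s'.
Proof.
move=> [_ v] ss us; split=> // p /ss /v[-> h]; split=> //.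
by apply: contra h; exact: ss.
Qed.

Variable E : Omega -> vtx d -> vtx d -> bool.
Hypothesis hE : is_LRP P beta E.

Let Es w i j : E w i j = E w j i. Proof. by have [h _ _ _ _] := hE; exact: h. Qed.
Let En w : nn_graph (E w). Proof. by move=> i j; have [_ h _ _ _] := hE; exact: h. Qed.
Let Em i j : measurable [set w | E w i j]. Proof. by have [_ _ h _ _] := hE; exact: h. Qed.

Lemma lrp_conn w : conn (E w). Proof. exact/nn_conn/En. Qed.
Lemma lrp_sym w i j : E w i j = E w j i. Proof. exact: Es. Qed.

Lemma cfg_measurable s (A : seq bool -> Prop) : measurable [set w | A (cfg E w s)].
Proof.
elim: s A => [|e s IH] A.
  have [h|h] := pselect (A [::]).
    by rewrite (_ : [set _ | _] = setT) //; apply/seteqP; split.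
  by rewrite (_ : [set _ | _] = set0) //; apply/seteqP; split.
rewrite (_ : [set _ | _] =
   ([set w | E w e.1 e.2] `&` [set w | A (true :: cfg E w s)]) `|`
   (~` [set w | E w e.1 e.2] `&` [set w | A (false :: cfg E w s)])).
  apply: measurableU; apply: measurableI => //.
  - exact: (IH (fun t => A (true :: t))).
  - exact: measurableC.
  - exact: (IH (fun t => A (false :: t))).
apply/seteqP; split=> w /=.
  by case h: (E w e.1 e.2) => ?; [left|right].
by case=> -[]; [move=> ->|move=> /negP/negbTE ->].
Qed.

Let allE (t : seq (vtx d * vtx d)) := \big[setI/setT]_(p <- t) [set w | E w p.1 p.2].

Let allE_measurable t : measurable (allE t).
Proof.
rewrite /allE; elim: t => [|e t IH]; first by rewrite big_nil.
by rewrite big_cons; apply: measurableI.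
Qed.

(** [is_LRP] only gives the probability that all pairs of a list are open. The induction therefore
    carries a list [t] of pairs already required to be open, and treats a closed pair as the
    difference between no requirement and an open pair. *)
Lemma cfg_law s (A : seq bool -> Prop) : valid s ->
  Pr P [set w | A (cfg E w s)] = Pb (map pe s) A.
Proof.
have [_ _ _ hP hI] := hE.
suff H : forall s t A, valid (t ++ s) ->
    Pr P (allE t `&` [set w | A (cfg E w s)]) =
    (\prod_(p <- t) pe p) * Pb (map pe s) A.
  by move=> v; have := H s [::] A v; rewrite /allE !big_nil setTI mul1r.
clear s A; elim=> [|e s IH] t A v.
  have v' : valid t by rewrite -[t]cats0.
  have Pt : Pr P (allE t) = \prod_(p <- t) pe p.
    rewrite /Pr /allE hI; [|by case: v'|by case: v'].
    rewrite /= !big_seq; apply: eq_bigr => p pt.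
    by rewrite hP //; have [_ /(_ p pt)[]] := v'.
  rewrite /= /Pb /=; have [h|h] := pselect (A [::]).
    rewrite asboolT // mulr1 -Pt; apply: eq_set_Pr.
    by apply/seteqP; split=> [w []|w].
  rewrite asboolF // mulr0 -[RHS](Pr0 P); apply: eq_set_Pr.
  by apply/seteqP; split=> [w []|w].
have v1 : valid ((e :: t) ++ s).
  have [u _] := v; apply: valid_sub v _ _; last first.
    by rewrite -(perm_uniq (permEl (perm_catCA t [:: e] s))).
  by move=> p; rewrite (perm_mem (permEl (perm_catCA t [:: e] s))).
have v2 : valid (t ++ s).
  have [+ _] := v1; rewrite cat_cons cons_uniq => /andP[_ u].
  by apply: valid_sub v1 _ u => p; rewrite inE => ->; rewrite orbT.
have m1 := allE_measurable t.
have mA b := cfg_measurable s (fun u => A (b :: u)).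
have mcs := cfg_measurable (e :: s) A.
have IHt := IH (e :: t) (fun u => A (true :: u)) v1.
have IHf := IH (e :: t) (fun u => A (false :: u)) v1.
have IH0 := IH t (fun u => A (false :: u)) v2.
have allEc : allE (e :: t) = [set w | E w e.1 e.2] `&` allE t by rewrite /allE big_cons.
rewrite (PrDI P (measurableI _ _ m1 mcs) (Em e.1 e.2)).
have -> : allE t `&` [set w | A (cfg E w (e :: s))] `&` [set w | E w e.1 e.2] =
   allE (e :: t) `&` [set w | A (true :: cfg E w s)].
  by rewrite allEc; apply/seteqP; split=> w /= => [[[? +] h]|[[h ?] +]]; rewrite h.
have -> : (allE t `&` [set w | A (cfg E w (e :: s))]) `\` [set w | E w e.1 e.2] =
   (allE t `&` [set w | A (false :: cfg E w s)]) `\` [set w | E w e.1 e.2].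
  by apply/seteqP; split=> w /= [[? +] /negP/negbTE h]; rewrite h.
have := PrDI P (measurableI _ _ m1 (mA false)) (Em e.1 e.2).
have -> : allE t `&` [set w | A (false :: cfg E w s)] `&` [set w | E w e.1 e.2] =
   allE (e :: t) `&` [set w | A (false :: cfg E w s)].
  by rewrite allEc; apply/seteqP; split=> w /= => [[[? ?] ?]|[[? ?] ?]].
rewrite IHt IH0 IHf !big_cons => e1.
have -> : Pr P ((allE t `&` [set w | A (false :: cfg E w s)]) `\` [set w | E w e.1 e.2]) =
  (\prod_(p <- t) pe p) * Pb (map pe s) (fun u => A (false :: u)) -
  pe e * (\prod_(p <- t) pe p) * Pb (map pe s) (fun u => A (false :: u)).
  by rewrite e1 addrAC subrr add0r.
by rewrite /Pb /=; ring.
Qed.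

End Law.

(** * Truncation to finite boxes and invariance *)

Section CountableMeasurable.
Variables (dd : measure_display) (T : measurableType dd) (I : countType).

Lemma measurable_ex (F : I -> T -> Prop) : (forall i, measurable [set w | F i w]) ->
  measurable [set w | exists i, F i w].
Proof.
move=> mF; rewrite (_ : [set _ | _] =
  \bigcup_n (if unpickle n is Some i then [set w | F i w] else set0)).
  by apply: bigcup_measurable => n _; case: unpickle.
apply/seteqP; split=> w /=.
  by move=> [i Fi]; exists (pickle i) => //; rewrite pickleK.
by move=> [n _]; case: unpickle => // i Fi; exists i.
Qed.

Lemma measurable_all (F : I -> T -> Prop) : (forall i, measurable [set w | F i w]) ->
  measurable [set w | forall i, F i w].
Proof.
move=> mF; rewrite (_ : [set _ | _] = ~` [set w | exists i, ~ F i w]).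
  by apply: measurableC; apply: measurable_ex => i; exact: measurableC (mF i).
apply/seteqP; split=> w /=.
  by move=> h [i]; apply.
by move=> h i; apply: contrapT => nF; apply: h; exists i.
Qed.

End CountableMeasurable.

Lemma measurable_cond (dd : measure_display) (T : measurableType dd) (Q : Prop)
    (F : T -> Prop) : measurable [set w | F w] -> measurable [set w | Q -> F w].
Proof.
move=> mF; have [q|nq] := pselect Q.
  rewrite (_ : [set _ | _] = [set w | F w]) //.
  by apply/seteqP; split=> w /= h; [exact: h | move=> _; exact: h].
by rewrite (_ : [set _ | _] = setT) //; apply/seteqP; split=> // w _ q; case: nq.
Qed.

Section Trunc.
Variables (R : realType) (d : nat) (beta : R) (dO : measure_display).
Variables (Omega : measurableType dO) (P : probability Omega R).
Variable E : Omega -> vtx d -> vtx d -> bool.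
Hypothesis hE : is_LRP P beta E.
Implicit Types (i j : vtx d) (w : Omega).

Lemma walk_measurable n i j : measurable [set w | walk (E w) n i j].
Proof.
elim: n i => [|n IH] i /=.
  have [->|ne] := eqVneq i j.
    by rewrite (_ : [set _ | _] = setT) //; apply/seteqP; split.
  rewrite (_ : [set _ | _] = set0) //; apply/seteqP; split=> // w /= e.
  by rewrite e eqxx in ne.
apply: (measurable_ex (F := fun z w => E w i z /\ walk (E w) n z j)) => z.
by have [_ _ h _ _] := hE; exact: measurableI (h i z) (IH z).
Qed.

Lemma nd_measurable (A : nat -> Prop) i j : measurable [set w | A (nd (E w) i j)].
Proof.
have m k : measurable [set w | nd (E w) i j = k].
  rewrite (_ : [set _ | _] = [set w | walk (E w) k i j] `&`
     [set w | forall l : 'I_k, ~ walk (E w) l i j]).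
    apply: measurableI; first exact: walk_measurable.
    by apply: measurable_all => l; exact: measurableC (walk_measurable l i j).
  apply/seteqP; split=> w /=.
    move=> <-; split; first exact/nd_walk/(lrp_conn hE).
    by move=> l wl; have := nd_le wl; rewrite leqNgt ltn_ord.
  move=> [wk nl]; apply/eqP; rewrite eqn_leq nd_le //= leqNgt; apply/negP => lt.
  by apply: (nl (Ordinal lt)); apply/nd_walk/(lrp_conn hE).
rewrite (_ : [set _ | _] = [set w | exists k, A k /\ nd (E w) i j = k]).
  apply: measurable_ex => k; have [h|h] := pselect (A k).
    by rewrite (_ : [set _ | _] = [set w | nd (E w) i j = k]) //;
      apply/seteqP; split=> w /=; [case|].
  by rewrite (_ : [set _ | _] = set0) //; apply/seteqP; split=> w //= -[].
apply/seteqP; split=> w /=; first by exists (nd (E w) i j).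
by move=> [k [Ak ->]].
Qed.

Lemma walk_trunc w n i j : walk (E w) n i j -> exists L0 n', (n' <= n)%N /\
  forall L, (L0 <= L)%N -> walk (Gof (edges d L) (cfg E w (edges d L))) n' i j.
Proof.
elim: n i => [|n IH] i /=; first by move=> ->; exists 0%N, 0%N.
move=> [z [iz /IH[L0 [n' [n'n h]]]]].
(* A loop of [E w] is not listed in [edges]; dropping it only shortens the walk, which is why [n']
   may be smaller than [n]. *)
case: (posnP (linf i z)) => [/linf_eq0 ->|l0].
  by exists L0, n'; split=> //; apply: leqW.
exists (maxn L0 (maxn (rad i) (rad z))), n'.+1; split=> // L.
rewrite !geq_max => /and3P[LL0 Li Lz]; exists z; split; last exact: h.
rewrite Gof_cfg; case: (ltngtP 1 (linf i z)) => //= [l|]; last by lia.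
by have := mem_edges l Li Lz; rewrite (lrp_sym hE w z i) iz !andbT.
Qed.

Lemma Gof_cfg_sub w s i j : Gof s (cfg E w s) i j -> E w i j.
Proof.
rewrite Gof_cfg => /or3P[/eqP|/andP[_]|/andP[_]] //.
  by have [_ h _ _ _] := hE; exact: h.
by rewrite (lrp_sym hE).
Qed.

Lemma Gof_conn s t : conn (@Gof d s t).
Proof. exact/nn_conn/Gof_nn. Qed.

Definition trunc_ok L r : set Omega := [set w | forall i j, (rad i <= r)%N -> (rad j <= r)%N ->
  nd (Gof (edges d L) (cfg E w (edges d L))) i j = nd (E w) i j].

Lemma trunc_ok_measurable L r : measurable (trunc_ok L r).
Proof.
apply: measurable_all => i; apply: measurable_all => j.
apply: measurable_cond; apply: measurable_cond.
rewrite (_ : [set _ | _] = [set w | exists k,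
  nd (Gof (edges d L) (cfg E w (edges d L))) i j = k /\ nd (E w) i j = k]).
  apply: measurable_ex => k; apply: measurableI.
    exact: (cfg_measurable hE (edges d L) (fun t => nd (Gof (edges d L) t) i j = k)).
  exact: (nd_measurable (fun l => l = k)).
apply/seteqP; split=> w /=; first by move=> ->; exists (nd (E w) i j).
by move=> [k [-> ->]].
Qed.

(** Truncation removes edges, so distances can only grow; a geodesic between two given points
    survives as soon as [L] is large, and the box of radius [r] holds finitely many pairs. *)
Lemma trunc_cvg r (e : R) : 0 < e -> exists L0, forall L, (L0 <= L)%N ->
  1 - e <= Pr P (trunc_ok L r).
Proof.
move=> e0; pose F n : set Omega := [set w | forall L, (n <= L)%N -> trunc_ok L r w].
have mF n : measurable (F n).
  apply: measurable_all => L; apply: measurable_cond; exact: trunc_ok_measurable.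
have [] := @Pr_exhaust _ _ _ P F e mF _ _ e0.
- by move=> n m nm w h L mL; apply: h; exact: leq_trans mL.
- rewrite -subTset => w _.
  have H i j : exists L0, forall L, (L0 <= L)%N ->
      nd (Gof (edges d L) (cfg E w (edges d L))) i j = nd (E w) i j.
    have [L0 [n' [n'n h]]] := walk_trunc (nd_walk i j (lrp_conn hE w)).
    exists L0 => L LL; have h' := nd_le (h L LL).
    apply/eqP; rewrite eqn_leq (leq_trans h' n'n).
    apply: nd_mono; [exact: Gof_conn | exact: Gof_cfg_sub].
  pose L0 i j := projT1 (cid (H i j)).
  exists (\max_(i <- box d r) \max_(j <- box d r) L0 i j)%N => // L hL i j ir jr.
  apply: (projT2 (cid (H i j))); apply: leq_trans hL.
  rewrite -/(L0 i j); apply: (@leq_trans (\max_(j <- box d r) L0 i j)%N).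
    by apply: (@leq_bigmax_seq _ _ _ (fun j => L0 i j) j); rewrite ?mem_box.
  by apply: (@leq_bigmax_seq _ _ _ (fun i => \max_(j <- box d r) L0 i j)%N i); rewrite ?mem_box.
- move=> N hN; exists N => L NL; apply: le_trans (hN _ (leqnn N)) _.
  apply: le_Pr => //; first exact: trunc_ok_measurable.
  by move=> w; apply.
Qed.

End Trunc.

(** * The law of the distances is invariant under lattice symmetries *)

Section Invariance2.
Variables (R : realType) (d : nat) (beta : R) (dO : measure_display).
Variables (Omega : measurableType dO) (P : probability Omega R).
Hypothesis beta0 : 0 < beta.
Implicit Types (i j : vtx d) (w : Omega).

(** By [cfg_law] both graphs have the same law in every finite box, and outside an event of small
    probability the distance is already that of a large box. *)
Lemma lrp_law_unique (E E' : Omega -> vtx d -> vtx d -> bool) (A : nat -> Prop) i j :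
  is_LRP P beta E -> is_LRP P beta E' ->
  Pr P [set w | A (nd (E w) i j)] = Pr P [set w | A (nd (E' w) i j)].
Proof.
suff H F F' : is_LRP P beta F -> is_LRP P beta F' ->
    Pr P [set w | A (nd (F w) i j)] <= Pr P [set w | A (nd (F' w) i j)].
  by move=> h h'; apply/eqP; rewrite eq_le !H.
move=> hF hF'; apply/ler_addgt0Pr => e e0.
have e20 : 0 < e / 2 by rewrite divr_gt0.
pose r := maxn (rad i) (rad j).
have [L1 h1] := trunc_cvg hF r e20; have [L2 h2] := trunc_cvg hF' r e20.
pose L := maxn L1 L2.
have {}h1 := h1 L (leq_maxl _ _); have {}h2 := h2 L (leq_maxr _ _).
have m1 := trunc_ok_measurable hF L r; have m2 := trunc_ok_measurable hF' L r.
pose B (t : seq bool) := A (nd (Gof (edges d L) t) i j).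
have c1 := cfg_law hF B (edges_valid d L); have c2 := cfg_law hF' B (edges_valid d L).
have mB1 := cfg_measurable hF (edges d L) B.
have mB2 := cfg_measurable hF' (edges d L) B.
have mA1 := nd_measurable hF A i j; have mA2 := nd_measurable hF' A i j.
have k1 := @le_PrU _ _ _ P _ _ _ mA1 mB1 (measurableC m1).
have k2 := @le_PrU _ _ _ P _ _ _ mB2 mA2 (measurableC m2).
have s1 : [set w | A (nd (F w) i j)] `<=`
    [set w | B (cfg F w (edges d L))] `|` ~` trunc_ok F L r.
  move=> w Aw; have [ok|nok] := pselect (trunc_ok F L r w); last by right.
  by left; rewrite /= /B ok ?leq_maxl ?leq_maxr.
have s2 : [set w | B (cfg F' w (edges d L))] `<=`
    [set w | A (nd (F' w) i j)] `|` ~` trunc_ok F' L r.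
  move=> w Bw; have [ok|nok] := pselect (trunc_ok F' L r w); last by right.
  by left; rewrite /= -(ok i j) ?leq_maxl ?leq_maxr.
by move: (k1 s1) (k2 s2); rewrite !PrC // c1 c2; lra.
Qed.

Lemma lrp_sperm (E : Omega -> vtx d -> vtx d -> bool) s pi p : is_LRP P beta E ->
  is_LRP P beta (fun w i j => E w (sperm s pi p i) (sperm s pi p j)).
Proof.
move=> [h1 h2 h3 h4 h5]; pose g := sperm s pi p.
have ginj : injective g by exact: can_inj (@spermK d s pi p).
split=> //.
- by move=> w i j l; apply: h2; rewrite sperm_linf.
- by move=> i j l; rewrite h4 ?sperm_linf // /lrp_edge_prob kernel_sperm.
move=> r ur vr; pose f (e : vtx d * vtx d) := (g e.1, g e.2).
have finj : injective f by move=> [a b] [a' b'] [/ginj -> /ginj ->].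
have := h5 (map f r); rewrite !big_map; apply; first by rewrite map_inj_uniq.
move=> _ /mapP[e /vr[l ne] ->]; rewrite sperm_linf; split=> //.
by rewrite -[(_, _)]/(f (e.2, e.1)) (mem_map finj).
Qed.

Lemma nd_sperm_law (E : Omega -> vtx d -> vtx d -> bool) s pi p (A : nat -> Prop) i j :
  is_LRP P beta E ->
  Pr P [set w | A (nd (E w) (sperm s pi p i) (sperm s pi p j))] =
  Pr P [set w | A (nd (E w) i j)].
Proof.
move=> hE; rewrite -(@lrp_law_unique _ E A i j (lrp_sperm s pi p hE) hE).
apply: eq_set_Pr; apply/seteqP.
by split=> w /=; rewrite (nd_bij _ _ (@spermK d s pi p) (@sperm_invK d s pi p))
  //; exact: (lrp_conn hE).
Qed.

End Invariance2.

(** * Long edges *)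

Section LongEdges.
Variables (R : realType) (d : nat) (beta : R).
Implicit Types (i j : vtx d) (e : vtx d * vtx d) (L a b : nat).

Definition cross a b e : bool :=
  ((rad e.1 <= a) && (b < rad e.2))%N || ((rad e.2 <= a) && (b < rad e.1))%N.

Lemma cross_linf a b i j : (a <= b)%N -> (rad i <= a)%N -> (b < rad j)%N -> (b - a < linf i j)%N.
Proof.
move=> ab ia bj; have : (rad j <= linf j i + rad i)%N by exact: linf_triangle.
by rewrite (linf_sym j i); lia.
Qed.

Lemma mask_wt (s : seq (vtx d * vtx d)) (q : pred (vtx d * vtx d)) :
  \sum_(x <- mask (map q s) (map (wt beta) s)) x = \sum_(e <- s | q e) wt beta e.
Proof. by rewrite -map_mask -filter_mask big_map big_filter. Qed.

Hypotheses (d0 : (0 < d)%N) (beta0 : 0 < beta).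

(** For [M >= 2] one has [M - 1 >= M / 2], which is the origin of [4 ^+ d]. *)
Lemma wt_le e : (1 < linf e.1 e.2)%N ->
  wt beta e <= beta * (4 ^+ d * (linf e.1 e.2)%:R ^- (2 * d)).
Proof.
move=> l; have /andP[_ up] := @kernel_bounds R d _ _ l.
rewrite /wt ler_pM2l //; apply: le_trans up _.
move: l; set M := linf _ _ => l.
have M2 : 2 <= M%:R :> R by rewrite ler_nat.
have M0 : 0 < M%:R :> R by rewrite ltr0n; lia.
have -> : 4 ^+ d * (M%:R ^- (2 * d)) = ((M%:R / 2) ^+ 2) ^- d :> R.
  rewrite exprM -[RHS]exprVn -[X in _ * X]exprVn -exprMn; congr (_ ^+ d).
  by field; rewrite gt_eqF.
have p0 : 0 < (M%:R / 2) ^+ 2 :> R by rewrite exprn_gt0 // divr_gt0.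
have le : (M%:R / 2) ^+ 2 <= (M%:R - 1) ^+ 2 :> R.
  by rewrite ler_sqr ?nnegrE //; lra.
have q0 : 0 < (M%:R - 1) ^+ 2 :> R by exact: lt_le_trans le.
rewrite lef_pV2 ?posrE; [|exact: exprn_gt0|exact: exprn_gt0].
by apply: lerXn2r; rewrite // nnegrE ltW.
Qed.

(** At most [(2 a + 1) ^ d] inner points, each with a tail sum beyond distance [b - a]. The 4 is the
    2 of [tail_sum] times the two orientations, and [20 = 4 * 5] joins [wt_le] and [tail_sum]. When
    [a] and [b] are multiples of [n] the bound does not depend on [n]: this is the scale invariance
    of the critical model. *)
Lemma cross_weight L a b : (a < b)%N ->
  \sum_(e <- edges d L | cross a b e) wt beta e <=
  4 * beta * (20 * (a.*2.+1)%:R / (b - a)%:R) ^+ d.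
Proof.
move=> ab; pose K i j : R := beta * (4 ^+ d * (linf i j)%:R ^- (2 * d)).
have K0 i j : 0 <= K i j.
  by rewrite mulr_ge0 ?(ltW beta0) // mulr_ge0 ?exprn_ge0 // invr_ge0 exprn_ge0 // ler0n.
have Ksym i j : K i j = K j i by rewrite /K linf_sym.
pose A i j := (rad i <= a)%N && (b < rad j)%N.
pose S := \sum_(i <- box d L) \sum_(j <- box d L | A i j) K i j.
have half : S <= 2 * beta * (20 * (a.*2.+1)%:R / (b - a)%:R) ^+ d.
  rewrite /S (bigID (fun i => rad i <= a)%N) /= [X in _ + X]big1 ?addr0; last first.
    by move=> i /negbTE ia; rewrite big_pred0 // => j; rewrite /A ia.
  apply: (@le_trans _ _ (\sum_(i <- box d L | (rad i <= a)%N)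
     beta * (4 ^+ d * (2 * (5 / (b - a)%:R) ^+ d)))).
    apply: ler_sum => i ia; rewrite -!mulr_sumr ler_pM2l // ler_pM2l ?exprn_gt0 //.
    rewrite -big_filter; apply: tail_sum => //; first by rewrite subn_gt0.
      exact/filter_uniq/box_uniq.
    by move=> j; rewrite mem_filter => /andP[/andP[_ bj] _]; exact: (cross_linf (ltnW ab)).
  rewrite -big_filter big_const_seq count_predT iter_addr_0 -[X in X <= _]mulr_natl.
  apply: (@le_trans _ _ ((a.*2.+1 ^ d)%N%:R * (beta * (4 ^+ d * (2 * (5 / (b - a)%:R) ^+ d))))).
    apply: ler_wpM2r.
      by rewrite !mulr_ge0 ?(ltW beta0) ?exprn_ge0 // divr_ge0 ?ler0n.
    rewrite ler_nat; apply: (@ball_count d 0 a).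
      exact/filter_uniq/box_uniq.
    by move=> j; rewrite mem_filter linf_sym => /andP[].
  rewrite natrX le_eqVlt; apply/orP; left; apply/eqP.
  set x := _.+1%:R; set y := (b - a)%:R.
  have -> : 20 * x / y = 4 * x * (5 / y) by ring.
  by rewrite !exprMn; ring.
apply: (@le_trans _ _ (S + S)); last by lra.
have {2}-> : S = \sum_(i <- box d L) \sum_(j <- box d L | A j i) K i j.
  rewrite /S; under eq_bigr do rewrite big_mkcond; rewrite exchange_big /=.
  apply: eq_bigr => i _; rewrite [RHS]big_mkcond; apply: eq_bigr => j _.
  by rewrite Ksym.
rewrite /S -big_split /= /edges big_filter_cond.
apply: (@le_trans _ _ (\sum_(e <- [seq (i, j) | i <- box d L, j <- box d L])
   ((if A e.1 e.2 then K e.1 e.2 else 0) + (if A e.2 e.1 then K e.1 e.2 else 0)))); last first.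
  rewrite big_allpairs le_eqVlt; apply/orP; left; apply/eqP.
  apply: eq_bigr => i _ /=; rewrite big_split /=; congr (_ + _); by rewrite [RHS]big_mkcond.
rewrite big_mkcond; apply: ler_sum => e _; case: ifPn => [|_]; last first.
  by rewrite addr_ge0 //; case: ifP.
move=> /andP[/andP[l _] c]; apply: le_trans (wt_le l) _; rewrite -/(K e.1 e.2).
have p1 : 0 <= (if A e.1 e.2 then K e.1 e.2 else 0) by case: ifP.
have p2 : 0 <= (if A e.2 e.1 then K e.1 e.2 else 0) by case: ifP.
by case/orP: c p1 p2 => c; rewrite -/(A _ _) in c; rewrite c; lra.
Qed.

Lemma size_pe (s : seq (vtx d * vtx d)) (q : pred (vtx d * vtx d)) :
  size (map q s) = size (map (pe beta) s).
Proof. by rewrite !size_map. Qed.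

Lemma Pb_off_wt (s : seq (vtx d * vtx d)) (q : pred (vtx d * vtx d)) :
  Pb (map (pe beta) s) (fun t => off (map q s) t) = expR (- \sum_(e <- s | q e) wt beta e).
Proof. by rewrite (@Pb_off_exp _ _ (map (wt beta) s)) ?size_pe ?mask_wt // -peE. Qed.

Lemma cross_off L a b : (a < b)%N ->
  expR (- (4 * beta * (20 * (a.*2.+1)%:R / (b - a)%:R) ^+ d)) <=
  Pb (map (pe beta) (edges d L)) (fun t => off (map (cross a b) (edges d L)) t).
Proof. by move=> ab; rewrite Pb_off_wt ler_expR lerN2; exact: cross_weight. Qed.

Definition between (Q Q' : seq (vtx d)) e : bool :=
  ((e.1 \in Q) && (e.2 \in Q')) || ((e.2 \in Q) && (e.1 \in Q')).

Lemma between_on L M (Q Q' : seq (vtx d)) : uniq Q -> uniq Q' ->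
  {subset Q <= box d L} -> {subset Q' <= box d L} ->
  (forall i j, i \in Q -> j \in Q' -> (1 < linf i j <= M)%N) ->
  1 - expR (- (beta * (d%:R * (M%:R + 1) ^+ 2) ^- d * (size Q * size Q')%:R)) <=
  Pb (map (pe beta) (edges d L)) (fun t => ~ off (map (between Q Q') (edges d L)) t).
Proof.
move=> uQ uQ' QL QL' h; rewrite PbC Pb_off_wt lerD2l lerN2 ler_expR lerN2.
set c := beta * _.
have c0 : 0 <= c.
  by rewrite /c mulr_ge0 ?(ltW beta0) // invr_ge0 exprn_ge0 // mulr_ge0 ?ler0n.
pose T := [seq e <- edges d L | between Q Q' e].
have sT : (size Q * size Q' <= size T)%N.
  (* Each pair is sent to whichever of its two orientations is listed; the distances between [Q] and
     [Q'] keep this map injective. *)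
  pose f (e : vtx d * vtx d) := if e \in edges d L then e else (e.2, e.1).
  rewrite -(size_allpairs pair) -(size_map f); apply: uniq_leq_size.
    rewrite map_inj_in_uniq; first by apply: allpairs_uniq => // -[? ?] [? ?] _ _ [-> ->].
    move=> _ _ /allpairsP[[i j] /= [iQ jQ ->]] /allpairsP[[i' j'] /= [iQ' jQ' ->]].
    have a1 := h i j' iQ jQ'; have a2 := h i' j iQ' jQ.
    by rewrite /f; case: ifP; case: ifP => //= _ _ [e1 e2];
      move: a1 a2; rewrite e1 ?e2 ?linf_xx // -e1 ?linf_xx.
  move=> _ /mapP[_ /allpairsP[[i j] /= [iQ jQ ->]] ->].
  have l := h i j iQ jQ.
  have := @mem_edges d L i j; case/andP: l => l _; rewrite -!mem_box => /(_ l (QL _ iQ) (QL' _ jQ)) hor.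
  rewrite /T /f; case: ifP hor => [hij _|_ /= hji].
    by rewrite mem_filter hij /between /= iQ jQ.
  by rewrite mem_filter hji /between /= iQ jQ orbT.
apply: (@le_trans _ _ (c * (size T)%:R)).
  by rewrite ler_wpM2l // ler_nat.
rewrite -big_filter -/T mulr_natr -iter_addr_0 -(count_predT T) -big_const_seq.
rewrite !big_seq; apply: ler_sum => e; rewrite mem_filter => /andP[be eL].
have [_ /(_ _ eL)[l _]] := edges_valid d L.
have lM : (linf e.1 e.2 <= M)%N.
  by case/orP: be => /andP[q q']; have /andP[] := h _ _ q q'; rewrite // linf_sym.
have /andP[lo _] := @kernel_bounds R d _ _ l.
rewrite /c /wt ler_pM2l //; apply: le_trans lo.
have d0' : 0 < d%:R :> R by rewrite ltr0n.
have x0 (n : nat) : 0 < d%:R * (n%:R + 1) ^+ 2 :> R.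
  by rewrite mulr_gt0 // exprn_gt0 // ltr_wpDl ?ler0n.
rewrite lef_pV2 ?posrE ?exprn_gt0 //.
apply: lerXn2r; rewrite ?nnegrE ?(ltW (x0 _)) // ler_pM2l //.
by apply: lerXn2r; rewrite ?nnegrE ?addr_ge0 ?ler0n // lerD2r ler_nat.
Qed.

End LongEdges.

(** * Consequences of the convergence in law *)

(** The test functionals for the convergence in law: when [K] lies in a compact set and [phi] is
    Lipschitz with values between 0 and 1, this is bounded and continuous for locally uniform
    convergence. *)
Definition Fsup {R : realType} {U : Type} (K : set U) (phi : R -> R) (f : U -> R) : R :=
  sup [set phi (f z) | z in K].

Section FsupFacts.
Variables (R : realType) (U : Type) (K : set U) (phi : R -> R).
Hypotheses (K0 : K !=set0) (phi01 : forall t, 0 <= phi t <= 1).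
Implicit Types f g : U -> R.

Lemma Fsup_ub f z : K z -> phi (f z) <= Fsup K phi f.
Proof.
move=> Kz; apply: ub_le_sup; last by exists z.
by exists 1 => _ [y _ <-]; have /andP[] := phi01 (f y).
Qed.

Lemma Fsup_le f c : (forall z, K z -> phi (f z) <= c) -> Fsup K phi f <= c.
Proof.
move=> h; apply: ge_sup; first by have [z Kz] := K0; exists (phi (f z)), z.
by move=> _ [z Kz <-]; exact: h.
Qed.

Lemma Fsup_ge0 f : 0 <= Fsup K phi f.
Proof.
have [z Kz] := K0; apply: le_trans (Fsup_ub f Kz).
by have /andP[] := phi01 (f z).
Qed.

Lemma Fsup_le1 f : Fsup K phi f <= 1.
Proof. by apply: Fsup_le => z _; have /andP[] := phi01 (f z). Qed.

Lemma Fsup_lip f g (e : R) : (forall z, K z -> phi (f z) <= phi (g z) + e) ->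
  Fsup K phi f <= Fsup K phi g + e.
Proof.
move=> h; apply: Fsup_le => z Kz; apply: le_trans (h z Kz) _.
by rewrite lerD2r Fsup_ub.
Qed.

End FsupFacts.

Section IntegralBounds.
Variables (R : realType) (dd : measure_display) (T : measurableType dd).
Variables (P : probability T R) (F : T -> R).
Hypothesis F01 : forall w, 0 <= F w <= 1.
Implicit Types A : set T.


Lemma int01_fin : (\int[P]_w (F w)%:E)%E \is a fin_num.
Proof.
have h0 : (0 <= \int[P]_w (F w)%:E)%E.
  by apply: integral_ge0 => w _; rewrite lee_fin; have /andP[] := F01 w.
have h1 : (\int[P]_w (F w)%:E <= \int[P]_w (cst 1%E w))%E.
  apply: ge0_le_integral_nomeas => w _; rewrite lee_fin;
  by have /andP[] := F01 w.
rewrite integral_cst //= mul1e in h1.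
have P1 : (P setT = 1)%E by exact: probability_setT.
rewrite P1 in h1.
by rewrite ge0_fin_numE // (le_lt_trans h1) // ltry.
Qed.

Lemma Pr_le_int A : measurable A -> (forall w, A w -> 1 <= F w) ->
  Pr P A <= fine (\int[P]_w (F w)%:E)%E.
Proof.
move=> mA h; rewrite -lee_fin (fineK int01_fin) -PrE //.
rewrite -[X in (P X <= _)%E]setIT -integral_indic //.
apply: ge0_le_integral_nomeas => w _; rewrite lee_fin indicE ?ler0n //.
have [/set_mem|_] := boolP (w \in A); first exact: h.
by have /andP[] := F01 w.
Qed.

Lemma int_le_Pr A : measurable A -> (forall w, ~ A w -> F w <= 0) ->
  fine (\int[P]_w (F w)%:E)%E <= Pr P A.
Proof.
move=> mA h; rewrite -lee_fin (fineK int01_fin) -PrE //.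
rewrite -[X in (_ <= P X)%E]setIT -integral_indic //.
apply: ge0_le_integral_nomeas => w _; rewrite lee_fin; have /andP[F0 F1] := F01 w => //.
rewrite indicE; have [_|/negP nA] := boolP (w \in A) => //.
by apply: h => Aw; apply: nA; rewrite inE.
Qed.

End IntegralBounds.

Section LawBounds.
Variables (R : realType) (dO dO' : measure_display).
Variables (Omega : measurableType dO) (Omega' : measurableType dO').
Variables (P : probability Omega R) (P' : probability Omega' R) (d : nat).
Let U := ('rV[R]_d * 'rV[R]_d)%type.
Variables (X : nat -> Omega -> U -> R) (Y : Omega' -> U -> R).
Hypothesis cv : cvg_in_law_lu P P' X Y.
Variables (K Kc : set U) (phi : R -> R) (C : R).
Hypotheses (cK : compact Kc) (KKc : K `<=` Kc) (K0 : K !=set0) (phi01 : forall t, 0 <= phi t <= 1).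
Hypotheses (C0 : 0 < C) (phi_lip : forall s t, phi s <= phi t + C * `|s - t|).

Lemma Fsup_near (f : {family compact, U -> R}) (e : R) : 0 < e ->
  nbhs f [set g : {family compact, U -> R} | `|Fsup K phi f - Fsup K phi g| <= e].
Proof.
move=> e0.
pose B : set (R * R) := [set xy | ball xy.1 (e / C) xy.2].
have eB : entourage B by apply: (@entourage_ball R R (PosNum (divr_gt0 e0 C0))).
have := @fam_nbhs U R compact Kc B f eB cK.
apply: filterS => g h.
have cl z : K z -> C * `|f z - g z| <= e.
  move=> Kz; have := h z (KKc Kz); rewrite /B /= /ball /= => lt.
  by rewrite mulrC -ler_pdivlMr // ltW.
have h1 : Fsup K phi f <= Fsup K phi g + e.
  by apply: Fsup_lip => // z Kz; apply: le_trans (phi_lip (f z) (g z)) _; rewrite lerD2l cl.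
have h2 : Fsup K phi g <= Fsup K phi f + e.
  by apply: Fsup_lip => // z Kz; apply: le_trans (phi_lip (g z) (f z)) _;
    rewrite lerD2l distrC cl.
by rewrite /= ler_norml; apply/andP; split; lra.
Qed.

Lemma Fsup_continuous : continuous (Fsup K phi : {family compact, U -> R} -> R).
Proof.
move=> f.
by apply: (iffRL (@cvgrPdist_le R R _ (nbhs f) _ (Fsup K phi) (Fsup K phi f))) => e;
  exact: Fsup_near.
Qed.

Let F01 (f : U -> R) : 0 <= Fsup K phi f <= 1.
Proof. by rewrite Fsup_ge0 // Fsup_le1. Qed.

Let cvF (e : R) : 0 < e -> exists N, forall n, (N <= n)%N ->
  `|fine (\int[P']_w (Fsup K phi (Y w))%:E)%E - fine (\int[P]_w (Fsup K phi (X n w))%:E)%E| <= e.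
Proof.
move=> e0; have := cv Fsup_continuous.
have b : exists M : R, forall f : {family compact, U -> R}, `|Fsup K phi f| <= M.
  by exists 1 => f; have /andP[h0 h1] := F01 f; rewrite ger0_norm.
move=> /(_ b).
have fin := int01_fin P' (fun w => F01 (Y w)).
rewrite -(fineK fin) => /fine_cvgP[_ /cvgrPdist_le /(_ e e0)[N _ hN]].
by exists N => n Nn; exact: hN.
Qed.

(** A portmanteau inequality: the functional is at least 1 on the lattice event [A n] and at most 0
    off the limit event [B], so its integrals separate the two probabilities. *)
Lemma law_upper (A : nat -> set Omega) (B : set Omega') (e : R) : 0 < e ->
  (forall n, measurable (A n)) -> measurable B ->
  (forall n w, A n w -> exists2 z, K z & 1 <= phi (X n w z)) ->
  (forall w, ~ B w -> forall z, K z -> phi (Y w z) <= 0) ->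
  exists N, forall n, (N <= n)%N -> Pr P (A n) <= Pr P' B + e.
Proof.
move=> e0 mA mB hA hB; have [N hN] := cvF e0; exists N => n /hN.
have h1 : Pr P (A n) <= fine (\int[P]_w (Fsup K phi (X n w))%:E)%E.
  apply: Pr_le_int => // w /hA[z Kz h]; apply: le_trans h _; exact: Fsup_ub.
have h2 : fine (\int[P']_w (Fsup K phi (Y w))%:E)%E <= Pr P' B.
  by apply: int_le_Pr => // w /hB h; apply: Fsup_le.
by rewrite ler_distlC => /andP[_]; lra.
Qed.

Lemma law_lower (A : nat -> set Omega) (B : set Omega') (e : R) : 0 < e ->
  (forall n, measurable (A n)) -> measurable B ->
  (forall w, B w -> exists2 z, K z & 1 <= phi (Y w z)) ->
  (forall n w, ~ A n w -> forall z, K z -> phi (X n w z) <= 0) ->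
  exists N, forall n, (N <= n)%N -> Pr P' B <= Pr P (A n) + e.
Proof.
move=> e0 mA mB hB hA; have [N hN] := cvF e0; exists N => n /hN.
have h1 : Pr P' B <= fine (\int[P']_w (Fsup K phi (Y w))%:E)%E.
  apply: Pr_le_int => // w /hB[z Kz h]; apply: le_trans h _; exact: Fsup_ub.
have h2 : fine (\int[P]_w (Fsup K phi (X n w))%:E)%E <= Pr P (A n).
  by apply: int_le_Pr => // w /hA h; apply: Fsup_le.
by rewrite ler_distlC => /andP[]; lra.
Qed.

End LawBounds.

(** * Compactness, separability and measurability for functions of two points *)

Section Plane.
Variables (R : realType) (d : nat).
Let U := ('rV[R]_d * 'rV[R]_d)%type.

Definition cdist_lt (z z' : U) (e : R) : Prop :=
  forall k, `|z.1 ord0 k - z'.1 ord0 k| < e /\ `|z.2 ord0 k - z'.2 ord0 k| < e.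

Lemma nbhs_cdist (z : U) (A : set U) :
  nbhs z A <-> exists2 e : R, 0 < e & forall z', cdist_lt z z' e -> A z'.
Proof.
split.
  move=> /nbhs_ballP[e /= e0 h]; exists e => // z' zz'; apply: h.
  by split; split=> // i k; rewrite (ord1 i); have [] := zz' k.
move=> [e e0 h]; apply/nbhs_ballP; exists e => //= z' [[_ h1] [_ h2]]; apply: h => k.
by split; [exact: h1 | exact: h2].
Qed.

Definition Kbox (rho : R) : set U :=
  [set z : U | forall k, `|z.1 ord0 k| <= rho /\ `|z.2 ord0 k| <= rho].

Lemma Kbox_compact rho : compact (Kbox rho).
Proof.
have c1 : compact [set v : 'rV[R]_d | forall k, `[- rho, rho]%classic (v ord0 k)].
  by apply: (@rV_compact _ _ (fun=> `[- rho, rho]%classic)) => k; exact: segment_compact.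
have := compact_setX c1 c1; rewrite (_ : _ `*` _ = Kbox rho) //.
apply/seteqP; split=> -[u v].
  by move=> [/= h1 h2] k /=; have := h1 k; have := h2 k; rewrite !in_itv /= -!ler_norml.
by move=> h; split=> k /=; have [/=] := h k; rewrite in_itv /= -ler_norml.
Qed.

Lemma Kbox_uniform rho (Q : nat -> U -> Prop) :
  (forall z, Kbox rho z -> exists2 A : set U, nbhs z A &
     exists N, forall n, (N <= n)%N -> forall z', A z' -> Q n z') ->
  exists N, forall n, (N <= n)%N -> forall z, Kbox rho z -> Q n z.
Proof.
move=> h; have /compact_near_coveringP := @Kbox_compact rho.
move=> /(_ nat \oo Q _)[]; last by move=> N _ hN; exists N => n Nn z; exact: hN.
move=> z /h[A nA [N hN]]; exists (A, [set n | (N <= n)%N]) => /=.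
  by split=> //; exists N.
by move=> [z' n] /= [Az' Nn]; exact: hN.
Qed.

Lemma rat_close (x e : R) : 0 < e -> exists q : rat, `|x - ratr q| < e.
Proof.
move=> e0; have [|q] := @rat_in_itvoo R (x - e) (x + e); first by lra.
by rewrite in_itv /= => /andP[h1 h2]; exists q; rewrite ltr_norml; apply/andP; split; lra.
Qed.

(** For every rational box that meets [K], one point of [K] in it is selected. Bounds over an
    uncountable [K] then become countable conjunctions, hence measurable events. *)
Lemma dense_subset (K : set U) : K !=set0 -> exists2 q : nat -> U, (forall n, K (q n)) &
  forall z (A : set U), K z -> nbhs z A -> exists n, A (q n).
Proof.
move=> [z0 Kz0].
pose I := ('rV[rat]_d * 'rV[rat]_d * nat)%type.
pose cen (x : I) : U := (map_mx ratr x.1.1, map_mx ratr x.1.2).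
pose S (x : I) : set U := [set z | K z /\ cdist_lt z (cen x) (x.2.+1%:R^-1)].
pose q n : U := if unpickle n is Some x then
  (if pselect (S x !=set0) is left h then projT1 (cid h) else z0) else z0.
have qK n : K (q n).
  rewrite /q; case: unpickle => // x; case: pselect => // h.
  by case: cid => z [].
exists q => // z A Kz /nbhs_cdist[e e0 hA].
have [m hm] : exists m : nat, m.+1%:R^-1 < e / 2.
  exists (Num.truncn (e / 2)^-1); rewrite invf_plt ?posrE ?divr_gt0 //.
  exact: truncnS_gt.
have m0 : 0 < m.+1%:R^-1 :> R by rewrite invr_gt0.
pose r (x : R) := projT1 (cid (rat_close x m0)).
have rP x : `|x - ratr (r x)| < m.+1%:R^-1 := projT2 (cid (rat_close x m0)).
pose x : I := ((map_mx r z.1, map_mx r z.2), m).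
have zS : S x z by split=> // k; rewrite !mxE.
exists (pickle x); rewrite /q pickleK; case: pselect => [h|[]]; last by exists z.
case: cid => z' /= [Kz' hz']; apply: hA => k.
have [_ zx] := zS.
have tri (x1 x2 c y : R) : `|x2 - c| < y -> `|x1 - c| < y -> y < e / 2 -> `|x1 - x2| < e.
  rewrite !ltr_norml => /andP[c1 c2] /andP[c3 c4] h5.
  by apply/andP; split; lra.
have [a1 a2] := hz' k; have [b1 b2] := zx k.
by split; [exact: tri a1 b1 hm | exact: tri a2 b2 hm].
Qed.

Variables (dO' : measure_display) (Omega' : measurableType dO').

Lemma sup_le_measurable (F : Omega' -> U -> R) (K : set U) (c : R) :
  (forall z, measurable_fun setT (fun w => F w z)) -> (forall w, continuous (F w)) ->
  measurable [set w | forall z, K z -> F w z <= c].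
Proof.
move=> mF cF; have [->|/set0P] := eqVneq K set0.
  rewrite (_ : [set _ | _] = setT) //.
  by apply/seteqP; split=> // w _ z [].
move=> K0; have [q qK qd] := dense_subset K0.
rewrite (_ : [set _ | _] = [set w | forall n, F w (q n) <= c]).
  apply: measurable_all => n.
  have := mF (q n) measurableT `]-oo, c]%classic (measurable_itv _).
  by rewrite setTI (_ : _ @^-1` _ = [set w | F w (q n) <= c]) //;
    apply/seteqP; split=> w /=; rewrite in_itv.
apply/seteqP; split=> w /= h; first by move=> n; exact: h.
move=> z Kz; rewrite leNgt; apply/negP => lt.
have [n] : exists n, c < F w (q n).
  apply: (qd z [set z' | c < F w z'] Kz).
  have := cF w z; move/cvgrPdist_lt => /(_ (F w z - c)).
  rewrite subr_gt0 => /(_ lt); apply: filterS => z' /=.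
  by rewrite ltr_norml => /andP[_]; lra.
by rewrite ltNge h.
Qed.

Lemma inf_ge_measurable (F : Omega' -> U -> R) (K : set U) (c : R) :
  (forall z, measurable_fun setT (fun w => F w z)) -> (forall w, continuous (F w)) ->
  measurable [set w | forall z, K z -> c <= F w z].
Proof.
move=> mF cF.
have := @sup_le_measurable (fun w z => - F w z) K (- c) _ _.
rewrite (_ : [set w | forall z, K z -> - F w z <= - c] =
  [set w | forall z, K z -> c <= F w z]); last first.
  by apply/seteqP; split=> w h z /h; rewrite lerN2.
apply; first by move=> z; exact: measurable_funN (mF z).
by move=> w z; apply: cvgN; exact: cF.
Qed.

End Plane.

(** * Eventual properties and clamped test functions *)

Definition evt (Q : nat -> Prop) : Prop := exists N, forall n, (N <= n)%N -> Q n.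

Lemma evt_and (Q Q' : nat -> Prop) : evt Q -> evt Q' -> evt (fun n => Q n /\ Q' n).
Proof.
move=> [N h] [N' h']; exists (maxn N N') => n; rewrite geq_max => /andP[n1 n2].
by split; [exact: h | exact: h'].
Qed.

Lemma evt_imp (Q Q' : nat -> Prop) : (forall n, Q n -> Q' n) -> evt Q -> evt Q'.
Proof. by move=> QQ [N h]; exists N => n /h /QQ. Qed.

Lemma evt_ge N : evt (fun n => (N <= n)%N).
Proof. by exists N. Qed.

Definition clamp {R : realType} (t : R) : R := Num.max 0 (Num.min 1 t).

Lemma clamp01 (R : realType) (t : R) : 0 <= clamp t <= 1.
Proof. by rewrite /clamp le_max lexx ge_max ler01 ge_min lexx. Qed.

Lemma clamp_ge1 (R : realType) (t : R) : 1 <= t -> 1 <= clamp t.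
Proof. by move=> t1; rewrite /clamp le_max le_min lexx t1 orbT. Qed.

Lemma clamp_le0 (R : realType) (t : R) : t <= 0 -> clamp t <= 0.
Proof. by move=> t0; rewrite /clamp ge_max lexx ge_min t0 orbT. Qed.

Lemma clamp_lip (R : realType) (C : R) (g : R -> R) : 0 < C ->
  (forall s t, g s <= g t + C * `|s - t|) ->
  forall s t, clamp (g s) <= clamp (g t) + C * `|s - t|.
Proof.
move=> C0 h s t; have := h s t; have := mulr_ge0 (ltW C0) (normr_ge0 (s - t)).
move: (C * _) (g s) (g t) => e x y e0 xy; rewrite /clamp.
have m1 : Num.min 1 x <= 1 by rewrite ge_min lexx.
have m2 : Num.min 1 x <= x by rewrite ge_min lexx orbT.
have M0 z : 0 <= Num.max 0 z :> R by rewrite le_max lexx.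
have M1 z : z <= Num.max 0 z :> R by rewrite le_max lexx orbT.
rewrite ge_max; apply/andP; split; first by rewrite addr_ge0.
by have := M1 (Num.min 1 y); have [hy|hy] := leP 1 y; lra.
Qed.

(** * Tightness, growth of the medians and equicontinuity of the rescaled distances *)

Section Lattice.
Variables (R : realType) (d : nat) (beta : R) (dO dO' : measure_display).
Variables (Omega : measurableType dO) (Omega' : measurableType dO').
Variables (P : probability Omega R) (P' : probability Omega' R).
Variables (E : Omega -> vtx d -> vtx d -> bool) (a : nat -> R).
Variable D : Omega' -> 'rV[R]_d * 'rV[R]_d -> R.
Hypotheses (d0 : (0 < d)%N) (beta0 : 0 < beta) (hE : is_LRP P beta E).
Hypotheses (hmed : is_median_seq P E a).
Hypothesis mD : forall z, measurable_fun setT (fun w => D w z).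
Hypothesis cD : forall w, continuous (D w).
Hypothesis cv : cvg_in_law_lu P P' (Dn E a) D.
Implicit Types (i j : vtx d) (n m : nat).

Let U := ('rV[R]_d * 'rV[R]_d)%type.

Lemma DnE n w (z : U) :
  Dn E a n w z = (a n)^-1 * (nd (E w) (floor_scale n z.1) (floor_scale n z.2))%:R.
Proof. by rewrite /Dn gdistE //; exact: (lrp_conn hE). Qed.

Definition sc n i : 'rV[R]_d := \row_k ((i ord0 k)%:~R / n%:R).

Lemma floor_sc n i : (0 < n)%N -> floor_scale n (sc n i) = i.
Proof.
move=> n0; apply: vtxP => k; rewrite !mxE mulrC divfK ?intrKfloor //.
by rewrite pnatr_eq0 -lt0n.
Qed.

Lemma Dn_sc n w i j : (0 < n)%N -> Dn E a n w (sc n i, sc n j) = (a n)^-1 * (nd (E w) i j)%:R.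
Proof. by move=> n0; rewrite DnE !floor_sc. Qed.

Lemma rad_coord i r k : (rad i <= r)%N -> (`|i ord0 k| <= r)%N.
Proof. by move=> /linf_leP /(_ k); rewrite mxE subr0. Qed.

Lemma norm_int (x : int) : `|x%:~R| = `|x|%N%:R :> R.
Proof. by rewrite -intr_norm -abszE. Qed.

Lemma sc_le n i r k : (0 < n)%N -> (rad i <= r * n)%N -> `|sc n i ord0 k| <= r%:R.
Proof.
move=> n0 ir; rewrite mxE normrM normfV normr_nat norm_int ler_pdivrMr ?ltr0n //.
by rewrite -natrM ler_nat rad_coord.
Qed.

Lemma rad_const n : (rad (const_mx n%:Z : vtx d) <= n)%N.
Proof. by apply/linf_leP => k; rewrite !mxE subr0. Qed.

Lemma exists_measurable (C : vtx d -> vtx d -> Prop) (Q : vtx d -> vtx d -> nat -> Prop) :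
  measurable [set w | exists i j, C i j /\ Q i j (nd (E w) i j)].
Proof.
apply: measurable_ex => i; apply: measurable_ex => j.
have [c|nc] := pselect (C i j).
  rewrite (_ : [set _ | _] = [set w | Q i j (nd (E w) i j)]).
    exact: (nd_measurable hE).
  by apply/seteqP; split=> w /=; [case|].
by rewrite (_ : [set _ | _] = set0) //; apply/seteqP; split=> w //= -[].
Qed.

Lemma forall_measurable (C : vtx d -> vtx d -> Prop) (Q : vtx d -> vtx d -> nat -> Prop) :
  measurable [set w | forall i j, C i j -> Q i j (nd (E w) i j)].
Proof.
apply: measurable_all => i; apply: measurable_all => j; apply: measurable_cond.
exact: (nd_measurable hE).
Qed.

Lemma median_ge n : 2^-1 <= Pr P [set w | a n <= (nd (E w) 0 (const_mx n%:Z))%:R].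
Proof.
have [_ h] := hmed n.
have e : [set w | a n <= gdist (E w) (0 : vtx d) (const_mx n%:Z)] =
    [set w | a n <= (nd (E w) 0 (const_mx n%:Z))%:R].
  by apply/seteqP; split=> w /=; rewrite gdistE //; exact: (lrp_conn hE).
rewrite e PrE ?lee_fin // in h.
exact: (nd_measurable hE (fun k => a n <= k%:R)).
Qed.

Lemma a_gt0 n : (0 < n)%N -> 0 < a n.
Proof.
move=> n0; rewrite ltNge; apply/negP => an.
have [h _] := hmed n; move: h.
rewrite (_ : [set w | _] = set0); first by rewrite measure0 lee_fin invr_le0 lern0.
apply/seteqP; split=> // w /=; rewrite gdistE; last exact: (lrp_conn hE).
move=> le; have : (nd (E w) 0 (const_mx n%:Z))%:R <= 0 :> R by exact: le_trans an.
rewrite lern0 => /eqP /(nd_eq0 (lrp_conn hE w)) e.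
have := congr1 (fun v : vtx d => v ord0 (Ordinal d0)) e; rewrite !mxE.
by lia.
Qed.

(** The events [V T] decrease to the empty set, because a continuous function is bounded on a
    compact box. The step from [T] to [T + 1] leaves room for the ramp of the test function. *)
Lemma tight (rho : nat) (e : R) : 0 < e -> exists2 T : R, 0 < T & evt (fun n =>
  Pr P [set w | exists i j, ((rad i <= rho * n)%N /\ (rad j <= rho * n)%N) /\
     T * a n < (nd (E w) i j)%:R] <= e).
Proof.
move=> e0; have e20 : 0 < e / 2 by rewrite divr_gt0.
pose V (T : nat) : set Omega' := ~` [set w | forall z, Kbox rho%:R z -> D w z <= T%:R].
have mV T : measurable (V T) by apply: measurableC; exact: sup_le_measurable.
have [] := @Pr_vanish _ _ _ P' V _ mV _ _ e20.
- by move=> S T ST w; apply: contra_not => h z /h le; rewrite (le_trans le) // ler_nat.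
- rewrite -subset0 => w hw.
  have [] := @Kbox_uniform R d rho%:R (fun T z => D w z <= T%:R).
    move=> z _; exists [set z' | D w z' < D w z + 1].
      have := @cD w z; move/cvgrPdist_lt => /(_ 1 ltr01); apply: filterS => z' /=.
      by rewrite ltr_norml => /andP[]; lra.
    exists (Num.truncn (D w z + 1)).+1 => n Nn z' /= /ltW le; apply: le_trans le _.
    by apply: (le_trans (ltW (truncnS_gt _))); rewrite ler_nat.
  by move=> N hN; have := hw N Logic.I; apply => z Kz; exact: hN.
move=> T0 hT; pose T : R := T0%:R; exists (T + 1).
  by rewrite ltr_wpDl ?ler0n.
have [N hN] : evt (fun n => Pr P [set w | exists i j,
   [/\ (0 < n)%N, (rad i <= rho * n)%N & (rad j <= rho * n)%N] /\
     (T + 1) * a n < (nd (E w) i j)%:R] <= Pr P' (V T0) + e / 2).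
  apply: (law_upper cv (K := Kbox rho%:R) (@Kbox_compact R d rho%:R) _ _
    (phi := fun t => clamp (t - T)) _ ltr01) => //.
  - exists (0, 0) => k /=; by rewrite !mxE normr0 ler0n.
  - by move=> t; exact: clamp01.
  - apply: clamp_lip => // s t; rewrite mul1r; have := ler_norm (s - t); lra.
  - move=> n; exact: (exists_measurable _ (fun _ _ k => (T + 1) * a n < k%:R)).
  - move=> n w [i [j [[n0 ir jr] h]]]; exists (sc n i, sc n j).
      by move=> k; rewrite !sc_le.
    rewrite Dn_sc //; apply: clamp_ge1; rewrite lerBrDr addrC.
    by rewrite mulrC ler_pdivlMr ?a_gt0 // ltW.
  - move=> w /contrapT h z Kz; apply: clamp_le0; rewrite subr_le0; exact: h.
exists (maxn N 1) => n; rewrite geq_max => /andP[Nn n0].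
apply: (@le_trans _ _ (Pr P' (V T0) + e / 2)); last by have := hT T0 (leqnn _); lra.
apply: le_trans (hN n Nn); apply: le_Pr.
- exact: (exists_measurable _ (fun _ _ k => (T + 1) * a n < k%:R)).
- exact: (exists_measurable _ (fun _ _ k => (T + 1) * a n < k%:R)).
- by move=> w [i [j [[ir jr] h]]]; exists i, j.
Qed.

(** The distance from 0 to [n 1] is at least [a n] with probability at least [1 / 2], and by
    tightness it exceeds [C * a m] with probability at most [1 / 4]; so [C * a m < a n] is
    impossible. *)
Lemma growth (rho : nat) : exists2 C : R, 0 < C &
  evt (fun m => forall n, (n <= rho * m)%N -> a n <= C * a m).
Proof.
have e0 : 0 < 4^-1 :> R by rewrite invr_gt0.
have [C C0 [N hN]] := tight rho e0; exists C => //; exists N => m Nm n nm.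
rewrite leNgt; apply/negP => lt.
have : 2^-1 <= 4^-1 :> R.
  apply: le_trans (median_ge n) _; apply: le_trans (hN m Nm); apply: le_Pr.
  - exact: (nd_measurable hE (fun k => a n <= k%:R)).
  - exact: (exists_measurable _ (fun _ _ k => C * a m < k%:R)).
  - move=> w /= h; exists 0, (const_mx n%:Z); split; last exact: lt_le_trans h.
    by rewrite /rad linf_xx; split=> //; apply: leq_trans (rad_const n) nm.
lra.
Qed.

(** [Dn] vanishes identically on the diagonal, and exceeding a positive level passes to the limit.
    As [e] is arbitrary, the limit is almost surely at most [c] there. *)
Lemma diag_null (rho c e : R) : 0 < c -> 0 < e -> 0 <= rho ->
  Pr P' [set w | ~ forall z : U, Kbox rho z /\ z.1 = z.2 -> D w z <= c] <= e.
Proof.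
move=> c0 e0 rho0.
have mB := measurableC (sup_le_measurable (fun z => Kbox rho z /\ z.1 = z.2) c mD cD).
have [N hN] : evt (fun n => Pr P' [set w | ~ forall z : U, Kbox rho z /\ z.1 = z.2 ->
    D w z <= c] <= Pr P set0 + e).
  apply: (law_lower cv (K := [set z : U | Kbox rho z /\ z.1 = z.2])
    (@Kbox_compact R d rho) _ _ (phi := fun t => clamp (c^-1 * t)) (C := c^-1)) => //.
  - by move=> z [].
  - by exists (0, 0); split=> // k /=; rewrite !mxE normr0.
  - by move=> t; exact: clamp01.
  - by rewrite invr_gt0.
  - apply: clamp_lip; rewrite ?invr_gt0 // => s t; rewrite -mulrDr ler_pM2l ?invr_gt0 //.
    by have := ler_norm (s - t); lra.
  - move=> w; rewrite /= -existsNE => -[z]; rewrite not_implyE => -[Kz /negP].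
    rewrite -ltNge => lt; exists z => //; apply: clamp_ge1.
    by rewrite mulrC ler_pdivlMr // mul1r ltW.
  - move=> n w _ z [_ e12]; rewrite DnE e12 nd_xx !mulr0; apply: clamp_le0; exact: lexx.
by have := hN N (leqnn N); rewrite Pr0 add0r.
Qed.

(** A modulus of continuity for the lattice distances: off the null event [N0] the continuous
    function [D] is small near the whole diagonal of the compact box, so [V q] without [N0]
    decreases to the empty set. *)
Lemma small_scale (rho : nat) (kap e : R) : 0 < kap -> 0 < e ->
  exists q : nat, evt (fun n =>
    Pr P [set w | exists i j, [/\ (rad i <= rho * n)%N, (rad j <= rho * n)%N &
      (linf i j * q.+1 <= n)%N] /\ kap * a n < (nd (E w) i j)%:R] <= e).
Proof.
move=> k0 e0; have e20 : 0 < e / 4 by rewrite divr_gt0.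
pose S (q : nat) : set U := [set z | Kbox rho%:R z /\
  forall k, `|z.1 ord0 k - z.2 ord0 k| <= q.+1%:R^-1].
pose V q : set Omega' := ~` [set w | forall z, S q z -> D w z <= kap / 2].
pose N0 : set Omega' := [set w | ~ forall z : U, Kbox rho%:R z /\ z.1 = z.2 -> D w z <= kap / 4].
have mV q : measurable (V q) by apply: measurableC; exact: sup_le_measurable.
have mN0 : measurable N0.
  exact: measurableC (sup_le_measurable (fun z => Kbox rho%:R z /\ z.1 = z.2) (kap / 4) mD cD).
have k40 : 0 < kap / 4 by rewrite divr_gt0.
have pN0 : Pr P' N0 <= e / 4 by exact: diag_null.
have [] := @Pr_vanish _ _ _ P' (fun q => V q `\` N0) _ (fun q => measurableD (mV q) mN0) _ _ e20.
- move=> q q' qq w [Vw Nw]; split=> //; apply: contra_not Vw => h z [Kz zz].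
  apply: h; split=> // k; apply: le_trans (zz k) _.
  by rewrite lef_pV2 ?posrE // ler_nat ltnS.
- rewrite -subset0 => w hw.
  have dg z : Kbox rho%:R z -> z.1 = z.2 -> D w z <= kap / 4.
    have [_ /contrapT h] := hw 0%N Logic.I; move=> Kz e12; exact: h.
  have [] := @Kbox_uniform R d rho%:R (fun q z =>
      (forall k, `|z.1 ord0 k - z.2 ord0 k| <= q.+1%:R^-1) -> D w z <= kap / 2).
    move=> z Kz; have [e12|ne] := pselect (z.1 = z.2).
      exists [set z' | D w z' < kap / 2]; last by exists 0%N => n _ z' /= /ltW.
      have := @cD w z; move/cvgrPdist_lt => /(_ (kap / 4) k40); apply: filterS => z' /=.
      by rewrite ltr_norml => /andP[h1 h2]; have := dg z Kz e12; lra.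
    have [k nk] : exists k, z.1 ord0 k != z.2 ord0 k.
      apply: contrapT => h; apply: ne; apply/rowP => k; apply/eqP.
      by apply: contrapT => nk; apply: h; exists k; apply/negP.
    (* Near an off-diagonal point the two components stay apart by more than [1 / (q + 1)] once [q]
       is large, and the claim is void. *)
    pose eta := `|z.1 ord0 k - z.2 ord0 k| / 4.
    have eta0 : 0 < eta by rewrite divr_gt0 // normr_gt0 subr_eq0.
    exists [set z' | cdist_lt z z' eta]; first by apply/nbhs_cdist; exists eta.
    exists (Num.truncn eta^-1) => q qN z' hz' /(_ k) hk; exfalso.
    have [h1 h2] := hz' k.
    have h3 : q.+1%:R^-1 < eta.
      rewrite invf_plt ?posrE //; apply: lt_le_trans (truncnS_gt _) _.
      by rewrite ler_nat ltnS.
    have h4 : `|z'.1 ord0 k - z'.2 ord0 k| < eta by exact: le_lt_trans h3.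
    have : `|z.1 ord0 k - z.2 ord0 k| < 3 * eta.
      move: h1 h2 h4; rewrite !ltr_norml => /andP[a1 a2] /andP[a3 a4] /andP[a5 a6].
      by apply/andP; split; lra.
    have -> : `|z.1 ord0 k - z.2 ord0 k| = 4 * eta by rewrite /eta; field.
    lra.
  move=> N hN; have [Vw _] := hw N Logic.I; apply: Vw => z [Kz zz].
  exact: (hN N (leqnn N) z Kz zz).
move=> q /(_ q (leqnn q)) hq; exists q.
have pV : Pr P' (V q) <= e / 2.
  have := PrDI P' (mV q) mN0; have := le_Pr P' (measurableI _ _ (mV q) mN0) mN0 (@subIsetr _ _ _).
  lra.
have e220 : 0 < e / 2 by rewrite divr_gt0.
have [N hN] : evt (fun n => Pr P [set w | exists i j,
   [/\ (0 < n)%N, (rad i <= rho * n)%N, (rad j <= rho * n)%N & (linf i j * q.+1 <= n)%N] /\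
     kap * a n < (nd (E w) i j)%:R] <= Pr P' (V q) + e / 2).
  apply: (law_upper cv (K := S q) (@Kbox_compact R d rho%:R) _ _
    (phi := fun t => clamp (2 / kap * t - 1)) _ (C := 2 / kap)) => //.
  - by move=> z [].
  - by exists (0, 0); split=> k /=; rewrite ?mxE ?subrr normr0.
  - by move=> t; exact: clamp01.
  - by rewrite divr_gt0.
  - have ck : 0 < 2 / kap by rewrite divr_gt0.
    apply: clamp_lip => // s t; rewrite addrAC lerD2r -mulrDr ler_pM2l //.
    by have := ler_norm (s - t); lra.
  - move=> n; exact: (exists_measurable _ (fun _ _ k => kap * a n < k%:R)).
  - move=> n w [i [j [[n0 ir jr lij] h]]]; exists (sc n i, sc n j).
      split=> k /=; first by rewrite !sc_le.
      rewrite !mxE -mulrBl normrM normfV normr_nat normr_coord.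
      rewrite ler_pdivrMr ?ltr0n // mulrC ler_pdivlMr ?ltr0n // -natrM ler_nat.
      by apply: leq_trans lij; rewrite leq_pmul2r // linf_ge.
    rewrite Dn_sc //; apply: clamp_ge1; rewrite lerBrDr.
    have ge : kap <= (a n)^-1 * (nd (E w) i j)%:R.
      by rewrite mulrC ler_pdivlMr ?a_gt0 // ltW.
    by rewrite mulrAC ler_pdivlMr //; lra.
  - move=> w /contrapT h z Kz; apply: clamp_le0; rewrite subr_le0.
    by rewrite mulrAC ler_pdivrMr // mul1r; have := h z Kz; lra.
exists (maxn N 1) => n; rewrite geq_max => /andP[Nn n0].
apply: (@le_trans _ _ (Pr P' (V q) + e / 2)); last by lra.
apply: le_trans (hN n Nn); apply: le_Pr.
- exact: (exists_measurable _ (fun _ _ k => kap * a n < k%:R)).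
- exact: (exists_measurable _ (fun _ _ k => kap * a n < k%:R)).
- by move=> w [i [j [[ir jr lij] h]]]; exists i, j.
Qed.

End Lattice.

(** * Nondegeneracy of the limit and windows around a value *)

Section Lattice2.
Variables (R : realType) (d : nat) (beta : R) (dO dO' : measure_display).
Variables (Omega : measurableType dO) (Omega' : measurableType dO').
Variables (P : probability Omega R) (P' : probability Omega' R).
Variables (E : Omega -> vtx d -> vtx d -> bool) (a : nat -> R).
Variable D : Omega' -> 'rV[R]_d * 'rV[R]_d -> R.
Hypotheses (d0 : (0 < d)%N) (beta0 : 0 < beta) (hE : is_LRP P beta E).
Hypotheses (hmed : is_median_seq P E a).
Hypothesis mD : forall z, measurable_fun setT (fun w => D w z).
Hypothesis cD : forall w, continuous (D w).
Hypothesis cv : cvg_in_law_lu P P' (Dn E a) D.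
Implicit Types (i j v : vtx d) (n m : nat).

Let U := ('rV[R]_d * 'rV[R]_d)%type.

Lemma shift_law (A : nat -> Prop) i j p :
  Pr P [set w | A (nd (E w) (i + p) (j + p))] = Pr P [set w | A (nd (E w) i j)].
Proof.
rewrite -(@nd_sperm_law R d beta dO Omega P E (fun=> false) 1%g p A i j hE).
have e v : sperm (fun=> false) 1%g p v = v + p.
  by apply: vtxP => k; rewrite spermE mxE expr0 mul1r perm1.
by rewrite !e.
Qed.

Lemma sign_law (A : nat -> Prop) s pi v :
  Pr P [set w | A (nd (E w) 0 (sperm s pi 0 v))] = Pr P [set w | A (nd (E w) 0 v)].
Proof.
rewrite -(@nd_sperm_law R d beta dO Omega P E s pi 0 A 0 v hE).
suff -> : sperm s pi 0 0 = 0 :> vtx d by [].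
by apply: vtxP => k; rewrite spermE !mxE mulr0.
Qed.

Lemma nd_lt_measurable (t : R) i j : measurable [set w | t < (nd (E w) i j)%:R].
Proof. exact: (nd_measurable hE (fun k => t < k%:R)). Qed.

(** The walk passes through the partial sums of [vs]; by translation invariance each increment has
    the law of the distance from 0 to one of the [v]. *)
Lemma chain_bound (vs : seq (vtx d)) (t e : R) :
  (forall v, v \in vs -> Pr P [set w | t < (nd (E w) 0 v)%:R] <= e) ->
  Pr P [set w | (size vs)%:R * t < (nd (E w) 0 (\sum_(v <- vs) v))%:R] <= (size vs)%:R * e.
Proof.
elim: vs => [|v vs IH] h.
  rewrite big_nil !mul0r (_ : [set _ | _] = set0) ?Pr0 //.
  by apply/seteqP; split=> // w /=; rewrite nd_xx ltxx.
rewrite big_cons; set V := \sum_(v <- vs) v.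
apply: le_trans (@le_PrU _ _ _ P _ _ _ (nd_lt_measurable _ _ _)
  (nd_lt_measurable t 0 v) (nd_lt_measurable ((size vs)%:R * t) v (v + V)) _) _.
  move=> w /= lt; apply: contrapT => /not_orP[/negP h1 /negP h2].
  move: lt; apply/negP; rewrite -!leNgt in h1 h2 *.
  apply: (@le_trans _ _ ((nd (E w) 0 v)%:R + (nd (E w) v (v + V))%:R)).
    by rewrite -natrD ler_nat; apply: nd_triangle; exact: (lrp_conn hE).
  by rewrite -natr1 mulrDl mul1r addrC lerD.
rewrite -natr1 mulrDl mul1r addrC; apply: lerD; last by apply: h; rewrite mem_head.
have := shift_law (fun k => (size vs)%:R * t < k%:R) 0 V v; rewrite add0r [V + v]addrC => ->.
by apply: IH => u us; apply: h; rewrite inE us orbT.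
Qed.

Lemma coord_spread v k (t e : R) : Pr P [set w | t < (nd (E w) 0 v)%:R] <= e ->
  Pr P [set w | (2 * d)%:R * t < (nd (E w) 0 (const_mx (2 * `|v ord0 k|)%N%:Z))%:R] <=
    (2 * d)%:R * e.
Proof.
move=> h; pose sg := v ord0 k < 0.
(* For each [l], two images of [v] carry [|v_k|] in coordinate [l] and opposite values in all other
   coordinates. The sum of the [2 d] images is therefore [2 |v_k|] in every coordinate. *)
pose g b l := sperm (fun l' => if l' == l then sg else b) (tperm k l) 0 v.
pose vs := [seq g false l | l <- enum 'I_d] ++ [seq g true l | l <- enum 'I_d].
have sv : size vs = (2 * d)%N by rewrite /vs size_cat !size_map -enumT size_enum_ord mul2n addnn.
have := @chain_bound vs t e; rewrite sv.
have -> : \sum_(u <- vs) u = const_mx (2 * `|v ord0 k|)%N%:Z.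
  rewrite big_cat !big_map /= -big_split /= -enumT big_enum /=.
  apply: vtxP => l; rewrite summxE mxE (bigD1 l) //= big1 ?addr0.
    rewrite !mxE eqxx tpermR addr0 /sg; case: ltP => s; rewrite ?expr1 ?expr0; lia.
  move=> l' ll'; rewrite !mxE eq_sym (negbTE ll') expr0 expr1; lia.
apply => u; rewrite mem_cat => /orP[] /mapP[l _ ->]; rewrite /g;
  by rewrite (sign_law (fun k' => t < k'%:R)).
Qed.

(** If [D(y, z)] vanished almost surely, distances over a vector [v] of length of order [n] would be
    small compared with [a n]; by [coord_spread] so would the median [a m] for some [m] of order
    [n], against [growth]. *)
Lemma limit_nondeg (y z : 'rV[R]_d) : y != z -> 0 < Pr P' [set w | 0 < D w (y, z)].
Proof.
move=> yz; have mpos : measurable [set w | 0 < D w (y, z)].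
  have := @mD (y, z) measurableT _ (measurable_itv `]0, +oo[%R).
  by rewrite setTI (_ : _ @^-1` _ = [set w | 0 < D w (y, z)]) //;
    apply/seteqP; split=> w /=; rewrite in_itv /= andbT.
rewrite lt_neqAle Pr_ge0 andbT; apply/negP => /eqP p0.
have dR : 0 < d%:R :> R by rewrite ltr0n.
have [k vk] : exists k, y ord0 k != z ord0 k.
  apply: contrapT => h; move/eqP: yz; apply; apply/rowP => k; apply/eqP.
  by apply: contrapT => nk; apply: h; exists k; apply/negP.
pose del := `|z ord0 k - y ord0 k|.
have del0 : 0 < del by rewrite normr_gt0 subr_eq0 eq_sym.
pose rho := (Num.truncn del^-1).+1.
have hrho : 1 <= rho%:R * del.
  by rewrite -ler_pdivrMr // mul1r; apply/ltW/truncnS_gt.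
have [C C0 [N1 hC]] := growth d0 beta0 hE hmed mD cD cv rho.
(* Chosen so that [2 d * C * kap = 1 / 2]; together with [2 d * e = 1 / 4] this yields
   [a n <= a n / 2]. *)
pose kap := (4 * d%:R * C)^-1.
have kap0 : 0 < kap by rewrite invr_gt0 mulr_gt0 // mulr_gt0.
have kv0 : 0 < kap^-1 by rewrite invr_gt0.
pose e := (8 * d%:R)^-1 : R.
have e0 : 0 < e by rewrite invr_gt0 mulr_gt0.
have [N2 h2] : evt (fun n => Pr P [set w | (0 < n)%N /\
    kap * a n < (nd (E w) (floor_scale n y) (floor_scale n z))%:R] <=
    Pr P' [set w | 0 < D w (y, z)] + e).
  apply: (law_upper cv (K := [set (y, z)]) (Kc := [set (y, z)]) (@compact_set1 _ _) _ _
    (phi := fun t => clamp (kap^-1 * t)) _ (C := kap^-1)) => //.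
  - by exists (y, z).
  - by move=> t; exact: clamp01.
  - apply: clamp_lip => // s t; rewrite -mulrDr ler_pM2l //.
    by have := ler_norm (s - t); lra.
  - move=> n; case: n => [|n].
      by rewrite (_ : [set _ | _] = set0) //; apply/seteqP; split=> w // -[].
    rewrite (_ : [set _ | _] = [set w | kap * a n.+1 <
      (nd (E w) (floor_scale n.+1 y) (floor_scale n.+1 z))%:R]); last first.
      by apply/seteqP; split=> w //= -[].
    exact: nd_lt_measurable.
  - move=> n w [n0 h]; exists (y, z) => //; apply: clamp_ge1; rewrite (DnE a hE) /=.
    rewrite mulrC ler_pdivlMr // mul1r mulrC ler_pdivlMr ?(a_gt0 d0 beta0 hE hmed) //.
    exact: ltW.
  - move=> w /negP; rewrite -leNgt => le _ ->; apply: clamp_le0.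
    by rewrite mulr_ge0_le0 // ltW.
(* Large enough for the comparison of laws, for [n * del >= 2], which absorbs the rounding by the
   floors, and for [m >= N1]. *)
pose n := (maxn N2 (maxn (Num.truncn (2 / del)).+1 (rho * N1).+1)).
have n2 : (N2 <= n)%N by rewrite leq_maxl.
have n3 : ((Num.truncn (2 / del)).+1 <= n)%N by rewrite /n !leq_max leqnn !orbT.
have n4 : ((rho * N1).+1 <= n)%N by rewrite /n !leq_max leqnn !orbT.
have n0 : (0 < n)%N by apply: leq_trans n3.
have n0' : 0 < n%:R :> R by rewrite ltr0n.
pose v := floor_scale n z - floor_scale n y.
pose m := (2 * `|v ord0 k|)%N.
have vb : n%:R * del - 1 <= `|v ord0 k|%N%:R.
  rewrite -norm_int !mxE intrB.
  have /andP[f1 f2] := floor_itv (n%:R * z ord0 k).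
  have /andP[f3 f4] := floor_itv (n%:R * y ord0 k).
  move: f1 f2 f3 f4; rewrite !intrD; set F := (_ _)%:~R; set G := (_ _)%:~R => f1 f2 f3 f4.
  have -> : n%:R * del = `|n%:R * z ord0 k - n%:R * y ord0 k|.
    by rewrite -mulrBr normrM normr_nat.
  move: f1 f2 f3 f4; move: (n%:R * z ord0 k) (n%:R * y ord0 k) => A B f1 f2 f3 f4.
  have : `|(A - B) - (F - G)| <= 1 by rewrite ler_norml; apply/andP; split; lra.
  by have := lerB_dist (A - B) (F - G); lra.
have mn : n%:R * del <= m%:R.
  have : 2 <= n%:R * del.
    rewrite -ler_pdivrMr //; apply: le_trans (ltW (truncnS_gt _)) _.
    by rewrite ler_nat.
  by rewrite natrM; lra.
have nm : (n <= rho * m)%N.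
  rewrite -(ler_nat R) natrM.
  apply: (@le_trans _ _ (rho%:R * (n%:R * del))); last by rewrite ler_wpM2l ?ler0n.
  by rewrite mulrCA ler_peMr // ltW.
have N1m : (N1 <= m)%N.
  rewrite leqNgt; apply/negP => lt.
  have le : (rho * m <= rho * N1)%N by rewrite leq_mul2l (ltnW lt) orbT.
  by have := leq_ltn_trans (leq_trans nm le) n4; rewrite ltnn.
have hCn := hC m N1m n nm.
have an0 : 0 < a n by exact: (a_gt0 d0 beta0 hE hmed).
have h3 : Pr P [set w | kap * a n < (nd (E w) 0 v)%:R] <= e.
  have := shift_law (fun k => kap * a n < k%:R) 0 v (floor_scale n y).
  rewrite add0r /v subrK => <-.
  have := h2 n n2; rewrite -p0 add0r (_ : [set w | _ /\ _] = [set w | kap * a n <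
      (nd (E w) (floor_scale n y) (floor_scale n z))%:R]) //.
  by apply/seteqP; split=> w //= -[].
have h4 := coord_spread k h3; rewrite -/m in h4.
have am : a m <= (2 * d)%:R * (kap * a n).
  rewrite leNgt; apply/negP => lt.
  have : 2^-1 <= (2 * d)%:R * e.
    apply: le_trans (median_ge hE hmed m) _; apply: le_trans h4; apply: le_Pr.
    - exact: (nd_measurable hE (fun k => a m <= k%:R)).
    - exact: nd_lt_measurable.
    - by move=> w /= h; exact: lt_le_trans h.
  have -> : (2 * d)%:R * e = 4^-1 by rewrite /e natrM; field; rewrite gt_eqF.
  lra.
have : a n <= a n / 2.
  apply: le_trans hCn _; apply: le_trans (ler_wpM2l (ltW C0) am) _.
  rewrite le_eqVlt; apply/orP; left; apply/eqP; rewrite /kap natrM; field.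
  by rewrite !gt_eqF.
lra.
Qed.


(** Where [D(y, z) > 0], continuity gives a [q] such that [D >= 1 / (q + 1)] at all pairs within
    [1 / (q + 1)] of [(y, z)]. One [q] serves on half of the mass [p], and the passage to the
    lattice loses another quarter. *)
Lemma pair_far (y z : 'rV[R]_d) : y != z -> exists r c e : R, [/\ 0 < r, 0 < c, 0 < e &
  evt (fun n => e <= Pr P [set w | forall i j,
    (forall k, `|y ord0 k - sc R n i ord0 k| <= r /\ `|z ord0 k - sc R n j ord0 k| <= r) ->
    c * a n <= (nd (E w) i j)%:R])].
Proof.
move=> yz; set p := Pr P' [set w | 0 < D w (y, z)].
have p0 : 0 < p by exact: limit_nondeg.
have mpos : measurable [set w | 0 < D w (y, z)].
  have := @mD (y, z) measurableT _ (measurable_itv `]0, +oo[%R).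
  by rewrite setTI (_ : _ @^-1` _ = [set w | 0 < D w (y, z)]) //;
    apply/seteqP; split=> w /=; rewrite in_itv /= andbT.
pose S (q : nat) : set U := [set u : U | forall k,
  `|y ord0 k - u.1 ord0 k| <= q.+1%:R^-1 /\ `|z ord0 k - u.2 ord0 k| <= q.+1%:R^-1].
pose W q : set Omega' := [set w | forall u, S q u -> q.+1%:R^-1 <= D w u].
have mW q : measurable (W q) by exact: inf_ge_measurable.
have inv_le q q' : (q <= q')%N -> q'.+1%:R^-1 <= q.+1%:R^-1 :> R.
  by move=> qq; rewrite lef_pV2 ?posrE // ler_nat ltnS.
have p20 : 0 < p / 2 by rewrite divr_gt0.
have [] := @Pr_vanish _ _ _ P' (fun q => [set w | 0 < D w (y, z)] `\` W q) _
  (fun q => measurableD mpos (mW q)) _ _ p20.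
- move=> q q' qq w [pw nW]; split=> //; apply: contra_not nW => h u Su.
  apply: le_trans (inv_le _ _ qq) _; apply: h => k; have [h1 h2] := Su k.
  by split; [apply: le_trans h1 _|apply: le_trans h2 _]; exact: inv_le.
- rewrite -subset0 => w hw; have [pw _] := hw 0%N Logic.I; rewrite /= in pw.
  have : nbhs (y, z) [set u | D w (y, z) / 2 < D w u].
    have := @cD w (y, z); move/cvgrPdist_lt => /(_ (D w (y, z) / 2)).
    rewrite divr_gt0 // => /(_ isT); apply: filterS => u /=.
    by rewrite ltr_norml => /andP[_]; lra.
  move=> /nbhs_cdist[e e0 he].
  pose mn := Num.min e (D w (y, z) / 2).
  have mn0 : 0 < mn by rewrite lt_min e0 divr_gt0.
  pose q := Num.truncn mn^-1.
  have hq : q.+1%:R^-1 < mn by rewrite invf_plt ?posrE //; exact: truncnS_gt.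
  have [_ ] := hw q Logic.I; apply => u Su.
  have : D w (y, z) / 2 < D w u.
    apply: he => k; have [h1 h2] := Su k.
    have qe : q.+1%:R^-1 < e by apply: lt_le_trans hq _; rewrite ge_min lexx.
    by split; [exact: le_lt_trans h1 qe | exact: le_lt_trans h2 qe].
  have : q.+1%:R^-1 < D w (y, z) / 2 by apply: lt_le_trans hq _; rewrite ge_min lexx orbT.
  by move=> h1 h2; apply/ltW; exact: lt_trans h1 h2.
move=> q /(_ q (leqnn q)) hq; pose r : R := q.+1%:R^-1.
have r0 : 0 < r by rewrite invr_gt0.
have pW : p / 2 <= Pr P' (W q).
  have := PrDI P' mpos (mW q); rewrite -/p.
  have := le_Pr P' (measurableI _ _ mpos (mW q)) (mW q) (@subIsetr _ _ _); lra.
exists r, (r / 2), (p / 4); split; rewrite ?divr_gt0 //.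
have p40 : 0 < p / 4 by rewrite divr_gt0.
pose rho : R := \sum_k (`|y ord0 k| + `|z ord0 k|) + 1.
have rhoP k : `|y ord0 k| + 1 <= rho /\ `|z ord0 k| + 1 <= rho.
  rewrite /rho (bigD1 k) //=.
  have : 0 <= \sum_(l | l != k) (`|y ord0 l| + `|z ord0 l|).
    by apply: sumr_ge0 => l _; rewrite addr_ge0.
  have := normr_ge0 (y ord0 k); have := normr_ge0 (z ord0 k); lra.
have r1 : r <= 1 by rewrite invf_le1 // ler1n.
pose cl n i j := forall k,
  `|y ord0 k - sc R n i ord0 k| <= r /\ `|z ord0 k - sc R n j ord0 k| <= r.
have mA n : measurable [set w | exists i j, ((0 < n)%N /\ cl n i j) /\
    (nd (E w) i j)%:R < r / 2 * a n].
  exact: (exists_measurable hE _ (fun _ _ k => k%:R < r / 2 * a n)).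
have [N hN] : evt (fun n => Pr P [set w | exists i j, ((0 < n)%N /\ cl n i j) /\
    (nd (E w) i j)%:R < r / 2 * a n] <= Pr P' (~` W q) + p / 4).
  have ck : 0 < 2 / r by rewrite divr_gt0.
  apply: (law_upper cv (K := S q) (@Kbox_compact R d rho) _ _
    (phi := fun t => clamp (2 - 2 / r * t)) _ (C := 2 / r)) => //.
  - move=> u Su k; have [h1 h2] := Su k; have [h3 h4] := rhoP k; rewrite -/r in h1 h2.
    split.
      have := lerB_dist (u.1 ord0 k) (y ord0 k); rewrite distrC; lra.
    have := lerB_dist (u.2 ord0 k) (z ord0 k); rewrite distrC; lra.
  - by exists (y, z) => k /=; rewrite !subrr normr0; split; exact: ltW.
  - by move=> t; exact: clamp01.
  - apply: (@clamp_lip _ _ (fun t => 2 - 2 / r * t)) => // s t.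
    have h : t <= s + `|s - t| by have := ler_norm (t - s); rewrite (distrC t s); lra.
    by have := ler_wpM2l (ltW ck) h; rewrite mulrDr; lra.
  - exact/measurableC/mW.
  - move=> n w [i [j [[n0 c] h]]]; exists (sc R n i, sc R n j) => //.
    rewrite (Dn_sc _ hE) //; apply: clamp_ge1.
    have an0 : 0 < a n by exact: (a_gt0 d0 beta0 hE hmed).
    have : (a n)^-1 * (nd (E w) i j)%:R <= r / 2.
      by rewrite mulrC ler_pdivrMr // ltW.
    move=> /(ler_wpM2l (ltW ck)); rewrite [2 / r * (r / 2)](_ : _ = 1); last first.
      by field; rewrite gt_eqF.
    lra.
  - move=> w /contrapT h u Su; apply: clamp_le0.
    have := ler_wpM2l (ltW ck) (h u Su); rewrite -/r.
    by rewrite [2 / r * r]divfK ?gt_eqF //; lra.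
exists (maxn N 1) => n; rewrite geq_max => /andP[Nn n0].
have := hN n Nn; rewrite PrC // => h.
apply: (@le_trans _ _ (Pr P (~` [set w | exists i j, ((0 < n)%N /\ cl n i j) /\
    (nd (E w) i j)%:R < r / 2 * a n]))); first by rewrite PrC //; lra.
apply: le_Pr; first exact: measurableC.
  exact: (forall_measurable hE (cl n) (fun _ _ k => r / 2 * a n <= k%:R)).
move=> w /= nex i j c; rewrite leNgt; apply/negP => lt; apply: nex.
by exists i, j.
Qed.

Section Window.
Variables (a0 : R) (x : 'rV[R]_d).

Lemma floor_scale0 n : floor_scale n (0 : 'rV[R]_d) = 0.
Proof. by apply: vtxP => k; rewrite !mxE mulr0 floor0. Qed.

Let X n : vtx d := floor_scale n x.

Lemma Dx_measurable (A : set R) : measurable A -> measurable [set w | A (D w (0, x))].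
Proof. by move=> mA; have := @mD (0, x) measurableT A mA; rewrite setTI. Qed.

Lemma win_measurable n (eta : R) :
  measurable [set w | `|(nd (E w) 0 (X n))%:R - a0 * a n| < eta * a n].
Proof. exact: (nd_measurable hE (fun k => `|k%:R - a0 * a n| < eta * a n)). Qed.

Lemma Dn_win n w : (0 < n)%N ->
  `|Dn E a n w (0, x) - a0| * a n = `|(nd (E w) 0 (X n))%:R - a0 * a n|.
Proof.
move=> n0; have an0 : 0 < a n by exact: (a_gt0 d0 beta0 hE hmed).
rewrite (DnE _ hE) /= floor_scale0 -{2}(gtr0_norm an0) -normrM mulrBl.
by rewrite mulrAC mulVf ?gt_eqF // mul1r.
Qed.

(** Applied to the complements: the test function vanishes at [a0] and reaches 1 at distance
    [eta]. *)
Lemma window_lower (eta e : R) : 0 < eta -> 0 < e ->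
  evt (fun n => Pr P' [set w | D w (0, x) = a0] - e <=
    Pr P [set w | `|(nd (E w) 0 (X n))%:R - a0 * a n| < eta * a n]).
Proof.
move=> eta0 e0; have iv : 0 < eta^-1 by rewrite invr_gt0.
have mB : measurable [set w | D w (0, x) = a0].
  exact: (Dx_measurable (measurable_set1 a0)).
have [N hN] : evt (fun n => Pr P [set w | (0 < n)%N /\
    ~ `|(nd (E w) 0 (X n))%:R - a0 * a n| < eta * a n] <=
    Pr P' (~` [set w | D w (0, x) = a0]) + e).
  apply: (law_upper cv (K := [set (0, x)]) (Kc := [set (0, x)]) (@compact_set1 _ _) _ _
    (phi := fun t => clamp (eta^-1 * `|t - a0|)) _ (C := eta^-1)) => //.
  - by exists (0, x).
  - by move=> t; exact: clamp01.
  - apply: (@clamp_lip _ _ (fun t => eta^-1 * `|t - a0|)) => // s t.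
    rewrite -mulrDr ler_pM2l //.
    by have := ler_distD t s a0; lra.
  - move=> n; case: n => [|n].
      by rewrite (_ : [set _ | _] = set0) //; apply/seteqP; split=> w // -[].
    rewrite (_ : [set _ | _] = ~` [set w | `|(nd (E w) 0 (X n.+1))%:R - a0 * a n.+1| <
      eta * a n.+1]); first by apply: measurableC; exact: win_measurable.
    by apply/seteqP; split=> w //= -[].
  - exact: measurableC.
  - move=> n w [n0 /negP]; rewrite -leNgt -Dn_win // => h; exists (0, x) => //.
    apply: clamp_ge1; rewrite mulrC ler_pdivlMr // mul1r.
    by move: h; rewrite ler_pM2r // (a_gt0 d0 beta0 hE hmed).
  - move=> w /contrapT /= h _ ->; apply: clamp_le0.
    by rewrite h subrr normr0 mulr0.
exists (maxn N 1) => n; rewrite geq_max => /andP[Nn n0].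
have := hN n Nn; rewrite (_ : [set w | _ /\ _] =
  ~` [set w | `|(nd (E w) 0 (X n))%:R - a0 * a n| < eta * a n]); last first.
  by apply/seteqP; split=> w //= -[].
by rewrite !PrC //; [lra | exact: win_measurable].
Qed.

(** The test function falls from 1 at distance [3 del] from [a0] to 0 at distance [4 del]. *)
Lemma window_upper (del e : R) : 0 < del -> 0 < e ->
  evt (fun n => Pr P [set w | `|(nd (E w) 0 (X n))%:R - a0 * a n| < 3 * del * a n] <=
    Pr P' [set w | `|D w (0, x) - a0| <= 4 * del] + e).
Proof.
move=> del0 e0; have iv : 0 < del^-1 by rewrite invr_gt0.
have mB : measurable [set w | `|D w (0, x) - a0| <= 4 * del].
  rewrite (_ : [set _ | _] = [set w | `[a0 - 4 * del, a0 + 4 * del]%classic (D w (0, x))]).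
    exact: (Dx_measurable (measurable_itv _)).
  by apply/seteqP; split=> w /=; rewrite in_itv /= ler_distl.
have [N hN] : evt (fun n => Pr P [set w | (0 < n)%N /\
    `|(nd (E w) 0 (X n))%:R - a0 * a n| < 3 * del * a n] <=
    Pr P' [set w | `|D w (0, x) - a0| <= 4 * del] + e).
  apply: (law_upper cv (K := [set (0, x)]) (Kc := [set (0, x)]) (@compact_set1 _ _) _ _
    (phi := fun t => clamp (4 - del^-1 * `|t - a0|)) _ (C := del^-1)) => //.
  - by exists (0, x).
  - by move=> t; exact: clamp01.
  - apply: (@clamp_lip _ _ (fun t => 4 - del^-1 * `|t - a0|)) => // s t.
    have h : `|t - a0| <= `|s - a0| + `|s - t|.
      by have := ler_distD s t a0; rewrite (distrC t s); lra.
    by have := ler_wpM2l (ltW iv) h; rewrite mulrDr; lra.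
  - move=> n; case: n => [|n].
      by rewrite (_ : [set _ | _] = set0) //; apply/seteqP; split=> w // -[].
    rewrite (_ : [set _ | _] = [set w | `|(nd (E w) 0 (X n.+1))%:R - a0 * a n.+1| <
      3 * del * a n.+1]); first exact: win_measurable.
    by apply/seteqP; split=> w //= -[].
  - move=> n w [n0]; rewrite -Dn_win // => h; exists (0, x) => //.
    have an0 : 0 < a n by exact: (a_gt0 d0 beta0 hE hmed).
    move: h; rewrite ltr_pM2r // => /ltW /(ler_wpM2l (ltW iv)).
    rewrite [del^-1 * (3 * del)](_ : _ = 3); last by field; rewrite gt_eqF.
    by move=> h; apply: clamp_ge1; lra.
  - move=> w /= /negP; rewrite -ltNge => /ltW /(ler_wpM2l (ltW iv)) h _ ->.
    apply: clamp_le0; move: h.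
    rewrite [del^-1 * (4 * del)](_ : _ = 4); last by field; rewrite gt_eqF.
    lra.
exists (maxn N 1) => n; rewrite geq_max => /andP[Nn n0].
have := hN n Nn; rewrite (_ : [set w | _ /\ _] =
  [set w | `|(nd (E w) 0 (X n))%:R - a0 * a n| < 3 * del * a n]) //.
by apply/seteqP; split=> w //= -[].
Qed.

End Window.

End Lattice2.

(** * Deterministic comparison of distances *)

Section Deterministic.
Variables (R : realType) (d : nat).
Implicit Types (G : vtx d -> vtx d -> bool) (i j X y : vtx d) (n k : nat).

Definition annulus n : pred (vtx d) := fun v => (n < rad v <= 6 * n)%N.

Definition outer n : pred (vtx d) := fun v => (6 * n < rad v)%N.

(** Walks are confined to the annulus so that the event reads only edges inside it and is decreasing
    in the edges. *)
Definition slow G n (c : R) := forall i j k, (rad i <= 2 * n)%N -> (5 * n < rad j)%N ->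
  walk (restr (annulus n) G) k i j -> c <= k%:R.

Lemma rad0 : rad (0 : vtx d) = 0%N.
Proof. exact: linf_xx. Qed.

(** Cut at the first exit from the box of radius [6 n] and, before that, at the last exit from the
    box of radius [n]. The two conditions on jumps put the ends of the middle piece well inside the
    annulus. *)
Lemma crossing_split G n X k : walk G k 0 X -> (6 * n < rad X)%N ->
  (forall i j, G i j -> (rad i <= n)%N -> (rad j <= 2 * n)%N) ->
  (forall i j, G i j -> (rad i <= 5 * n)%N -> (rad j <= 6 * n)%N) ->
  exists k1 k2 k3 i j, [/\ walk G k1 0 i, (n < rad i <= 2 * n)%N,
    walk (restr (annulus n) G) k2 i j, (5 * n < rad j <= 6 * n)%N &
    walk G k3 j X /\ (k = k1 + k2 + k3)%N].
Proof.
move=> w0 farX jump1 jump5.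
have [||m1 [m2 [u [v [w1 Su uv nSv [w2 ->]]]]]] :=
  @walk_first_exit _ (fun v => rad v <= 6 * n)%N G k 0 X w0.
- by rewrite rad0.
- by rewrite -ltnNge.
rewrite -ltnNge in nSv.
have u5 : (5 * n < rad u)%N.
  by rewrite ltnNge; apply/negP => /(jump5 _ _ uv); rewrite leqNgt nSv.
have nS1 : ~~ (fun v => rad v <= n)%N u by rewrite -ltnNge; lia.
have [w3|[k1 [k2 [x [y [w3 Sx xy nSy [w4 ->]]]]]]] :=
  @walk_last_exit _ (fun v => rad v <= n)%N _ _ _ _ w1 nS1.
  case: m1 w1 w3 => [|m1] /=; first by move=> _ e; move: nS1; rewrite -e rad0.
  by move=> _ [z [/and3P[]]]; rewrite /= rad0.
rewrite -ltnNge in nSy.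
have xy' := restr_sub xy; have y2 := jump1 _ _ xy' Sx.
exists k1.+1, k2, m2.+1, y, u; split.
- rewrite -addn1; apply: (walk_cat (walk_sub (@restr_sub _ _ G) w3)).
  exact: walk1.
- by rewrite nSy.
- apply: walk_sub w4 => i j /and3P[/= i1 j1 /and3P[/= i6 j6 ij]].
  by rewrite /restr /annulus ij i6 j6 -!ltnNge in i1 j1 *; rewrite i1 j1.
- by rewrite u5.
- split; last by lia.
  by exists v.
Qed.

(** In a geodesic of [G], the middle piece, of length at least [c], is replaced by two detours of
    length at most [kap] and one edge of [G']. *)
Lemma shortcut G G' n (c kap : R) X : conn G -> conn G' ->
  (forall i j, G i j -> G' i j) -> (6 * n < rad X)%N ->
  (forall i j, G i j -> (rad i <= n)%N -> (rad j <= 2 * n)%N) ->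
  (forall i j, G i j -> (rad i <= 5 * n)%N -> (rad j <= 6 * n)%N) ->
  slow G n c ->
  (forall i j, (n < rad i <= 2 * n)%N -> (5 * n < rad j <= 6 * n)%N ->
     exists i' j', [/\ G' i' j', (nd G i i')%:R <= kap & (nd G j' j)%:R <= kap]) ->
  (nd G' 0 X)%:R + c <= (nd G 0 X)%:R + 2 * kap + 1.
Proof.
move=> Gc Gc' GG' farX j1 j5 sl sh.
have [k1 [k2 [k3 [i [j [w1 ib w2 jb [w3 e]]]]]]] := crossing_split (nd_walk 0 X Gc) farX j1 j5.
have [i' [j' [ij' di dj]]] := sh i j ib jb.
have ck : c <= k2%:R by apply: sl w2; case/andP: ib; case/andP: jb.
have t1 := nd_triangle 0 i X Gc'; have t2 := nd_triangle i i' X Gc'.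
have t3 := nd_triangle i' j' X Gc'; have t4 := nd_triangle j' j X Gc'.
have u1 := leq_trans (nd_mono 0 i Gc GG') (nd_le w1).
have u2 := nd_mono i i' Gc GG'; have u3 := nd_le (walk1 ij').
have u4 := nd_mono j' j Gc GG'.
have u5 := leq_trans (nd_mono j X Gc GG') (nd_le w3).
have h : (nd G' 0%R X <= k1 + (nd G i i' + (1 + (nd G j' j + k3))))%N.
  apply: leq_trans t1 (leq_add u1 _); apply: leq_trans t2 (leq_add u2 _).
  by apply: leq_trans t3 (leq_add u3 _); apply: leq_trans t4 (leq_add u4 _).
by move: h; rewrite e -(ler_nat R) !natrD; lra.
Qed.

(* The part of the event [|d(0, X) - c| < 2 del] that is visible outside the box of
   radius [6 n], when [lo] and [up] are [c - 2 del] and [c + 2 del]. *)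
Definition Hev G n tau X (lo up : R) :=
  (exists y k, [/\ (rad y <= tau * n)%N, walk (restr (outer n) G) k y X & k%:R < up]) /\
  (forall y k, (rad y <= tau * n)%N -> walk (restr (outer n) G) k y X -> lo < k%:R).

Section Localize.
Variables (G : vtx d -> vtx d -> bool) (n tau : nat) (X : vtx d) (c del : R).
Hypotheses (Gc : conn G) (farX : (6 * n < rad X)%N).
Hypothesis nojump : forall i j, G i j -> (rad i <= 6 * n)%N -> (rad j <= tau * n)%N.
Hypothesis diam : forall y, (rad y <= tau * n)%N -> (nd G 0 y)%:R <= del.

Lemma last_exit_outer : exists y k, [/\ (rad y <= tau * n)%N,
  walk (restr (outer n) G) k y X & (k <= nd G 0%R X)%N].
Proof.
have nS : ~~ (fun v => rad v <= 6 * n)%N X by rewrite -ltnNge.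
have sub k u v : walk (restr (predC (fun v : vtx d => rad v <= 6 * n)%N) G) k u v ->
    walk (restr (outer n) G) k u v.
  by apply: walk_sub => i j; rewrite /restr /outer /= -!ltnNge.
have [w|[m1 [m2 [u [v [w1 Su uv nSv [w2 ->]]]]]]] :=
  @walk_last_exit _ (fun v => rad v <= 6 * n)%N _ _ _ _ (nd_walk 0 X Gc) nS.
  case: (nd G 0 X) w => [|k] /=; first by move=> e; move: nS; rewrite -e rad0.
  by move=> [z [/and3P[]]]; rewrite /= rad0.
by exists v, m2; split; [exact: nojump uv Su | exact: sub | lia].
Qed.

Lemma nd_outer y k : (rad y <= tau * n)%N -> walk (restr (outer n) G) k y X ->
  (nd G 0 X)%:R <= del + k%:R.
Proof.
move=> yt w; apply: (@le_trans _ _ ((nd G 0 y)%:R + (nd G y X)%:R)).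
  by rewrite -natrD ler_nat; exact: nd_triangle.
apply: lerD; first exact: diam.
by rewrite ler_nat; apply: nd_le; apply: walk_sub w => i j; exact: restr_sub.
Qed.

(** A geodesic to [X] ends with an outer walk that starts in the box of radius [tau * n], and any
    such outer walk extends to 0 at a cost of at most [del]. Outer lengths and the distance to [X]
    thus agree up to [del]; this turns the window [eta] into [2 del], and in [Hev_win] back into
    [3 del]. *)
Lemma win_Hev eta : eta <= del -> `|(nd G 0 X)%:R - c| < eta ->
  Hev G n tau X (c - 2 * del) (c + 2 * del).
Proof.
move=> ed; rewrite ltr_norml => /andP[h1 h2]; split.
  have [y [k [yt w kf]]] := last_exit_outer; exists y, k; split=> //.
  by move: kf; rewrite -(ler_nat R); lra.
by move=> y k yt w; have := nd_outer yt w; lra.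
Qed.

Lemma Hev_win : 0 < del -> Hev G n tau X (c - 2 * del) (c + 2 * del) ->
  `|(nd G 0 X)%:R - c| < 3 * del.
Proof.
move=> del0 [[y [k [yt w kup]]] lo].
have [y' [k' [yt' w' kf]]] := last_exit_outer.
have := lo _ _ yt' w'; have := nd_outer yt w.
by move: kf; rewrite -(ler_nat R) ltr_norml => *; apply/andP; split; lra.
Qed.

End Localize.

End Deterministic.

(** * Slow annuli and shortcuts *)

Lemma off_dep_sub (d : nat) (s : seq (vtx d * vtx d)) (q pi : pred (vtx d * vtx d)) :
  (forall e, q e -> pi e) -> dep (map pi s) (fun t => off (map q s) t).
Proof.
move=> qp t u; rewrite size_map => st su h; rewrite !off_mem //; congr (~~ _).
by apply/hasP/hasP => -[e et qe]; exists e => //; move: et;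
  rewrite (mem_mask_dep st su h) // qp.
Qed.

Lemma cmask_map (T : Type) (s : seq T) (q : pred T) : cmask (map q s) = map (predC q) s.
Proof. by rewrite /cmask -map_comp. Qed.

Lemma off_down (d : nat) (s : seq (vtx d * vtx d)) (q : pred (vtx d * vtx d)) :
  bdown (size s) (fun t => off (map q s) t).
Proof.
move=> t u st su tu; rewrite !off_mem // => /hasPn h; apply/hasPn => e et.
by apply: h; exact: mem_mask_leb et.
Qed.

Lemma min_pos (R : realType) (T : eqType) (r : seq T) (c : T -> R) :
  (forall x, 0 < c x) -> exists2 c0, 0 < c0 & forall x, x \in r -> c0 <= c x.
Proof.
move=> cp; elim: r => [|x r [c0 c00 h]]; first by exists 1.
exists (Num.min c0 (c x)); first by rewrite lt_min c00 cp.
move=> y; rewrite inE => /orP[/eqP ->|/h le]; first by rewrite ge_min lexx orbT.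
by rewrite ge_min le.
Qed.

Lemma evt_seq (T : eqType) (r : seq T) (Q : T -> nat -> Prop) : (forall x, evt (Q x)) ->
  evt (fun n => forall x, x \in r -> Q x n).
Proof.
move=> h; elim: r => [|x r IH]; first by exists 0%N.
apply: evt_imp (evt_and (h x) IH) => n [h1 h2] y.
by rewrite inE => /orP[/eqP ->//|]; exact: h2.
Qed.

Lemma finite_subcover (T : topologicalType) (K : set T) (ngh : T -> set T) :
  compact K -> (forall u, nbhs u (ngh u)) ->
  exists l : seq T, forall u, K u -> exists2 v, v \in l & ngh v u.
Proof.
move=> /compact_near_coveringP cK hn.
(* The filter of lists that eventually contain any given list turns the near-covering form of
   compactness into a finite subcover. *)
pose F : set_system (seq T) := [set A | exists l0 : seq T, forall l : seq T,
  {subset l0 <= l} -> A l].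
have FF : Filter F.
  split; first by exists [::].
  - move=> A B [l1 h1] [l2 h2]; exists (l1 ++ l2) => l hl; split.
      by apply: h1 => x xl; apply: hl; rewrite mem_cat xl.
    by apply: h2 => x xl; apply: hl; rewrite mem_cat xl orbT.
  - by move=> A B AB [l h]; exists l => l' /h /AB.
have [] := cK (seq T) F (fun l u => exists2 v, v \in l & ngh v u) FF.
  move=> u _; exists (ngh u, [set l : seq T | u \in l]) => /=.
    by split=> //; exists [:: u] => l; apply; rewrite mem_head.
  by move=> [u' l] /= [nu ul]; exists u.
by move=> l hl; exists l => u; exact: hl.
Qed.

Section Slow.
Variables (R : realType) (d : nat) (beta : R) (dO dO' : measure_display).
Variables (Omega : measurableType dO) (Omega' : measurableType dO').
Variables (P : probability Omega R) (P' : probability Omega' R).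
Variables (E : Omega -> vtx d -> vtx d -> bool) (a : nat -> R).
Variable D : Omega' -> 'rV[R]_d * 'rV[R]_d -> R.
Hypotheses (d0 : (0 < d)%N) (beta0 : 0 < beta) (hE : is_LRP P beta E).
Hypotheses (hmed : is_median_seq P E a).
Hypothesis mD : forall z, measurable_fun setT (fun w => D w z).
Hypothesis cD : forall w, continuous (D w).
Hypothesis cv : cvg_in_law_lu P P' (Dn E a) D.

Let U := ('rV[R]_d * 'rV[R]_d)%type.

Let close n (r : R) (u : U) (i j : vtx d) := forall k,
  `|u.1 ord0 k - sc R n i ord0 k| <= r /\ `|u.2 ord0 k - sc R n j ord0 k| <= r.

Let far n (i j : vtx d) := exists k, 2 < `|sc R n i ord0 k - sc R n j ord0 k|.

(** When the two components of [u] agree, points within distance 1 of them are never [far] and the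
    condition is void; otherwise [pair_far] applies. *)
Let local_far (u : U) : exists rce : R * R * R, [/\ 0 < rce.1.1, 0 < rce.1.2, 0 < rce.2 &
  evt (fun n => rce.2 <= Pr P [set w | forall i j, close n rce.1.1 u i j /\ far n i j ->
    rce.1.2 * a n <= (nd (E w) i j)%:R])].
Proof.
have [e12|ne] := eqVneq u.1 u.2.
  exists (1, 1, 1); split=> //=; exists 0%N => n _.
  rewrite (_ : [set _ | _] = setT) ?PrT //; apply/seteqP; split=> // w _ i j [cl [k fk]].
  exfalso; have [h1 h2] := cl k; move: h1 h2 fk; rewrite e12.
  move: (u.2 ord0 k) (sc R n i ord0 k) (sc R n j ord0 k) => x y z.
  have := ler_distD x y z; rewrite (distrC y x); lra.
have [r [c [e [r0 c0 e0 h]]]] := pair_far d0 beta0 hE hmed mD cD cv ne.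
exists (r, c, e); split=> //=; apply: evt_imp h => n h; apply: le_trans h _; apply: le_Pr.
- exact: (forall_measurable hE (close n r u) (fun _ _ k => c * a n <= k%:R)).
- exact: (forall_measurable hE (fun i j => close n r u i j /\ far n i j)
    (fun _ _ k => c * a n <= k%:R)).
- by move=> w h' i j [cl _]; exact: h'.
Qed.

(** The bound is uniform in [L], since truncating and confining walks to the annulus only make them
    longer. The constants come from a finite cover of the rescaled pairs, hence do not depend on
    [n]. *)
Lemma slow_pos : exists c w : R, [/\ 0 < c, 0 < w & evt (fun n => forall L,
  w <= Pb (map (pe beta) (edges d L)) (fun t => slow (Gof (edges d L) t) n (c * a n)))].
Proof.
pose rce u := projT1 (cid (local_far u)).
have rceP u := projT2 (cid (local_far u)).
pose ngh (u : U) : set U := [set u' | cdist_lt u u' (rce u).1.1].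
have [u|l cov] := finite_subcover (ngh := ngh) (@Kbox_compact R d 6).
  by apply/nbhs_cdist; exists (rce u).1.1 => //; have [] := rceP u.
have [c c0 hc] := @min_pos R _ l (fun u => (rce u).1.2) (fun u => let: And4 _ h _ _ := rceP u in h).
have e0 u : 0 < (rce u).2 by have [] := rceP u.
exists c, (\prod_(u <- l) (rce u).2); split=> //.
  by apply: prodr_gt0 => u _; exact: e0.
have ev : evt (fun n => forall u, u \in l -> (rce u).2 <= Pr P [set w | forall i j,
    close n (rce u).1.1 u i j /\ far n i j -> (rce u).1.2 * a n <= (nd (E w) i j)%:R]).
  by apply: evt_seq => u; have [] := rceP u.
apply: evt_imp (evt_and ev (evt_ge 1)) => n [hn n0] L.
set s := edges d L; have vs := edges_valid d L.
have pps := @probs_pe R d beta beta0 _ vs.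
have an0 : 0 < a n by exact: (a_gt0 d0 beta0 hE hmed).
pose A u t := forall i j k, close n (rce u).1.1 u i j /\ far n i j ->
  walk (restr (annulus n) (Gof s t)) k i j -> (rce u).1.2 * a n <= k%:R.
have szp : size (map (pe beta) s) = size s by rewrite size_map.
have dA u : bdown (size (map (pe beta) s)) (A u).
  rewrite szp => t t' st st' tt' h i j k c1 w; apply: (h i j k c1).
  apply: walk_sub w => x y /and3P[h1 h2 h3]; apply/and3P; split=> //.
  exact: Gof_mono tt' h3.
have lA u : u \in l -> (rce u).2 <= Pb (map (pe beta) s) (A u).
  move=> ul; rewrite -(cfg_law hE _ vs); apply: le_trans (hn u ul) _; apply: le_Pr.
  - exact: (forall_measurable hE (fun i j => close n (rce u).1.1 u i j /\ far n i j)
      (fun _ _ k => (rce u).1.2 * a n <= k%:R)).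
  - exact: (cfg_measurable hE).
  - move=> w h i j k cf wk; apply: le_trans (h i j cf) _; rewrite ler_nat.
    by apply: nd_le; apply: walk_sub wk => x y h'; exact: (Gof_cfg_sub hE (restr_sub h')).
have inl u : List.In u l -> u \in l.
  by elim: (l) => //= x r IH [->|/IH h]; rewrite inE ?eqxx // h orbT.
apply: le_trans (@harris_down_seq _ U _ l A (fun u => (rce u).2) pps
  (fun u => ltW (e0 u)) dA (fun u ul => lA u (inl u ul))) _.
apply: Pb_sub => // t _ h i j k i2 j5 wk.
have j6 : (rad j <= 6 * n)%N.
  case: k wk => [/= e|k wk]; first by move: j5 i2; rewrite -e; lia.
  elim: k i {i2} wk => [|k IH] x /= [z [/and3P[_ az _]]].
    by move=> <-; case/andP: az.
  by move=> wz; exact: IH wz.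
have n0' : 0 < n%:R :> R by rewrite ltr0n.
have Ku : Kbox 6 (sc R n i, sc R n j).
  by move=> q; split; apply: (@sc_le R d _ _ 6) => //; lia.
have [u ul hu] := cov _ Ku.
have [q qE] : exists q, (5 * n < `|j ord0 q|)%N.
  have [|q e] := @linf_attained d j 0; first by rewrite -/(rad j); lia.
  by exists q; move: j5; rewrite /rad e mxE subr0.
apply: (@le_trans _ _ ((rce u).1.2 * a n)); first by rewrite ler_pM2r // hc.
apply: (h u _ i j k) => //.
  by move: ul; elim: (l) => //= x r IH; rewrite inE => /orP[/eqP ->|/IH]; [left|right].
split; first by move=> k'; have [h1 h2] := hu k'; split; exact: ltW.
exists q; rewrite !mxE -mulrBl normrM normfV normr_nat ltr_pdivlMr //.
rewrite normr_coord -natrM ltr_nat.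
by have := rad_coord q i2; lia.
Qed.

End Slow.

(** * Shortcuts by links between pairs of small cubes *)

Section Cubes.
Variables (R : realType) (d : nat).
Implicit Types (i j b : vtx d) (l n q L : nat).

Definition cube l b : seq (vtx d) :=
  [seq \row_k (b ord0 k * l%:Z + (m k : nat)%:Z) | m : {ffun 'I_d -> 'I_l}].

Lemma mem_cube l b i : reflect
  (forall k, b ord0 k * l%:Z <= i ord0 k < b ord0 k * l%:Z + l%:Z) (i \in cube l b).
Proof.
apply: (iffP mapP) => [[m _ ->] k|h].
  by rewrite !mxE; case: (m k) => x lx /=; lia.
have bd k : (`|(i ord0 k - b ord0 k * l%:Z)%R| < l)%N.
  by have := h k; move: (b ord0 k * l%:Z) => y; lia.
exists [ffun k => Ordinal (bd k)]; first by rewrite mem_enum.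
by apply: vtxP => k; rewrite !mxE ffunE /=; have := h k; move: (b ord0 k * l%:Z) => y; lia.
Qed.

Lemma cube_uniq l b : uniq (cube l b).
Proof.
rewrite map_inj_uniq ?enum_uniq // => m m' h; apply/ffunP => k; apply: val_inj.
have := congr1 (fun v : vtx d => v ord0 k) h; rewrite !mxE.
by case: (m k) => x ?; case: (m' k) => y ? /=; lia.
Qed.

Lemma size_cube l b : size (cube l b) = (l ^ d)%N.
Proof. by rewrite size_map -cardT card_ffun !card_ord. Qed.

Definition cell l i : vtx d := \row_k (i ord0 k %/ l%:Z)%Z.

Lemma mem_cell l i : (0 < l)%N -> i \in cube l (cell l i).
Proof.
move=> l0; apply/mem_cube => k; rewrite mxE.
have l0' : l%:Z != 0 by lia.
have := divz_eq (i ord0 k) l%:Z.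
have := modz_ge0 (i ord0 k) l0'; have := ltz_pmod (i ord0 k) (d := l%:Z) _.
rewrite ltz_nat => /(_ l0).
by move: (i ord0 k %/ l%:Z)%Z (modz _ _) => x y; move: (x * l%:Z) => z; lia.
Qed.

Lemma cube_linf l b i j : i \in cube l b -> j \in cube l b -> (linf i j <= l.-1)%N.
Proof.
move=> /mem_cube hi /mem_cube hj; apply/linf_leP => k.
by have := hi k; have := hj k; move: (b ord0 k * l%:Z) => x; lia.
Qed.

(** Two opposite needs: points of a cube are within [n / (q + 1)] of each other ([side_le]), and the
    number of cubes needed stays bounded as [n] grows ([side_gt]). *)
Definition side n q : nat := (n %/ q.+1).+1.

Lemma side_le n q : ((side n q).-1 * q.+1 <= n)%N.
Proof. exact: leq_trunc_div. Qed.

Lemma side_gt n q : (n < side n q * q.+1)%N.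
Proof. by rewrite /side {1}(divn_eq n q.+1) mulSn addnC ltn_add2r ltn_pmod. Qed.

Lemma rad_cell n q i : (rad i <= 6 * n)%N -> (rad (cell (side n q) i) <= 6 * q.+1)%N.
Proof.
move=> ir; apply/linf_leP => k; rewrite [X in _ - X]mxE subr0.
have hk := rad_coord k ir.
have /mem_cube /(_ k) := @mem_cell (side n q) i isT.
have := side_gt n q; move: (side n q) (cell _ i ord0 k) => l b ln hb.
rewrite -ltnS ltnNge; apply/negP => hb'.
by nia.
Qed.

Lemma rad_linf i j : (rad i <= rad j + linf j i)%N.
Proof. by rewrite addnC linf_sym; exact: linf_triangle. Qed.

(** The pairs of cubes in which the middle piece of a crossing may start and end. *)
Definition good n q (x : vtx d * vtx d) : bool :=
  has (fun i => rad i <= 2 * n)%N (cube (side n q) x.1) &&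
  has (fun j => 5 * n < rad j <= 6 * n)%N (cube (side n q) x.2).

Definition cells q : seq (vtx d * vtx d) :=
  [seq (b, b') | b <- box d (6 * q.+1), b' <- box d (6 * q.+1)].

Definition linked n q L t : Prop := forall x, List.In x (cells q) -> good n q x ->
  ~ off (map (between (cube (side n q) x.1) (cube (side n q) x.2)) (edges d L)) t.

Lemma side_pred n q : ((side n q).-1 <= n)%N.
Proof. by apply: leq_trans (side_le n q); rewrite leq_pmulr. Qed.

Lemma good_inner n q x i : good n q x -> i \in cube (side n q) x.1 -> (rad i <= 3 * n)%N.
Proof.
move=> /andP[/hasP[j jc jr] _] ic; have := cube_linf jc ic.
by have := rad_linf i j; have := side_pred n q; lia.
Qed.

Lemma good_outer n q x j : good n q x -> j \in cube (side n q) x.2 ->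
  (4 * n < rad j <= 7 * n)%N.
Proof.
move=> /andP[_ /hasP[i ic ir]] jc; have := cube_linf ic jc.
have := rad_linf i j; have := rad_linf j i; have := side_pred n q.
by rewrite (linf_sym j i); lia.
Qed.

(** Cubes have diameter at most [n]: one that meets the box of radius [2 n] stays in radius [3 n],
    and one that meets the region beyond [5 n] stays beyond [4 n]. So only edges of
    [cross (3 * n) (4 * n)] are read. *)
Lemma linked_dep n q L : dep (map (cross (3 * n) (4 * n)) (edges d L)) (linked n q L).
Proof.
move=> t u st su h; apply/propext.
suff H t' u' : size t' = size (map (cross (3 * n) (4 * n)) (edges d L)) ->
    size u' = size (map (cross (3 * n) (4 * n)) (edges d L)) ->
    mask (map (cross (3 * n) (4 * n)) (edges d L)) t' =
    mask (map (cross (3 * n) (4 * n)) (edges d L)) u' ->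
    linked n q L t' -> linked n q L u'.
  by split; exact: H.
move=> {st su h} st su h lk x xc gx.
rewrite -(@off_dep_sub d (edges d L) _ (cross (3 * n) (4 * n)) _ t' u') //.
  exact: lk.
move=> e /orP[] /andP[h1 h2]; have r1 := good_inner gx h1; have /andP[r2 _] := good_outer gx h2.
  by rewrite /cross r1 r2.
by rewrite /cross r1 r2 orbT.
Qed.

Lemma linked_short n q L t i j : size t = size (edges d L) -> linked n q L t ->
  (rad i <= 2 * n)%N -> (5 * n < rad j <= 6 * n)%N ->
  exists i' j', [/\ Gof (edges d L) t i' j', (rad i' <= 3 * n)%N /\ (rad j' <= 7 * n)%N,
    (linf i i' * q.+1 <= n)%N & (linf j' j * q.+1 <= n)%N].
Proof.
move=> st lk ir jr; pose l := side n q.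
have ic : i \in cube l (cell l i) by exact: mem_cell.
have jc : j \in cube l (cell l j) by exact: mem_cell.
have gx : good n q (cell l i, cell l j).
  by apply/andP; split; apply/hasP; [exists i|exists j].
have xc : List.In (cell l i, cell l j) (cells q).
  have : (cell l i, cell l j) \in cells q.
    have i6 : (rad i <= 6 * n)%N by lia.
    have j6 : (rad j <= 6 * n)%N by case/andP: jr.
    by apply: allpairs_f; rewrite mem_box; exact: rad_cell.
  by elim: (cells q) => //= x r IH; rewrite inE => /orP[/eqP ->|/IH]; [left|right].
have := lk _ xc gx; rewrite off_mem // => /negP; rewrite negbK => /hasP[e et be].
have ln x b y : x \in cube l b -> y \in cube l b -> (linf x y * q.+1 <= n)%N.
  move=> hx hy; apply: leq_trans (side_le n q); rewrite leq_mul2r orbC.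
  by rewrite (cube_linf hx hy).
case/orP: be => /andP[/= h1 h2]; have r1 := good_inner gx h1; have r2 := good_outer gx h2.
  exists e.1, e.2; split; [|by split=> //; case/andP: r2|exact: ln ic h1|exact: ln h2 jc].
  by rewrite /Gof -surjective_pairing et orbT.
exists e.2, e.1; split; [|by split=> //; case/andP: r2|exact: ln ic h1|exact: ln h2 jc].
by rewrite /Gof -surjective_pairing et !orbT.
Qed.

Variable beta : R.
Hypotheses (d0 : (0 < d)%N) (beta0 : 0 < beta).

Lemma linked_pos q : exists2 p : R, 0 < p & forall n L, (0 < n)%N -> (7 * n <= L)%N ->
  p <= Pb (map (pe beta) (edges d L)) (linked n q L).
Proof.
have d0' : 0 < d%:R :> R by rewrite ltr0n.
(* Linked points are at distance at most [10 n], and [10 n + 1 <= 11 * side * (q + 1)]; the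
   [side ^ (2 d)] pairs of points cancel the power of [side] in the kernel bound, leaving a constant
   free of [n]. *)
pose c : R := beta * (121 * d%:R * q.+1%:R ^+ 2) ^- d.
have c0 : 0 < c.
  by rewrite /c mulr_gt0 // invr_gt0 exprn_gt0 // !mulr_gt0 // exprn_gt0.
pose p := 1 - expR (- c).
have p0 : 0 < p by rewrite subr_gt0 -expR0 ltr_expR oppr_lt0.
exists (p ^+ size (cells q)); first exact: exprn_gt0.
move=> n L n0 nL; have pps := @probs_pe R d beta beta0 _ (edges_valid d L).
apply: le_trans (@harris_up_seq R _ _ (cells q) (fun x t => good n q x ->
  ~ off (map (between (cube (side n q) x.1) (cube (side n q) x.2)) (edges d L)) t)
  p pps (ltW p0) _ _) _; last 1 first.
- by apply: Pb_sub => // t _ h x xc; exact: h.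
- move=> x t u; rewrite size_map => st su tu h gx o; apply: (h gx).
  exact: off_down tu o.
move=> x _; case: (boolP (good n q x)) => gx; last first.
  apply: (@le_trans _ _ 1); first by rewrite gerBl expR_ge0.
  rewrite -(Eb_cst (map (pe beta) (edges d L)) 1); apply: le_Eb => // t _.
  by rewrite asboolT // => g; rewrite g in gx.
have bnd i j : i \in cube (side n q) x.1 -> j \in cube (side n q) x.2 ->
    (1 < linf i j <= 10 * n)%N.
  move=> ic jc; have r1 := good_inner gx ic; have r2 := good_outer gx jc.
  have := rad_linf j i; have := linf_triangle i 0 j.
  by rewrite -/(rad i) (linf_sym 0 j) -/(rad j); lia.
have inL : {subset cube (side n q) x.1 <= box d L}.
  by move=> i ic; rewrite mem_box; have := good_inner gx ic; lia.
have outL : {subset cube (side n q) x.2 <= box d L}.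
  by move=> j jc; rewrite mem_box; have := good_outer gx jc; lia.
have bo := between_on d0 beta0 (cube_uniq _ _) (cube_uniq _ _) inL outL bnd.
apply: (le_trans _ (le_trans bo _)); last by apply: Pb_sub => // t _ h _.
rewrite !size_cube /p lerD2l lerN2 ler_expR lerN2 /c -[X in _ <= X]mulrA ler_pM2l //.
set l := side n q; have l0 : 0 < l%:R :> R by rewrite ltr0n.
have h1 : (10 * n)%:R + 1 <= 11 * (l%:R * q.+1%:R) :> R.
  by rewrite natr1 -!natrM ler_nat; have := side_gt n q; rewrite -/l; lia.
have -> : (l ^ d * l ^ d)%:R = (l ^ 2)%:R ^+ d :> R.
  by rewrite natrM !natrX -expr2 -!exprM mulnC.
rewrite -ler_pdivrMr ?exprn_gt0 ?ltr0n ?expn_gt0 //.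
rewrite -invfM -exprMn lef_pV2 ?posrE ?exprn_gt0 //; last 2 first.
- by rewrite !mulr_gt0 // ?exprn_gt0 // ltr0n expn_gt0.
- by rewrite mulr_gt0 // exprn_gt0 // ltr_wpDl ?ler0n.
apply: lerXn2r; rewrite ?nnegrE ?mulr_ge0 ?exprn_ge0 ?ler0n ?addr_ge0 //.
apply: (@le_trans _ _ (d%:R * (11 * (l%:R * q.+1%:R)) ^+ 2)).
  rewrite ler_pM2l //; apply: lerXn2r => //; rewrite nnegrE ?addr_ge0 ?mulr_ge0 ?ler0n //.
by rewrite le_eqVlt; apply/orP; left; apply/eqP; rewrite natrX; ring.
Qed.

End Cubes.

(** * Resampling one scale *)

(** Since [kp >= 1], the edge of length 1 is absorbed in a third [kp], and [x <= y - 2 * eta]: a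
    window of half-width [eta] cannot hold both. *)
Lemma leave_window (R : realType) (x y cs kp eta cc : R) :
  x + cs <= y + 2 * kp + 1 -> 2 * eta <= cs - 3 * kp -> 1 <= kp ->
  `|y - cc| < eta -> ~ `|x - cc| < eta.
Proof. by rewrite !ltr_norml => h1 h2 h3 /andP[x1 x2] /andP[x3 x4]; lra. Qed.

Section Resample.
Variables (R : realType) (d : nat) (beta : R) (n q tau L : nat) (X : vtx d).
Variables (cs kp cc eta del : R).
Hypotheses (beta0 : 0 < beta) (n0 : (0 < n)%N) (tau6 : (6 < tau)%N).
Hypotheses (farX : (6 * n < rad X)%N) (del0 : 0 < del) (etad : eta <= del).
Hypotheses (kp1 : 1 <= kp) (eff : 2 * eta <= cs - 3 * kp).

Let s := edges d L.
Let ps := map (pe beta) s.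
Let G t := Gof s t.
Let m := map (cross (3 * n) (4 * n)) s.

Definition win (e : R) t := `|(nd (G t) 0 X)%:R - cc| < e.
(** The radius [7 n] accommodates the endpoints of the links, which may lie slightly outside the
    annulus. *)
Definition tame t := forall i j, (rad i <= 7 * n)%N -> (rad j <= 7 * n)%N ->
  (linf i j * q.+1 <= n)%N -> (nd (G t) i j)%:R <= kp.
Definition jumping t := ~ off (map (cross (6 * n) (tau * n)) s) t.
Definition spread t := exists2 y, (rad y <= tau * n)%N & del < (nd (G t) 0 y)%:R.

Let H t := Hev (G t) n tau X (cc - 2 * del) (cc + 2 * del).
Let W1 t := off (map (cross n (2 * n)) s) t.
Let W5 t := off (map (cross (5 * n) (6 * n)) s) t.
Let W2 t := slow (G t) n cs.

Let pps : probs ps. Proof. exact/probs_pe/edges_valid. Qed.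
Let sps : size ps = size s. Proof. exact: size_map. Qed.
Let sm : size m = size ps. Proof. by rewrite !size_map. Qed.
Let Gc t : conn (G t). Proof. exact: Gof_conn. Qed.

Let eta3 : eta <= 3 * del. Proof. by apply: le_trans etad _; rewrite ler_peMl ?ler1n // ltW. Qed.

Let no_cross a b t : (a < b)%N -> size t = size s -> off (map (cross a b) s) t ->
  forall i j, G t i j -> (rad i <= a)%N -> (rad j <= b)%N.
Proof.
move=> ab st o i j Gij ia; rewrite leqNgt; apply/negP => bj.
have l := cross_linf (ltnW ab) ia bj.
suff : ~~ G t i j by rewrite Gij.
apply: off_Gof st o _ _ _; first by lia.
- by rewrite /cross /= ia bj.
- by rewrite /cross /= ia bj orbT.
Qed.

Let calm t : size t = size s -> ~ jumping t -> ~ spread t ->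
  (forall i j, G t i j -> (rad i <= 6 * n)%N -> (rad j <= tau * n)%N) /\
  (forall y, (rad y <= tau * n)%N -> (nd (G t) 0 y)%:R <= del).
Proof.
move=> st /contrapT nj ns; split; first by apply: no_cross => //; rewrite ltn_pmul2r.
by move=> y yt; rewrite leNgt; apply/negP => lt; apply: ns; exists y.
Qed.

Let win_H t : size t = size s -> win eta t -> H t \/ (jumping t \/ spread t).
Proof.
move=> st w; have [j|nj] := pselect (jumping t); first by right; left.
have [sp|ns] := pselect (spread t); first by right; right.
have [h1 h2] := calm st nj ns; left; exact: (win_Hev (Gc t) farX h1 h2 etad w).
Qed.

Let H_win t : size t = size s -> H t -> win (3 * del) t \/ (jumping t \/ spread t).
Proof.
move=> st h; have [j|nj] := pselect (jumping t); first by right; left.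
have [sp|ns] := pselect (spread t); first by right; right.
have [h1 h2] := calm st nj ns; left; exact: (Hev_win (Gc t) farX h1 h2 del0 h).
Qed.

Let out2 (e : vtx d * vtx d) := outer n e.1 && outer n e.2.

Let H_dep : dep (map out2 s) H.
Proof.
move=> t u st su e; rewrite /H /Hev /G.
by rewrite (@Gof_dep d s out2 (outer n) _ t u) // => i j; rewrite /out2 /= => -> ->.
Qed.

Let cross_out a b e : (a <= 6 * n)%N -> cross a b e -> predC out2 e.
Proof.
move=> an; rewrite /cross /out2 /outer /= => /orP[] /andP[h _]; rewrite negb_and -!leqNgt.
  by rewrite (leq_trans h an).
by rewrite (leq_trans h an) orbT.
Qed.

(** The complement of the edges read by [H], so that [H] is independent of the three conditions on
    the annulus. *)
Let W_dep : dep (cmask (map out2 s)) (fun t => (W1 t /\ W5 t) /\ W2 t).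
Proof.
rewrite cmask_map => t u st su e.
rewrite /W1 (@off_dep_sub d s (cross n (2 * n)) (predC out2) _ t u) //; last first.
  by move=> x; apply: cross_out; lia.
rewrite /W5 (@off_dep_sub d s (cross (5 * n) (6 * n)) (predC out2) _ t u) //; last first.
  by move=> x; apply: cross_out; lia.
rewrite /W2 /slow /G (@Gof_dep d s (predC out2) (annulus n) _ t u) // => i j.
by rewrite /annulus /out2 /outer /= => /andP[_ i6] _; rewrite ltnNge i6.
Qed.

Let agree_out t u : size t = size s -> size u = size s ->
  mask (cmask m) t = mask (cmask m) u -> H t -> H u.
Proof.
move=> st su e; suff eH : H t = H u by rewrite eH.
apply: H_dep; rewrite ?size_map //.
have sub (x : vtx d * vtx d) : out2 x -> predC (cross (3 * n) (4 * n)) x.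
  by rewrite /out2 /outer /cross /= => /andP[h1 h2]; lia.
move: e; rewrite /m cmask_map; clear -sub st su.
elim: s t u st su => [|x r IH] [|b t] [|c u] //= [st] [su].
case: (boolP (out2 x)) => ox.
  by move: (sub _ ox) => /= -> [-> /(IH _ _ st su) ->].
by case: (~~ _) => [[_ /(IH _ _ st su)]|/(IH _ _ st su)].
Qed.

Let slow_down : bdown (size s) W2.
Proof.
move=> t u st su tu h i j k i2 j5 w; apply: (h i j k) => //.
apply: walk_sub w => x y /and3P[h1 h2 h3]; apply/and3P; split=> //.
exact: Gof_mono tu h3.
Qed.

(** Stated on the erased configuration, so that it ignores the resampled coordinates, as [Pb_flip]
    requires. *)
Let Y t := [/\ H (erase m t), W1 (erase m t), W5 (erase m t), W2 (erase m t) & tame (erase m t)].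

Let esz (t : seq bool) : size t = size s -> size (erase m t) = size s.
Proof. by move=> st; rewrite size_erase !size_map. Qed.

Let msz (t : seq bool) : size t = size s -> size t = size m.
Proof. by move=> ->; rewrite size_map. Qed.

(** Every resampled edge has an endpoint in the box of radius [3 n], so [H] survives either choice;
    the links shorten the distance by at least the width [2 * eta] of the window. *)
Let flip t : size t = size ps -> Y t ->
  (H (erase m t) /\ ~ win eta (erase m t)) \/
  (forall u, size u = size ps -> mask (cmask m) u = mask (cmask m) t -> linked d n q L u ->
     H u /\ ~ win eta u).
Proof.
rewrite sps => st [hH h1 h5 h2 h3].
have [w|nw] := pselect (win eta (erase m t)); last by left.
right=> u su e lk; split.
  by apply: agree_out (esz st) su _ hH; rewrite e; exact/mask_erase/msz.
have le : leb (erase m t) u.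
  rewrite -(erase_eq (msz su) (msz st) e); exact/erase_leb/msz.
have sub i j : G (erase m t) i j -> G u i j by exact: Gof_mono (esz st) su le.
have sc : (nd (G u) 0 X)%:R + cs <= (nd (G (erase m t)) 0 X)%:R + 2 * kp + 1.
  apply: (shortcut (n := n)) (Gc _) (Gc _) sub farX _ _ h2 _.
  - by apply: no_cross (esz st) h1; lia.
  - by apply: no_cross (esz st) h5; lia.
  - move=> i j /andP[i1 i2] jr.
    have [i' [j' [g [r1 r2] l1 l2]]] := linked_short su lk i2 jr.
    have [j5 j6] := andP jr.
    have le7 a (v : vtx d) : (rad v <= a * n)%N -> (a <= 7)%N -> (rad v <= 7 * n)%N.
      by move=> va a7; apply: leq_trans va _; rewrite leq_mul2r a7 orbT.
    exists i', j'; split; first exact: g.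
      exact: (h3 i i' (le7 2 _ i2 isT) (le7 3 _ r1 isT) l1).
    exact: (h3 j' j r2 (le7 6 _ j6 isT) l2).
exact: leave_window sc eff kp1 w.
Qed.

Variables (w1 w5 w2 b b0 : R).
Hypotheses (w10 : 0 <= w1) (w50 : 0 <= w5) (w20 : 0 <= w2) (b00 : 0 < b0) (b_ge0 : 0 <= b).
Hypotheses (hw1 : w1 <= Pb ps W1) (hw5 : w5 <= Pb ps W5) (hw2 : w2 <= Pb ps W2).
Hypotheses (hb0 : b0 <= Pb ps (fun t => off m t)) (hb : b <= Pb ps (fun t => off m t)).
Hypothesis hlink : b <= Pb ps (linked d n q L).

Let bad := Pb ps jumping + Pb ps spread.

Let Pb_cover (A B C D : seq bool -> Prop) :
  (forall t, size t = size s -> A t -> B t \/ (C t \/ D t)) ->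
  Pb ps A <= Pb ps B + (Pb ps C + Pb ps D).
Proof.
move=> h; rewrite /Pb -!EbD; apply: le_Eb => // t; rewrite sps => st.
case: asboolP => At; last by rewrite !addr_ge0 ?ler0n.
case: (h t st At) => [|[]] x; rewrite (asboolT x); do 2 case: (`[< _ >]) => /=; lra.
Qed.

(** The mass outside the small window but inside the large one is bounded below by [b] times the
    mass of [Y]; [bad] is paid twice, to pass from the small window to [H] and from [H] back to the
    large window. *)
Lemma resample_ineq :
  Pb ps (win eta) + b * ((Pb ps (win eta) - bad) * (w1 * w5 * w2) -
     Pb ps (fun t => ~ tame t) / b0) - bad <= Pb ps (win (3 * del)).
Proof.
have PW : w1 * w5 * w2 <= Pb ps (fun t => (W1 t /\ W5 t) /\ W2 t).
  have d1 : bdown (size ps) W1 by rewrite sps; exact: off_down.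
  have d5 : bdown (size ps) W5 by rewrite sps; exact: off_down.
  have d2 : bdown (size ps) W2 by rewrite sps; exact: slow_down.
  have d15 : bdown (size ps) (fun t => W1 t /\ W5 t).
    by move=> t u st su tu [x y]; split; [exact: d1 tu x|exact: d5 tu y].
  apply: le_trans (harris_down pps d15 d2); apply: ler_pM => //; first exact: mulr_ge0.
  by apply: le_trans (harris_down pps d1 d5); apply: ler_pM.
have PH : Pb ps (win eta) - bad <= Pb ps H.
  by have := Pb_cover win_H; rewrite -/bad; lra.
have PHW : (Pb ps (win eta) - bad) * (w1 * w5 * w2) <=
    Pb ps (fun t => H t /\ ((W1 t /\ W5 t) /\ W2 t)).
  rewrite (@Pb_indep _ ps (map out2 s) H) ?size_map //.
  (* A negative left side is trivially dominated; the product bound needs nonnegative factors. *)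
  have [neg|pos] := ltP (Pb ps (win eta) - bad) 0.
    apply: (@le_trans _ _ 0); first by rewrite mulr_le0_ge0 ?(ltW neg) ?mulr_ge0.
    by rewrite mulr_ge0 ?Pb_ge0.
  by apply: ler_pM; rewrite ?mulr_ge0.
(* Tameness is not monotone under erasing, as fewer edges mean longer distances; its failure is
   controlled through [Pb_erase_le], at the price of [1 / b0]. *)
have PT : Pb ps (fun t => ~ tame (erase m t)) <= Pb ps (fun t => ~ tame t) / b0.
  rewrite ler_pdivlMr //; apply: le_trans (@Pb_erase_le _ ps m (fun t => ~ tame t) pps sm).
  by apply: ler_wpM2l => //; exact: Pb_ge0.
have PY : Pb ps (fun t => H t /\ ((W1 t /\ W5 t) /\ W2 t)) <=
    Pb ps Y + Pb ps (fun t => ~ tame (erase m t)).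
  have := @Pb_cover (fun t => H t /\ ((W1 t /\ W5 t) /\ W2 t)) Y
    (fun t => ~ tame (erase m t)) (fun=> False).
  have -> : Pb ps (fun=> False) = 0.
    by rewrite -(Eb_cst ps 0); apply: eq_Eb => t _; rewrite asboolF.
  rewrite addr0; apply => t st [h [[h1 h5] h2]].
  have [tm|nt] := pselect (tame (erase m t)); last by right; left.
  have le := erase_leb (msz st); have se := esz st.
  left; split=> //.
  - by apply: (agree_out st se _ h); rewrite (mask_erase (msz st)).
  - exact: off_down le h1.
  - exact: off_down le h5.
  - exact: slow_down le h2.
have PF : b * Pb ps Y <= Pb ps (fun t => H t /\ ~ win eta t).
  apply: (@Pb_flip _ ps m Y (linked d n q L)) => //.
  - by move=> t u st su e; rewrite /Y (erase_eq _ _ e) // ?st ?su size_map.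
  - exact: linked_dep.
have PFW : Pb ps (fun t => H t /\ ~ win eta t) <=
    Pb ps (fun t => win (3 * del) t /\ ~ win eta t) + bad.
  apply: Pb_cover => t st [h nw]; case: (H_win st h) => [w|]; by [left|right].
have P1 : Pb ps (win eta) <= Pb ps (fun t => win (3 * del) t /\ win eta t).
  apply: Pb_sub => // t _ w; split=> //; exact: lt_le_trans w eta3.
have := PbDI ps (win (3 * del)) (win eta).
have : b * ((Pb ps (win eta) - bad) * (w1 * w5 * w2) - Pb ps (fun t => ~ tame t) / b0) <=
    b * Pb ps Y by apply: ler_wpM2l => //; lra.
lra.
Qed.

End Resample.

(** * Absence of atoms *)

Section NoAtom.
Variables (R : realType) (d : nat) (beta : R) (dO dO' : measure_display).
Variables (Omega : measurableType dO) (Omega' : measurableType dO').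
Variables (P : probability Omega R) (P' : probability Omega' R).
Variables (E : Omega -> vtx d -> vtx d -> bool) (a : nat -> R).
Variable D : Omega' -> 'rV[R]_d * 'rV[R]_d -> R.
Hypotheses (d0 : (0 < d)%N) (beta0 : 0 < beta) (hE : is_LRP P beta E).
Hypotheses (hmed : is_median_seq P E a).
Hypothesis mD : forall z, measurable_fun setT (fun w => D w z).
Hypothesis cD : forall w, continuous (D w).
Hypothesis cv : cvg_in_law_lu P P' (Dn E a) D.
Variables (a0 : R) (x : 'rV[R]_d).

(** [220 = 20 * 11], where 11 bounds [(2 r n + 1) / n] for [r <= 5]. *)
Let omega : R := expR (- (4 * beta * 220 ^+ d)).

Lemma annulus_off L n r : (0 < n)%N -> (r <= 5)%N ->
  omega <= Pb (map (pe beta) (edges d L))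
    (fun t => off (map (cross (r * n) (r.+1 * n)) (edges d L)) t).
Proof.
move=> n0 r5; apply: le_trans (cross_off d0 beta0 L _); last by rewrite ltn_pmul2r.
have n0' : 0 < n%:R :> R by rewrite ltr0n.
rewrite ler_expR lerN2 ler_pM2l ?mulr_gt0 //; apply: lerXn2r.
- by rewrite nnegrE divr_ge0 ?mulr_ge0 ?ler0n.
- by rewrite nnegrE.
rewrite mulSn addnK ler_pdivrMr // -!natrM ler_nat.
by have : (r * n <= 5 * n)%N by [rewrite leq_mul2r r5 orbT]; lia.
Qed.

(** The number 260 is [20 * 13], from [12 n + 1 <= 13 n]; the probability of a jump is at most the
    total weight, because [1 - expR (- y) <= y]. *)
Lemma jump_small (e : R) : 0 < e -> exists K0 : nat, forall K n L, (K0 <= K)%N -> (0 < n)%N ->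
  Pb (map (pe beta) (edges d L)) (jumping d n (6 + K) L) <= e.
Proof.
move=> e0; pose K0 := maxn 260 (Num.truncn (4 * beta * 260 / e)).+1.
exists K0 => K n L; rewrite geq_max => /andP[K260 Ke] n0.
have K0' : 0 < K%:R :> R by rewrite ltr0n; lia.
have n0' : 0 < n%:R :> R by rewrite ltr0n.
have lt : (6 * n < (6 + K) * n)%N by rewrite ltn_pmul2r //; lia.
have pps := @probs_pe R d beta beta0 _ (edges_valid d L).
rewrite /jumping PbC; have := cross_off d0 beta0 L lt.
set y := 4 * beta * _; have : 1 - y <= expR (- y).
  by have := expR_ge1Dx (- y); lra.
have : y <= e.
  rewrite /y; have h1 : 20 * (6 * n).*2.+1%:R / ((6 + K) * n - 6 * n)%:R <= 260 / K%:R :> R.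
    have -> : ((6 + K) * n - 6 * n = K * n)%N by rewrite mulnDl addnC addnK.
    rewrite ler_pdivrMr ?ltr0n ?muln_gt0 ?n0 ?andbT; last by lia.
    by rewrite natrM mulrA divfK ?gt_eqF // -!natrM ler_nat; lia.
  have h2 : 260 / K%:R <= 1 :> R by rewrite ler_pdivrMr // mul1r ler_nat.
  have h3 : 0 <= 260 / K%:R :> R by rewrite divr_ge0 ?ler0n.
  apply: (@le_trans _ _ (4 * beta * (260 / K%:R) ^+ d)).
    rewrite ler_pM2l ?mulr_gt0 //; apply: lerXn2r; rewrite ?nnegrE.
    - by rewrite divr_ge0 // ?mulr_ge0 // ler0n.
    - exact: h3.
    - exact: h1.
  apply: (@le_trans _ _ (4 * beta * (260 / K%:R))).
    rewrite ler_pM2l ?mulr_gt0 //; case: d d0 => // k _; rewrite exprS.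
    by rewrite ler_piMr // exprn_ile1.
  rewrite mulrA ler_pdivrMr // [e * _]mulrC -ler_pdivrMr //.
  by apply: (le_trans (ltW (truncnS_gt _))); rewrite ler_nat.
lra.
Qed.

Let meas_win (r : R) : measurable [set w | `|D w (0, x) - a0| <= r].
Proof.
rewrite (_ : [set _ | _] = [set w | `[a0 - r, a0 + r]%classic (D w (0, x))]).
  exact: (Dx_measurable mD x (measurable_itv _)).
by apply/seteqP; split=> w /=; rewrite in_itv /= ler_distl.
Qed.

Let m := Pr P' [set w | D w (0, x) = a0].

Lemma window_shrink (e : R) : 0 < e ->
  exists2 r : R, 0 < r & Pr P' [set w | `|D w (0, x) - a0| <= r] <= m + e.
Proof.
move=> e0; have mB : measurable [set w | D w (0, x) = a0].
  exact: (Dx_measurable mD x (measurable_set1 a0)).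
pose F (k : nat) : set Omega' := [set w | `|D w (0, x) - a0| <= k.+1%:R^-1].
have mF k : measurable (F k) by exact: meas_win.
have [] := @Pr_vanish _ _ _ P' (fun k => F k `\` [set w | D w (0, x) = a0]) _
  (fun k => measurableD (mF k) mB) _ _ e0.
- move=> k l kl w [Fw nw]; split=> //; apply: le_trans Fw _.
  by rewrite lef_pV2 ?posrE // ler_nat ltnS.
- rewrite -subset0 => w hw; have [_ ne] := hw 0%N Logic.I.
  have p0 : 0 < `|D w (0, x) - a0| by rewrite normr_gt0 subr_eq0; apply/eqP.
  have [h _] := hw (Num.truncn `|D w (0, x) - a0|^-1) Logic.I.
  move: h; rewrite /F /= leNgt => /negP; apply.
  by rewrite invf_plt ?posrE //; exact: truncnS_gt.
move=> k /(_ k (leqnn k)) h; exists k.+1%:R^-1; first by rewrite invr_gt0.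
have := PrDI P' (mF k) mB.
have := le_Pr P' (measurableI _ _ (mF k) mB) mB (@subIsetr _ _ _); rewrite -/m /F.
lra.
Qed.

Hypothesis x1 : enorm x = 1.

Let coord_neq0 : exists k, 0 < `|x ord0 k|.
Proof.
apply: contrapT => h; move: x1; rewrite /enorm big1 ?sqrtr0; first by move=> /eqP; rewrite eq_sym oner_eq0.
move=> k _; apply/eqP; rewrite expf_eq0 /=; apply/eqP; apply: contrapT => /eqP xk.
by apply: h; exists k; rewrite normr_gt0.
Qed.

Lemma no_atom : m = 0.
Proof.
apply/eqP; rewrite eq_le Pr_ge0 andbT leNgt; apply/negP => m0.
have om0 : 0 < omega by exact: expR_gt0.
have [c0 [w2 [c00 w20 evs]]] := slow_pos d0 beta0 hE hmed mD cD cv.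
pose W := omega * omega * w2.
have W0 : 0 < W by rewrite !mulr_gt0.
(* Bound for the failure of [tame]: divided by [omega] it costs at most [W * m / 4]. The cap [2^-1]
   is for [kp1]. *)
pose ev := Num.min (omega * W * m / 4) 2^-1.
have ev0 : 0 < ev by rewrite lt_min invr_gt0 ltr0n andbT divr_gt0 // !mulr_gt0.
have ev1 : ev <= omega * W * m / 4 by rewrite ge_min lexx.
have ev2 : ev <= 2^-1 by rewrite ge_min lexx orbT.
(* After subtracting [3 * kap], half of the effect [c0] remains. *)
pose kap := c0 / 6.
have kap0 : 0 < kap by rewrite divr_gt0.
have ev20 : 0 < ev / 2 by rewrite divr_gt0.
have [q evq] := small_scale d0 beta0 hE hmed mD cD cv 7 kap0 ev20.
have [p p0 hp] := @linked_pos R d beta d0 beta0 q.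
pose b := Num.min omega p.
have b0 : 0 < b by rewrite lt_min om0 p0.
pose g := b * W * m / 2.
have g0 : 0 < g by rewrite divr_gt0 // !mulr_gt0.
(* With [m / 8], at least [3 / 4 * m] of the mass is left after the losses; with [g / 16], the
   errors, at most [15 / 4 * e1] in all, stay below the gain [g]. *)
pose e1 := Num.min (m / 8) (g / 16).
have e10 : 0 < e1 by rewrite lt_min; apply/andP; split; rewrite divr_gt0.
have e1m : e1 <= m / 8 by rewrite ge_min lexx.
have e1g : e1 <= g / 16 by rewrite ge_min lexx orbT.
have e140 : 0 < e1 / 4 by rewrite divr_gt0.
have [r r0 hr] := window_shrink e10.
pose del := r / 4.
have del0 : 0 < del by rewrite divr_gt0.
have [q2 evq2] := small_scale d0 beta0 hE hmed mD cD cv 1 del0 e140.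
have [K0 hK] := jump_small e140.
have [k xk] := coord_neq0.
(* Besides making jumps rare, [K] is large against [1 / |x_k|], so that [X] lies outside the box of
   radius [6 n]. *)
pose K := maxn (maxn K0 1) (Num.truncn (8 / `|x ord0 k|)).+1.
have KK0 : (K0 <= K)%N by rewrite !leq_max leqnn.
have K1 : (0 < K)%N by rewrite !leq_max ltnSn orbT.
have Kx : 8 <= K%:R * `|x ord0 k|.
  rewrite -ler_pdivrMr //; apply: (le_trans (ltW (truncnS_gt _))).
  by rewrite ler_nat !leq_max leqnn orbT.
pose tau := (6 + K)%N; pose N := (q2.+1 * tau)%N.
have [C C0 evC] := growth d0 beta0 hE hmed mD cD cv N.
(* As [a M <= C * a n], the small window has half-width at most [c0 / 4 * a n], half of what the
   resampling moves. *)
pose eta := Num.min del (c0 / (4 * C)).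
have eta0 : 0 < eta by rewrite lt_min del0 divr_gt0 // mulr_gt0.
have etad : eta <= del by rewrite ge_min lexx.
have etaC : eta * C <= c0 / 4.
  rewrite -ler_pdivlMr // -mulrA -invfM; by rewrite ge_min lexx orbT.
have evl := window_lower d0 beta0 hE hmed mD cv a0 x eta0 e140.
have evu := window_upper d0 beta0 hE hmed mD cv a0 x del0 e140.
have N0 : (0 < N)%N by rewrite muln_gt0.
have evM Q : evt Q -> evt (fun n => Q (N * n)%N).
  move=> [n0 h]; exists n0 => n nn; apply: h; apply: leq_trans nn _.
  exact: leq_pmull.
have [n0 hn] := evt_and (evt_and (evt_and evs evq) (evt_and evC (evt_ge q.+1)))
  (evt_and (evM _ evq2) (evt_and (evM _ evl) (evM _ evu))).
pose n := n0; have [[[hs hq] [hC nq]] [hq2 [hl hu]]] := hn n (leqnn _).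
have n_gt0 : (0 < n)%N by exact: leq_trans nq.
pose M := (N * n)%N; rewrite -/M in hq2 hl hu.
have M0 : (0 < M)%N by rewrite muln_gt0 N0.
have an0 : 0 < a n by exact: (a_gt0 d0 beta0 hE hmed).
have aM0 : 0 < a M by exact: (a_gt0 d0 beta0 hE hmed).
have aMC : a M <= C * a n by exact: hC.
pose X := floor_scale M x.
have farX : (6 * n < rad X)%N.
  apply: leq_trans (linf_ge X 0 k); rewrite -(ltr_nat R) [X in `|_ - X|%N]mxE subr0.
  rewrite -norm_int mxE.
  have /andP[f1 f2] := floor_itv (M%:R * x ord0 k).
  rewrite intrD in f2.
  have hM : 8 * n%:R <= M%:R * `|x ord0 k|.
    apply: (@le_trans _ _ (K%:R * `|x ord0 k| * n%:R)); first by rewrite ler_wpM2r ?ler0n.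
    rewrite mulrAC -natrM ler_wpM2r ?normr_ge0 // ler_nat leq_mul2r.
    by rewrite (leq_trans (leq_addl 6 K)) ?orbT // leq_pmull.
  have : 1 <= n%:R :> R by rewrite ler1n.
  move: hM f1 f2; rewrite [(6 * n)%:R]natrM.
  have -> : M%:R * `|x ord0 k| = `|M%:R * x ord0 k| by rewrite normrM normr_nat.
  move: (M%:R * x ord0 k) (Num.floor _)%:~R => y F hM f1 f2 n1.
  have := lerB_dist y F; have : `|y - F| <= 1 by rewrite ler_norml; apply/andP; split; lra.
  lra.
(* Otherwise 0 and its neighbour [const_mx 1], at distance at least 1, would violate the modulus of
   continuity with probability 1. *)
have kp1 : 1 <= kap * a n.
  rewrite leNgt; apply/negP => lt.
  have : 1 <= ev / 2.
    rewrite -[X in X <= _](PrT P); apply: le_trans hq; apply: le_Pr => //.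
      exact: (exists_measurable hE _ (fun _ _ k => kap * a n < k%:R)).
    move=> w _; exists 0, (const_mx 1); split.
      have l1 : (linf (0%R : vtx d) (const_mx 1%R) <= 1)%N.
        by apply/linf_leP => l; rewrite !mxE.
      split; first by rewrite rad0.
        by rewrite /rad linf_sym (leq_trans l1) // muln_gt0.
      by apply: leq_trans nq; rewrite -[X in (_ <= X)%N]mul1n leq_mul2r l1 orbT.
    apply: lt_le_trans lt _; rewrite ler1n lt0n; apply/eqP => /(nd_eq0 (lrp_conn hE w)) e.
    have := congr1 (fun v : vtx d => v ord0 (Ordinal d0)) e; by rewrite !mxE.
  lra.
have eff : 2 * (eta * a M) <= c0 * a n - 3 * (kap * a n).
  have : eta * a M <= eta * (C * a n) by rewrite ler_pM2l.
  rewrite mulrA => h; have h2 := ler_wpM2r (ltW an0) etaC.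
  have -> : c0 * a n - 3 * (kap * a n) = 2 * (c0 / 4 * a n) by rewrite /kap; field.
  lra.
pose rr := maxn (maxn (7 * n) (tau * n)) (rad X).
pose er := Num.min (ev / 2) (e1 / 4).
have er0 : 0 < er by rewrite lt_min ev20 e140.
have er1 : er <= ev / 2 by rewrite ge_min lexx.
have er2 : er <= e1 / 4 by rewrite ge_min lexx orbT.
(* Only now is the finite box chosen: the bounds on [Pb] above hold for all large [L]. *)
have [L0 hL] := trunc_cvg hE rr er0.
pose L := maxn L0 (7 * n); have {}hL := hL L (leq_maxl _ _).
have nL : (7 * n <= L)%N by rewrite leq_maxr.
have mtr := trunc_ok_measurable hE L rr.
have ptr : Pr P (~` trunc_ok E L rr) <= er by rewrite PrC //; lra.
have vs := edges_valid d L.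
set ps := map (pe beta) (edges d L).
have r7 (i : vtx d) : (rad i <= 7 * n)%N -> (rad i <= rr)%N by move=> h; rewrite !leq_max h.
have rt (i : vtx d) : (rad i <= tau * n)%N -> (rad i <= rr)%N by move=> h; rewrite !leq_max h orbT.
have rX : (rad X <= rr)%N by rewrite leq_max leqnn orbT.
have rO : (rad (0%R : vtx d) <= rr)%N by rewrite rad0.
have up (A : seq bool -> Prop) (B : set Omega) : measurable B ->
    (forall w, trunc_ok E L rr w -> A (cfg E w (edges d L)) -> B w) ->
    Pb ps A <= Pr P B + er.
  move=> mB h; rewrite -(cfg_law hE _ vs).
  apply: (@le_trans _ _ (Pr P B + Pr P (~` trunc_ok E L rr))); last by rewrite lerD2l.
  apply: le_PrU => //; [exact: (cfg_measurable hE)|exact: measurableC|].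
  by move=> w Aw; have [ok|] := pselect (trunc_ok E L rr w); [left; exact: h|right].
have mwin e : measurable [set w | `|(nd (E w) 0 X)%:R - a0 * a M| < e * a M].
  exact: (nd_measurable hE (fun k => `|k%:R - a0 * a M| < e * a M)).
have P3 : Pb ps (win L X (a0 * a M) (3 * (del * a M))) <= m + 2 * e1.
  apply: le_trans (up _ _ (mwin (3 * del)) _) _.
    by move=> w ok; rewrite /win /= ok // mulrA.
  by move: hu; rewrite (_ : 4 * del = r); [lra|rewrite /del; field].
have P1 : m - e1 <= Pb ps (win L X (a0 * a M) (eta * a M)).
  have mw := mwin eta.
  have := up (fun t => ~ win L X (a0 * a M) (eta * a M) t) _ (measurableC mw).
  rewrite PbC PrC //; rewrite -/m in hl.
  have h : forall w, trunc_ok E L rr w -> ~ win L X (a0 * a M) (eta * a M) (cfg E w (edges d L)) ->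
      (~` [set w | `|(nd (E w) 0 (floor_scale M x))%:R - a0 * a M| < eta * a M]) w.
    by move=> w ok; rewrite /win /= ok.
  by move=> /(_ h); lra.
have Psp : Pb ps (spread d n tau L (del * a M)) <= e1 / 2.
  apply: le_trans (up _ _ (exists_measurable hE (fun i j => [/\ (rad i <= 1 * M)%N,
    (rad j <= 1 * M)%N & (linf i j * q2.+1 <= M)%N]) (fun _ _ k => del * a M < k%:R)) _) _.
    move=> w ok [y yt]; rewrite (ok 0 y rO (rt y yt)) => lt; exists 0, y; split=> //.
    rewrite rad0 !mul1n /M /N -mulnA; split=> //.
      by apply: leq_trans yt _; rewrite leq_pmull.
    by rewrite linf_sym mulnC leq_mul2l.
  by move: hq2; lra.
have Pj : Pb ps (jumping d n tau L) <= e1 / 4 by exact: hK.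
have Pt : Pb ps (fun t => ~ tame d n q L (kap * a n) t) <= ev.
  apply: le_trans (up _ _ (exists_measurable hE (fun i j => [/\ (rad i <= 7 * n)%N,
    (rad j <= 7 * n)%N & (linf i j * q.+1 <= n)%N]) (fun _ _ k => kap * a n < k%:R)) _) _.
    move=> w ok nt; apply: contrapT => ne; apply: nt => i j i7 j7 lij.
    rewrite (ok i j (r7 i i7) (r7 j j7)) leNgt; apply/negP => lt; apply: ne.
    by exists i, j.
  by move: hq; lra.
have o1 := annulus_off L n_gt0 (isT : (1 <= 5)%N); rewrite mul1n in o1.
have o3 := annulus_off L n_gt0 (isT : (3 <= 5)%N).
have o5 := annulus_off L n_gt0 (isT : (5 <= 5)%N).
have tau6 : (6 < tau)%N by rewrite /tau -addn1 leq_add2l.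
have dM0 : 0 < del * a M by rewrite mulr_gt0.
have eM : eta * a M <= del * a M by rewrite ler_pM2r.
have bo : b <= omega by rewrite ge_min lexx.
have bp : b <= Pb ps (linked d n q L).
  by apply: le_trans (hp n L n_gt0 nL); rewrite ge_min lexx orbT.
move: P1 P3 Psp Pj Pt.
set p1 := Pb ps (win L X (a0 * a M) (eta * a M)).
set p3 := Pb ps (win L X (a0 * a M) (3 * (del * a M))).
set psp := Pb ps (spread _ _ _ _ _); set pj := Pb ps (jumping _ _ _ _).
set pt := Pb ps (fun t => ~ tame _ _ _ _ _ t) => P1 P3 Psp Pj Pt.
have hh : p1 + b * ((p1 - (pj + psp)) * W - pt / omega) - (pj + psp) <= p3.
  exact: (resample_ineq (a0 * a M) beta0 n_gt0 tau6 farX dM0 eM kp1 eff (ltW om0)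
    (ltW om0) (ltW w20) om0 (ltW b0) o1 o5 (hs L) o3 (le_trans bo o3) bp).
have v1 : pt / omega <= W * m / 4.
  by rewrite ler_pdivrMr //; apply: le_trans Pt _; apply: le_trans ev1 _; lra.
have v2 : 3 / 4 * m * W <= (p1 - (pj + psp)) * W by rewrite ler_pM2r //; lra.
have v3 : b * (W * m / 2) <= b * ((p1 - (pj + psp)) * W - pt / omega).
  by rewrite ler_pM2l //; lra.
have gE : g = b * (W * m / 2) by rewrite /g; ring.
lra.
Qed.


End NoAtom.

Theorem theorem1p2 (R : realType) (d : nat) (beta : R)
    (dO dO' : measure_display) (Omega : measurableType dO) (Omega' : measurableType dO')
    (P : probability Omega R) (P' : probability Omega' R)
    (E : Omega -> vtx d -> vtx d -> bool) (a : nat -> R)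
    (D : Omega' -> 'rV[R]_d * 'rV[R]_d -> R) :
  (1 <= d)%N -> 0 < beta ->
  is_LRP P beta E ->
  is_median_seq P E a ->
  (forall z, measurable_fun setT (fun w => D w z)) ->
  (forall w, continuous (D w)) ->
  cvg_in_law_lu P P' (Dn E a) D ->
  forall (a0 : R) (x : 'rV[R]_d), 0 <= a0 -> enorm x = 1 ->
    (fun eps : R => P' [set w | a0 - eps < D w (0, x) < a0 + eps])
      @ 0^'+ --> 0%E.
Proof.
move=> d0 beta0 hE hmed mD cD cv a0 x _ x1.
have mS (A : set R) : measurable A -> measurable [set w | A (D w (0, x))].
  exact: (Dx_measurable mD).
have mO eps : measurable [set w | a0 - eps < D w (0, x) < a0 + eps].
  rewrite (_ : [set _ | _] = [set w | `]a0 - eps, a0 + eps[%classic (D w (0, x))]).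
    exact: (mS _ (measurable_itv _)).
  by apply/seteqP; split=> w /=; rewrite in_itv.
have mC eps : measurable [set w | `|D w (0, x) - a0| <= eps].
  rewrite (_ : [set _ | _] = [set w | `[a0 - eps, a0 + eps]%classic (D w (0, x))]).
    exact: (mS _ (measurable_itv _)).
  by apply/seteqP; split=> w /=; rewrite in_itv /= ler_distl.
have atom := no_atom d0 beta0 hE hmed mD cD cv a0 x1.
apply/fine_cvgP; split.
  by apply: nearW => eps; exact: fin_num_measure.
apply/cvgrPdist_le => e e0.
have [r r0 hr] := window_shrink P' mD a0 x e0.
(* Without an atom, a closed window of radius [r] has mass at most [e], and it contains all smaller
   open windows. *)
rewrite atom add0r in hr.
near=> eps; rewrite sub0r normrN ger0_norm /=; last exact: Pr_ge0.
apply: le_trans hr; apply: le_Pr => // w /= /andP[h1 h2].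
have er : eps < r by near: eps; exact: nbhs_right_lt.
by rewrite ler_distl; apply/andP; split; lra.
Unshelve. all: by end_near.
Qed.
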